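(* Let $(w(t))_{t\ge0}$ be a Brownian motion on $\mathbb{H}P^n$ started at $0$ and let $\mathfrak a(t)$ be its quaternionic stochastic area process. For $\lambda\in[0,\infty)^3$ and $t\ge0$, $$\mathbb{E}\left(e^{i\lambda\cdot\mathfrak a(t)}\right)=e^{-2n\mu t}\int_0^{\pi/2}\frac{q_t^{2n-1,\mu+1}(0,r)}{(\cos r)^{\mu}}\,dr,$$ where $\mu=\sqrt{|\lambda|^2+1}-1$.
   Context: $n\ge1$. $\mathbb{H}$ is the field of quaternions with units $I,J,K$; imaginary quaternions $xI+yJ+zK$ are identified with $(x,y,z)\in\mathbb{R}^3$. The quaternionic projective space $\mathbb{H}P^n$ is described by inhomogeneous coordinates $w=(w_1,\dots,w_n)\in\mathbb{H}^n$ (valid off a set which Brownian motion started at $0$ almost surely never hits), in which its Riemannian metric is $\frac{\sum_j|dw_j|^2}{1+|w|^2}-\frac{|\sum_j dw_j\overline{w_j}|^2}{(1+|w|^2)^2}$; $0$ is the point $w=0$. Brownian motion has generator $\frac12\Delta_{\mathbb{H}P^n}$ (half the Laplace–Beltrami operator). Its quaternionic stochastic area process is $$\mathfrak a(t)=\frac12\sum_{j=1}^n\int_0^t\frac{dw_j(s)\overline{w_j}(s)-w_j(s)d\overline{w_j}(s)}{1+|w(s)|^2}\in\mathbb{R}^3$$ (Stratonovich, equivalently Itô, integrals). For $\alpha,\beta>-1$, $q_t^{\alpha,\beta}(r_0,r)$ denotes the transition density with respect to Lebesgue measure $dr$ on $[0,\pi/2]$ of the diffusion (circular Jacobi process) with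 generator $$\mathcal{L}^{\alpha,\beta}=\frac12\frac{\partial^2}{\partial r^2}+\left(\left(\alpha+\tfrac12\right)\cot r-\left(\beta+\tfrac12\right)\tan r\right)\frac{\partial}{\partial r};$$ for $t=0$, $q_0^{\alpha,\beta}(0,r)\,dr$ is read as the Dirac mass at $0$. $|\lambda|$ is the Euclidean norm. *)

(* Defs.v *)
From HB Require Import structures.
From mathcomp Require Import all_boot all_order all_algebra.
From mathcomp Require Import all_classical all_reals all_analysis.
From mathcomp Require Import complex.

Set Implicit Arguments.
Unset Strict Implicit.
Unset Printing Implicit Defensive.

Import Order.TTheory GRing.Theory Num.Theory.
Import numFieldNormedType.Exports.

Local Open Scope classical_set_scope.
Local Open Scope ring_scope.
Local Open Scope complex_scope.

(* The quaternion [a + b I + c J + d K] is the row vector [(a, b, c, d)]. *)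

Definition mkquat (R : realType) (a b c d : R) : 'rV[R]_4 :=
  \row_(k < 4) nth 0 [:: a; b; c; d] k.

(* [xI + yJ + zK] is identified with [(x, y, z)]. *)
Definition qim (R : realType) (p : 'rV[R]_4) : 'rV[R]_3 :=
  \row_(k < 3) p 0 (lift ord0 k).

Definition qmul (R : realType) (p q : 'rV[R]_4) : 'rV[R]_4 :=
  let p_ k := p 0 (inord k) in
  let q_ k := q 0 (inord k) in
  mkquat
    (p_ 0 * q_ 0 - p_ 1 * q_ 1 - p_ 2 * q_ 2 - p_ 3 * q_ 3)
    (p_ 0 * q_ 1 + p_ 1 * q_ 0 + p_ 2 * q_ 3 - p_ 3 * q_ 2)
    (p_ 0 * q_ 2 - p_ 1 * q_ 3 + p_ 2 * q_ 0 + p_ 3 * q_ 1)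
    (p_ 0 * q_ 3 + p_ 1 * q_ 2 - p_ 2 * q_ 1 + p_ 3 * q_ 0).

Definition qconj (R : realType) (p : 'rV[R]_4) : 'rV[R]_4 :=
  \row_(k < 4) (if k == 0 then p 0 k else - p 0 k).

(* Euclidean inner product and norm on R^m; for m = 4 the norm is the
   quaternionic modulus. *)
Definition edot (R : realType) (m : nat) (u v : 'rV[R]_m) : R :=
  \sum_(k < m) u 0 k * v 0 k.

Definition enorm (R : realType) (m : nat) (u : 'rV[R]_m) : R :=
  Num.sqrt (edot u u).

(* A point of the affine chart H^n of HP^n is a matrix [w] whose row [j] is the
   quaternion [w_j]. *)

Definition hnorm2 (R : realType) (n : nat) (w : 'M[R]_(n, 4)) : R :=
  \sum_(j < n) enorm (row j w) ^+ 2.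

(* Polarization of
   [sum_j |dw_j|^2 / (1 + |w|^2)
    - |sum_j dw_j * conj w_j|^2 / (1 + |w|^2)^2]. *)
Definition hp_metric (R : realType) (n : nat) (w u v : 'M[R]_(n, 4)) : R :=
  let pairing x : 'rV[R]_4 :=
    \sum_(j < n) qmul (row j x) (qconj (row j w)) in
  (\sum_(j < n) edot (row j u) (row j v)) / (1 + hnorm2 w)
  - edot (pairing u) (pairing v) / (1 + hnorm2 w) ^+ 2.

Definition hbasis (R : realType) (n : nat) (i : 'I_(n * 4)) : 'M[R]_(n, 4) :=
  vec_mx (delta_mx 0 i).
Arguments hbasis : clear implicits.

Definition partial (R : realType) (n : nat) (i : 'I_(n * 4))
    (f : 'M[R]_(n, 4) -> R) : 'M[R]_(n, 4) -> R :=
  fun x => 'D_(hbasis R n i) f x.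

Definition hp_gram (R : realType) (n : nat) (w : 'M[R]_(n, 4)) :
    'M[R]_(n * 4) :=
  \matrix_(i, j) hp_metric w (hbasis R n i) (hbasis R n j).

Definition laplace_beltrami (R : realType) (n : nat)
    (f : 'M[R]_(n, 4) -> R) : 'M[R]_(n, 4) -> R :=
  fun x =>
    (Num.sqrt (\det (hp_gram x)))^-1 *
    \sum_i \sum_j
      partial i (fun y => Num.sqrt (\det (hp_gram y)) *
                          invmx (hp_gram y) i j * partial j f y) x.

Fixpoint Ck (R : realType) (n : nat) (k : nat) (f : 'M[R]_(n, 4) -> R)
    : Prop :=
  continuous f /\
  match k with
  | 0 => True
  | k'.+1 => forall i, (forall x, derivable f x (hbasis R n i)) /\
                       Ck k' (partial i f)
  end.

Definition test_function (R : realType) (n : nat) (f : 'M[R]_(n, 4) -> R) :=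
  (forall k, Ck k f) /\ compact (closure [set x | f x != 0]).

(* Processes are indexed by R, but only their values at times [t >= 0] matter. *)

Definition filtration (d : measure_display) (Omega : measurableType d)
    (R : realType) (F : R -> set (set Omega)) : Prop :=
  [/\ forall t, 0 <= t -> sigma_algebra setT (F t),
      forall t, 0 <= t -> F t `<=` measurable
    & forall s t, 0 <= s -> s <= t -> F s `<=` F t].

Definition adapted (d : measure_display) (Omega : measurableType d)
    (R : realType) (E : topologicalType) (F : R -> set (set Omega))
    (X : R -> Omega -> E) : Prop :=
  forall t, 0 <= t -> forall U : set E, open U -> F t (X t @^-1` U).

(* The last clause is [E[M_t | F_s] = M_s] a.s. *)
Definition martingale (d : measure_display) (Omega : measurableType d)
    (R : realType) (P : probability Omega R) (F : R -> set (set Omega))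
    (M : R -> Omega -> R) : Prop :=
  [/\ adapted F M,
      forall t, 0 <= t -> P.-integrable setT (EFin \o M t)
    & forall s t, 0 <= s -> s <= t -> forall A, F s A ->
        \int[P]_(x in A) M t x = \int[P]_(x in A) M s x].

(* A diffusion started at [x0], as a continuous solution of the martingale
   problem; [gen f g] reads "[f] is an admissible test function and the
   generator maps it to [g]".  Since continuity of the paths is only required
   almost surely, the time integral below may be junk on a null set; hence the
   martingale [M] is only asked to be a version of the displayed process. *)
Definition diffusion (d : measure_display) (Omega : measurableType d)
    (R : realType) (P : probability Omega R) (E : topologicalType)
    (gen : (E -> R) -> (E -> R) -> Prop) (F : R -> set (set Omega))
    (x0 : E) (X : R -> Omega -> E) : Prop :=
  [/\ filtration F, adapted F X,
      {ae P, forall omega, X 0 omega = x0},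
      {ae P, forall omega,
         {within `[0%R, +oo[, continuous (fun t : R => X t omega)}}
    & forall f g, gen f g -> exists M, martingale P F M /\
        forall t, 0 <= t -> {ae P, forall omega,
          M t omega = f (X t omega) - f (X 0 omega)
            - \int[lebesgue_measure]_(s in `[0, t]) g (X s omega)}].

(* Brownian motion on HP^n, read in the affine chart (whose complement is
   almost surely never hit), started at [w = 0]. *)
Definition brownian_motion_HP (d : measure_display) (Omega : measurableType d)
    (R : realType) (P : probability Omega R) (n : nat)
    (F : R -> set (set Omega)) (w : R -> Omega -> 'M[R]_(n, 4)) : Prop :=
  diffusion P
    (fun f g => test_function f /\
                g = (fun x => 2^-1 * laplace_beltrami f x))
    F 0 w.

Definition mesh (R : realType) (a : R) (s : seq R) : R :=
  \big[Num.max/0]_(i < size s) (nth 0 s i - nth 0 (a :: s) i).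

(* Stratonovich (midpoint) sum along the partition [0 :: s] of
   [1/2 sum_j int (dw_j * conj w_j - w_j * d(conj w_j)) / (1 + |w|^2)]. *)
Definition area_sum (R : realType) (n : nat) (w : R -> 'M[R]_(n, 4))
    (s : seq R) : 'rV[R]_4 :=
  let mid (X : R -> 'rV[R]_4) i : 'rV[R]_4 :=
    2^-1 *: (X (nth 0 (0 :: s) i) + X (nth 0 s i)) in
  let incr (X : R -> 'rV[R]_4) i : 'rV[R]_4 :=
    X (nth 0 s i) - X (nth 0 (0 :: s) i) in
  let rho u : R := (1 + hnorm2 (w u))^-1 in
  2^-1 *: \sum_(j < n) \sum_(i < size s)
    (qmul (incr (fun u => row j (w u)) i)
          (mid (fun u => rho u *: qconj (row j (w u))) i)
     - qmul (mid (fun u => rho u *: row j (w u)) i)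
            (incr (fun u => qconj (row j (w u))) i)).

Definition cvg_in_probability (d : measure_display)
    (Omega : measurableType d) (R : realType) (P : probability Omega R)
    (X : nat -> Omega -> R) (Y : Omega -> R) : Prop :=
  forall e : R, 0 < e ->
    P [set omega | e < `|X k omega - Y omega|] @[k --> \oo] --> 0%E.

(* [area_sum] takes values in the imaginary quaternions, so that nothing is
   lost by applying [qim]. *)
Definition quaternionic_area (d : measure_display) (Omega : measurableType d)
    (R : realType) (P : probability Omega R) (n : nat)
    (w : R -> Omega -> 'M[R]_(n, 4)) (a : R -> Omega -> 'rV[R]_3) : Prop :=
  forall (t : R) (k : 'I_3), 0 <= t ->
    measurable_fun setT (fun omega => a t omega 0 k) /\
    forall s : nat -> seq R,
      (forall m, itv_partition 0 t (s m)) ->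
      mesh 0 (s m) @[m --> \oo] --> (0 : R) ->
      cvg_in_probability P
        (fun m omega => qim (area_sum (fun u => w u omega) (s m)) 0 k)
        (fun omega => a t omega 0 k).

Definition jacobi_op (R : realType) (alpha beta : R) (f : R -> R) (r : R) : R :=
  2^-1 * derive1n 2 f r
  + ((alpha + 2^-1) * (cos r / sin r) - (beta + 2^-1) * tan r) * derive1 f r.

(* Test functions are C^2 with vanishing derivative at both end points
   (reflection there if the end point is reached at all); then [L f] extends
   continuously to the closed interval, where the coefficients are singular. *)
Definition jacobi_gen (R : realType) (alpha beta : R) (f g : R -> R) : Prop :=
  [/\ (forall x, derivable f x 1) /\ (forall x, derivable (derive1 f) x 1),
      continuous (derive1n 2 f),
      derive1 f 0 = 0 /\ derive1 f (pi / 2) = 0,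
      {within `[0, pi / 2], continuous g}
    & forall r, 0 < r < pi / 2 -> g r = jacobi_op alpha beta f r].

Definition jacobi_process (d : measure_display) (Omega : measurableType d)
    (R : realType) (P : probability Omega R) (alpha beta : R)
    (F : R -> set (set Omega)) (r0 : R) (X : R -> Omega -> R) : Prop :=
  diffusion P (jacobi_gen alpha beta) F r0 X /\
  {ae P, forall omega, forall t, 0 <= t -> 0 <= X t omega <= pi / 2}.

(* [q t r0] is, for t > 0, the density on [0, pi/2] of the law at time [t] of
   the diffusion started at [r0]. *)
Definition jacobi_transition_density (R : realType) (alpha beta : R)
    (q : R -> R -> R -> R) : Prop :=
  (forall t r0, 0 < t -> 0 <= r0 <= pi / 2 ->
     measurable_fun `[0, pi / 2] (q t r0) /\
     forall r, 0 <= r <= pi / 2 -> 0 <= q t r0 r) /\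
  (forall r0, 0 <= r0 <= pi / 2 ->
     exists (d : measure_display) (Omega : measurableType d)
       (P : probability Omega R) (F : R -> set (set Omega))
       (X : R -> Omega -> R),
       jacobi_process P alpha beta F r0 X /\
       forall t (B : set R), 0 < t -> measurable B ->
         P (X t @^-1` B) =
         (\int[lebesgue_measure]_(r in `[0%R, (pi / 2)%R] `&` B)
            (q t r0 r)%:E)%E).

(* [int_0^(pi/2) q_t(r0, r) h(r) dr], where [q_0(r0, r) dr] is the Dirac mass
   at [r0]. *)
Definition transition_integral (R : realType) (q : R -> R -> R -> R)
    (t r0 : R) (h : R -> R) : R :=
  if t == 0 then \int[\d_r0]_(r in `[0, pi / 2]) h r
  else \int[lebesgue_measure]_(r in `[0, pi / 2]) (q t r0 r * h r).

Definition expi (R : realType) (theta : R) : R[i] := cos theta +i* sin theta.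

Definition cexpectation (d : measure_display) (Omega : measurableType d)
    (R : realType) (P : probability Omega R) (Z : Omega -> R[i]) : R[i] :=
  (\int[P]_x complex.Re (Z x)) +i* (\int[P]_x complex.Im (Z x)).

(* Main.v *)
(* Write v = |w|^2 and x = 1 / (1 + v).  The process lambda.a is a martingale with
   bracket |lambda|^2 v dt, orthogonal to the radial functions of w.  Therefore
   E[cos (tau + lambda.a_t) f(w_t)], for radial f, evolves by the generator minus
   the potential |lambda|^2 v / 2.  This operator maps x^(mu/2 + m) to a combination
   of x^(mu/2 + m) and x^(mu/2 + m - 1), exactly as the Jacobi generator, shifted by
   - 2 n mu, acts on cos^(2m).  So the quantities E[cos (tau + lambda.a_t) x_t^(mu/2 + m)]
   and cos tau e^(- 2 n mu t) E[cos^(2m) X_t] solve the same triangular linear system.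
   Summing the binomial series of x^(- mu/2) removes the weight; tau = 0 and
   tau = - pi/2 give the real and imaginary parts.

   In place of Ito's formula, the area is replaced by its midpoint sums along uniform
   partitions of mesh h.  A term of such a sum is a function of two consecutive
   positions which is a finite sum of products, so that Taylor's formula and the
   martingale problem give the recursion up to O(h^(3/2)) per step.  Cutting off at
   ln (1 + v) = M makes the test functions compactly supported, at the cost O(1/M). *)

Require Import Defs.
From mathcomp Require Import all_boot all_order all_algebra.
From mathcomp Require Import all_classical all_reals all_analysis.
From mathcomp Require Import complex.
From mathcomp Require Import measurable_realfun ring lra.

Import Order.TTheory GRing.Theory Num.Theory.
Import numFieldNormedType.Exports.

Set Implicit Arguments.
Unset Strict Implicit.
Unset Printing Implicit Defensive.

Local Open Scope classical_set_scope.
Local Open Scope ring_scope.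

(** * Expectations and conditioning *)

(** Applied to [x^b], the generator minus the potential has coefficient
    [2 b (b + 1) - |lambda|^2 / 2] on [x^(b - 1)]. The value of [mu] makes it vanish at
    [b = mu / 2]: this is why the system is triangular, and [x^(mu/2)] is an eigenfunction whose
    eigenvalue [- 2 n mu] is the exponential rate of the theorem. The cutoff is a function of
    [ln (1 + v)] because the generator maps [ln (1 + v)] to [4 n - 2 v], with carre du champ [4 v].
    It creates an error of order [(1 + v) / M], which is not uniformly small in space. The same
    drift [- 2 v] bounds the time integral of the mean of [1 + v] over the ball [ln (1 + v) <= M]
    independently of [M], so the error is [O(1/M)] after all. The cubic Taylor remainder of the
    cosine is not smooth in the area increment, so the martingale problem says nothing about it
    directly; it is dominated by the second and fourth powers, which are smooth. The parameter [tau]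
    keeps every quantity real: a cosine with a phase carries both parts of the exponential. *)

Section bounded_random_variables.
Context (R : realType) (d : measure_display) (Omega : measurableType d)
  (P : probability Omega R).
Implicit Types X Y Z : Omega -> R.

Definition bounded_rv X : Prop :=
  measurable_fun setT X /\ exists C : R, forall omega, `|X omega| <= C.

Definition expect X : R := \int[P]_omega X omega.

Lemma bounded_rv_integrable X : bounded_rv X -> P.-integrable setT (EFin \o X).
Proof.
move=> [mX [C XC]]; apply: (@le_integrable _ _ _ P setT measurableT _ (cst C%:E)).
- exact/measurable_EFinP.
- by move=> x _ /=; rewrite lee_fin (le_trans (XC x))// ler_norm.
- exact: finite_measure_integrable_cst.
Qed.

Lemma bounded_rv_cst c : bounded_rv (fun=> c).
Proof. by split; [exact: measurable_cst | exists `|c|]. Qed.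

Lemma bounded_rvD X Y : bounded_rv X -> bounded_rv Y ->
  bounded_rv (fun omega => X omega + Y omega).
Proof.
move=> [mX [C XC]] [mY [D YD]]; split; first exact: measurable_funD.
by exists (C + D) => x; rewrite (le_trans (ler_normD _ _))// lerD.
Qed.

Lemma bounded_rvM X Y : bounded_rv X -> bounded_rv Y ->
  bounded_rv (fun omega => X omega * Y omega).
Proof.
move=> [mX [C XC]] [mY [D YD]]; split; first exact: measurable_funM.
by exists (C * D) => x; rewrite normrM ler_pM.
Qed.

Lemma bounded_rvN X : bounded_rv X -> bounded_rv (fun omega => - X omega).
Proof.
move=> [mX [C XC]]; split; first exact: measurableT_comp.
by exists C => x; rewrite normrN.
Qed.

Lemma bounded_rvB X Y : bounded_rv X -> bounded_rv Y ->
  bounded_rv (fun omega => X omega - Y omega).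
Proof. by move=> bX bY; apply: bounded_rvD => //; exact: bounded_rvN. Qed.

Lemma bounded_rv_norm X : bounded_rv X -> bounded_rv (fun omega => `|X omega|).
Proof.
move=> [mX [C XC]]; split; first exact: measurableT_comp.
by exists C => x; rewrite normr_id.
Qed.

Lemma bounded_rv_sum (I : Type) (s : seq I) (X : I -> Omega -> R) :
  (forall i, bounded_rv (X i)) ->
  bounded_rv (fun omega => \sum_(i <- s) X i omega).
Proof.
move=> bX; elim: s => [|i s IH].
  by under eq_fun do rewrite big_nil; exact: bounded_rv_cst.
by under eq_fun do rewrite big_cons; exact: bounded_rvD.
Qed.

Lemma expect_cst c : expect (fun=> c) = c.
Proof.
rewrite /expect Rintegral_cst// -[RHS]mulr1; congr (c * _).
exact: (congr1 fine (probability_setT P)).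
Qed.

Lemma expectD X Y : bounded_rv X -> bounded_rv Y ->
  expect (fun omega => X omega + Y omega) = expect X + expect Y.
Proof. by move=> bX bY; rewrite /expect RintegralD//; exact: bounded_rv_integrable. Qed.

Lemma expectB X Y : bounded_rv X -> bounded_rv Y ->
  expect (fun omega => X omega - Y omega) = expect X - expect Y.
Proof. by move=> bX bY; rewrite /expect RintegralB//; exact: bounded_rv_integrable. Qed.

Lemma expectZ c X : bounded_rv X ->
  expect (fun omega => c * X omega) = c * expect X.
Proof. by move=> bX; rewrite /expect RintegralZl//; exact: bounded_rv_integrable. Qed.

Lemma expect_sum (I : Type) (s : seq I) (X : I -> Omega -> R) :
  (forall i, bounded_rv (X i)) ->
  expect (fun omega => \sum_(i <- s) X i omega) = \sum_(i <- s) expect (X i).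
Proof.
move=> bX; elim: s => [|i s IH].
  by under eq_fun do rewrite big_nil; rewrite big_nil expect_cst.
under eq_fun do rewrite big_cons; rewrite big_cons -IH expectD//.
exact: bounded_rv_sum.
Qed.

Lemma le_expect X Y : bounded_rv X -> bounded_rv Y ->
  (forall omega, X omega <= Y omega) -> expect X <= expect Y.
Proof. by move=> bX bY XY; apply: le_Rintegral => //; exact: bounded_rv_integrable. Qed.

Lemma le_expect_norm X Y : bounded_rv X -> bounded_rv Y ->
  (forall omega, `|X omega| <= Y omega) -> `|expect X| <= expect Y.
Proof.
move=> bX bY XY; apply: (le_trans (le_normr_Rintegral _ _)) => //.
  exact: bounded_rv_integrable.
by apply: le_expect => //; exact: bounded_rv_norm.
Qed.

Lemma expect_norm_le X C : bounded_rv X ->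
  (forall omega, `|X omega| <= C) -> `|expect X| <= C.
Proof.
move=> bX XC; rewrite -(expect_cst C); apply: le_expect_norm => //.
exact: bounded_rv_cst.
Qed.

Lemma expect_ae X Y : measurable_fun setT X -> measurable_fun setT Y ->
  {ae P, forall omega, X omega = Y omega} -> expect X = expect Y.
Proof.
move=> mX mY XY; congr fine; apply: ae_eq_integral => //.
- exact/measurable_EFinP.
- exact/measurable_EFinP.
- by apply: filterS XY => x + _ => /= ->.
Qed.

(** Clipping [X] to [[-C, C]] changes it only on a null set and turns the almost sure bound into a
    pointwise one. *)
Lemma expect_ae_norm_le X C : 0 <= C -> measurable_fun setT X ->
  {ae P, forall omega, `|X omega| <= C} -> `|expect X| <= C.
Proof.
move=> C0 mX XC.
have mXC : measurable_fun setT (fun omega => Num.max (- C) (Num.min (X omega) C)).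
  by apply: measurable_maxr => //; exact: measurable_minr.
have XC' omega : `|Num.max (- C) (Num.min (X omega) C)| <= C.
  by rewrite ler_norml le_max lexx/= ge_max ge_min lexx orbT ge0_cp.
rewrite (_ : expect X = expect (fun omega => Num.max (- C) (Num.min (X omega) C))).
  by apply: expect_norm_le => //; split => //; exists C.
apply: expect_ae => //; apply: filterS XC => x /=; rewrite ler_norml => /andP[? ?].
by rewrite min_l// max_r.
Qed.

Lemma expect_cvg (X : (Omega -> R)^nat) Y C :
  (forall n, measurable_fun setT (X n)) -> measurable_fun setT Y ->
  {ae P, forall omega, X ^~ omega @ \oo --> Y omega} ->
  {ae P, forall omega, forall n, `|X n omega| <= C} ->
  expect (X n) @[n --> \oo] --> expect Y.
Proof.
move=> mX mY XY XC.
have [] := @dominated_convergence _ _ _ P setT measurableT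
  (fun n => EFin \o X n) (EFin \o Y) (cst C%:E).
- by move=> n; exact/measurable_EFinP.
- exact/measurable_EFinP.
- apply: filterS XY => x xY _; apply/cvg_EFin => //; exact: nearW.
- exact: finite_measure_integrable_cst.
- by apply: filterS XC => x xC n _ /=; rewrite lee_fin.
move=> iY _ cY.
have : fine \o (fun n => \int[P]_omega (X n omega)%:E)%E @ \oo --> expect Y by
  apply: fine_cvg; rewrite fineK //; exact: integrable_fin_num.
exact.
Qed.

End bounded_random_variables.

(** * Orthogonality of martingale increments to bounded past variables *)

Section filtration_orthogonality.
Context (R : realType) (d : measure_display) (Omega : measurableType d)
  (P : probability Omega R).

(** [G] enters through the type of the sigma-algebra it generates, so that general lemmas on
    measurable functions apply to sub-sigma-algebras. *)
Definition rv_measurable (G : set (set Omega)) (Y : Omega -> R) : Prop :=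
  measurable_fun setT (Y : g_sigma_algebraType G -> R).

Lemma rv_measurable_preimage (G : set (set Omega)) (Y : Omega -> R) (B : set R) :
  sigma_algebra setT G -> rv_measurable G Y -> measurable B -> G (Y @^-1` B).
Proof.
move=> sG mY mB; have := mY measurableT _ mB; rewrite setTI => mG.
rewrite -(sigma_algebra_id sG); exact: mG.
Qed.

Lemma rv_measurableP (G : set (set Omega)) (Y : Omega -> R) :
  sigma_algebra setT G -> G `<=` measurable -> rv_measurable G Y ->
  measurable_fun setT Y.
Proof.
move=> sG GP mY _ B mB; rewrite setTI; apply: GP.
exact: rv_measurable_preimage.
Qed.

(** The sum counts the integers from [1] to [K] that are at most [z]; it is the integer part of
    [z]. *)
Lemma sum_indicator_approx (K : nat) (z : R) : 0 <= z <= K%:R ->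
  `|z - \sum_(k < K) (k.+1%:R <= z)%R%:R| <= 1.
Proof.
elim: K => [|K IH] /andP[z0 zK].
  by rewrite big_ord0 subr0 ger0_norm// (le_trans zK).
have [zleK|Kltz] := leP z K%:R.
  rewrite big_ord_recr/= [_ <= z]lt_geF ?addr0; first by rewrite IH// z0.
  by rewrite (le_lt_trans zleK)// ltr_nat.
rewrite big_ord_recr/= (eq_bigr (fun=> 1)); last first.
  by move=> i _; rewrite (le_trans _ (ltW Kltz))// ler_nat.
rewrite sumr_const card_ord; move: zK; rewrite -natr1 => zK.
by case: (leP (K%:R + 1) z) => ? /=; rewrite ler_norml ?mulr1n ?mulr0n; lra.
Qed.

Lemma integrable_bounded_mul (Y D : Omega -> R) : bounded_rv Y ->
  P.-integrable setT (EFin \o D) ->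
  P.-integrable setT (EFin \o (fun omega => Y omega * D omega)).
Proof.
move=> [mY [C YC]] iD.
have mD : measurable_fun setT D by exact/measurable_EFinP/(measurable_int P).
apply: (@le_integrable _ _ _ P setT measurableT _ (fun x => C%:E * (D x)%:E)%E).
- by apply/measurable_EFinP; exact: measurable_funM.
- move=> x _ /=; rewrite lee_fin normrM [leRHS]normrM ler_wpM2r//.
  by rewrite (le_trans (YC x))// ler_norm.
- exact: integrableZl.
Qed.

(* Up to the error 1/m, a bounded [Y] is a finite combination of indicators. *)
Lemma orthogonal_bounded (G : set (set Omega)) (D Y : Omega -> R) (C : R) :
  sigma_algebra setT G -> G `<=` measurable ->
  P.-integrable setT (EFin \o D) ->
  (forall A, G A -> \int[P]_(x in A) D x = 0) ->
  rv_measurable G Y -> (forall omega, `|Y omega| <= C) ->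
  expect P (fun omega => Y omega * D omega) = 0.
Proof.
move=> sG GP iD D0 mY YC.
have C0 : 0 <= C by rewrite (le_trans _ (YC point)).
have bY : bounded_rv Y by split; [exact: (rv_measurableP sG GP)|exists C].
have mD : measurable_fun setT D by exact/measurable_EFinP/(measurable_int P).
have IG (A : set Omega) : G A -> expect P (fun omega => \1_A omega * D omega) = 0.
  move=> GA; rewrite -(D0 A GA) Rintegral_mkcond patch_indic.
  by congr Rintegral; apply/funext => x; rewrite mulrC.
have bI (A : set Omega) : G A -> bounded_rv (\1_A : Omega -> R).
  move=> GA; split; first by apply: measurable_indic; exact: GP.
  by exists 1 => x; rewrite indicE; case: (_ \in _); rewrite ?normr1 ?normr0.
pose K := (Num.truncn (C + C)).+1.
have YK omega : 0 <= Y omega + C <= K%:R.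
  have := YC omega; rewrite ler_norml => /andP[? ?].
  have /ltW : C + C < K%:R by rewrite truncnS_gt.
  by move=> ?; apply/andP; split; lra.
pose A m k := [set omega | k.+1%:R <= m.+1%:R * (Y omega + C)].
have GA m k : G (A m k).
  rewrite (_ : A m k = Y @^-1` `[k.+1%:R / m.+1%:R - C, +oo[%classic).
    exact: rv_measurable_preimage.
  apply/seteqP; split => x /=; rewrite /A/= in_itv/= andbT.
    by rewrite lerBlDr ler_pdivrMr ?ltr0Sn// mulrC.
  by rewrite lerBlDr ler_pdivrMr ?ltr0Sn// mulrC.
pose S m omega : R := \sum_(k < m.+1 * K) \1_(A m k) omega.
have S0 m : expect P (fun omega => S m omega * D omega) = 0.
  have -> : (fun omega => S m omega * D omega) =
      (fun omega => \sum_(k < m.+1 * K) (\1_(A m k) omega * D omega)).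
    by apply/funext => x; rewrite /S mulr_suml.
  rewrite /expect /Rintegral.
  under eq_integral do rewrite -sumEFin.
  rewrite integral_sum//; last first.
    by move=> k; apply: integrable_bounded_mul => //; exact: bI.
  rewrite -sum_fine; last first.
    by move=> k _; apply: integrable_fin_num => //; apply: integrable_bounded_mul => //; exact: bI.
  by rewrite big1// => k _; exact: IG.
have bS m : bounded_rv (S m).
  by apply: bounded_rv_sum => k; exact: bI.
have YCS m omega : `|m.+1%:R * (Y omega + C) - S m omega| <= 1.
  have -> : S m omega =
      \sum_(k < m.+1 * K) (k.+1%:R <= m.+1%:R * (Y omega + C))%R%:R.
    by apply: eq_bigr => k _; rewrite indicE mem_setE.
  apply: sum_indicator_approx; rewrite natrM.
  have /andP[? ?] := YK omega.
  by rewrite mulr_ge0//= ler_pM2l ?ltr0Sn.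
have iYD : P.-integrable setT (EFin \o (fun omega => Y omega * D omega)).
  exact: integrable_bounded_mul.
have GT : G setT by case: sG => G0 GC _; rewrite -(setD0 setT); exact: GC.
have iSD m : P.-integrable setT (EFin \o (fun omega => S m omega * D omega)).
  exact: integrable_bounded_mul.
(* Adding [C] to [Y] costs nothing, as [D] has mean zero. Replacing [m.+1 * (Y + C)] by its integer
   part [S m], which is orthogonal to [D], costs at most [|D|]. As [m] is arbitrary, the expectation
   must vanish. *)
have H m : m.+1%:R * `|expect P (fun omega => Y omega * D omega)| <=
    expect P (fun omega => `|D omega|).
  have iCD : P.-integrable setT (EFin \o (fun omega => C * D omega)).
    by apply: (integrable_bounded_mul (Y := fun=> C)) => //; exact: bounded_rv_cst.
  have iE : P.-integrable setT
      (EFin \o (fun omega => Y omega * D omega + C * D omega)).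
    exact: (integrableD measurableT iYD iCD).
  have imE : P.-integrable setT
      (EFin \o (fun omega => m.+1%:R * (Y omega * D omega + C * D omega))).
    by apply: (integrable_bounded_mul (Y := fun=> _)) => //; exact: bounded_rv_cst.
  have iB : P.-integrable setT (EFin \o (fun omega =>
      m.+1%:R * (Y omega * D omega + C * D omega) - S m omega * D omega)).
    exact: (integrableB measurableT imE (iSD m)).
  have -> : m.+1%:R * `|expect P (fun omega => Y omega * D omega)| =
      `|expect P (fun omega =>
          m.+1%:R * (Y omega * D omega + C * D omega) - S m omega * D omega)|.
    rewrite [in RHS]/expect RintegralB// -[X in _ - X]/(expect P _) S0 subr0.
    rewrite RintegralZl// RintegralD// [X in _ + X]RintegralZl// D0// mulr0 addr0.
    by rewrite normrM ger0_norm.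
  apply: (le_trans (le_normr_Rintegral measurableT iB)).
  apply: le_Rintegral => //.
  - exact: (integrable_norm iB).
  - exact: (integrable_norm iD).
  move=> x _; rewrite -mulrDl mulrA -mulrBl normrM ler_piMl//.
apply/eqP; rewrite -normr_eq0 eq_le normr_ge0 andbT leNgt; apply/negP => E0.
set E := `|_| in H E0; set B := expect P _ in H.
have := H (Num.truncn (B / E)).
rewrite leNgt => /negP; apply.
by rewrite -ltr_pdivrMr// truncnS_gt.
Qed.

Lemma martingale_orthogonal (F : R -> set (set Omega)) (M : R -> Omega -> R)
    (s t C : R) (Y : Omega -> R) :
  filtration F -> martingale P F M -> 0 <= s -> s <= t ->
  rv_measurable (F s) Y -> (forall omega, `|Y omega| <= C) ->
  expect P (fun omega => Y omega * (M t omega - M s omega)) = 0.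
Proof.
move=> [sF Fm Fst] [aM iM EM] s0 st mY YC.
have t0 := le_trans s0 st.
apply: (@orthogonal_bounded (F s) _ Y C) => //; first exact: sF.
- exact: Fm.
- exact: (integrableB measurableT (iM _ t0) (iM _ s0)).
move=> A FA; have mA : measurable A by exact: Fm FA.
have iA u : 0 <= u -> P.-integrable A (EFin \o M u).
  by move=> u0; apply: (@integrableS _ _ _ P setT) => //; exact: iM.
by rewrite (RintegralB mA (iA _ t0) (iA _ s0)) (EM s t)// subrr.
Qed.

End filtration_orthogonality.

(** * Riemann sums of continuous functions *)

Section riemann_sums.
Context (R : realType).
Notation mu := (@lebesgue_measure R).

Lemma uniformly_continuous_itv (k : R -> R) (a b e : R) :
  continuous k -> 0 < e -> exists2 r : R, 0 < r &
  forall x y, a <= x <= b -> `|x - y| < r -> `|k x - k y| < e.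
Proof.
move=> ck e0; have e20 : 0 < e / 2 by rewrite divr_gt0.
have := @segment_compact R a b; rewrite compact_near_coveringP.
move=> /(_ R 0^'+ (fun r x => forall y, `|x - y| < r -> `|k x - k y| < e) _).
case=> [x abx|].
  have /cvgrPdist_lt /(_ _ e20) /nbhs_ballP [r /= r0 rx] := ck x.
  have r20 : 0 < r / 2 by rewrite divr_gt0.
  exists (ball x (r / 2), [set s | s < r / 2]) => /=.
    split; first exact: (nbhsx_ballx x (r / 2) r20).
    exact: nbhs_right_lt.
  move=> [x' s] [/= xx' sr] y x'y.
  have xy : ball x r y.
    rewrite /ball/= (_ : x - y = (x - x') + (x' - y)); last by lra.
    rewrite (le_lt_trans (ler_normD _ _))// [ltRHS]splitr ltrD//.
    exact: lt_trans sr.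
  have /rx kx' : ball x r x'.
    by move: xx'; rewrite /ball/= => /lt_le_trans -> //; lra.
  rewrite (_ : k x' - k y = (k x - k y) - (k x - k x')); last by lra.
  rewrite (le_lt_trans (ler_normB _ _))// [ltRHS]splitr ltrD//.
  exact: rx.
move=> r /= r0 rP.
exists (r / 2); first by rewrite divr_gt0.
move=> x y abx xy.
apply: (rP (r / 2)) => //=; rewrite ?in_itv ?divr_gt0//=.
  by rewrite sub0r normrN gtr0_norm ?divr_gt0//; lra.
Qed.

Lemma continuous_integrable_itv (k : R -> R) (a b : R) : continuous k ->
  mu.-integrable `[a, b] (EFin \o k).
Proof.
move=> ck; apply: continuous_compact_integrable; first exact: segment_compact.
exact: continuous_subspaceT.
Qed.

Lemma Rintegral_itv_near_cst (k : R -> R) (a b c e : R) :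
  a <= b -> continuous k -> (forall x, a <= x <= b -> `|k x - c| <= e) ->
  `|\int[mu]_(x in `]a, b]) k x - c * (b - a)| <= e * (b - a).
Proof.
move=> ab ck kc.
have ik : mu.-integrable `]a, b] (EFin \o k).
  apply: (@integrableS _ _ _ mu `[a, b]) => //.
    by apply: subset_itv; rewrite bnd_simp.
  exact: continuous_integrable_itv.
have muab : fine (mu `]a, b]) = b - a.
  rewrite lebesgue_measure_itv/= lte_fin.
  by case: ltP => //= ba; lra.
have ic c' : mu.-integrable `]a, b] (EFin \o (fun=> c')).
  apply: (@integrableS _ _ _ mu `[a, b]) => //.
    by apply: subset_itv; rewrite bnd_simp.
  by apply: continuous_integrable_itv => x; exact: cvg_cst.
rewrite -muab -(Rintegral_cst mu (measurable_itv _)) -(Rintegral_cst mu (measurable_itv _)).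
rewrite -RintegralB//.
have ikc : mu.-integrable `]a, b] (EFin \o (fun x => k x - c)).
  by apply: (integrableB _ ik (ic c)); exact: measurable_itv.
apply: (le_trans (le_normr_Rintegral _ ikc)) => //.
apply: le_Rintegral => //; first exact: (integrable_norm ikc).
by move=> x /=; rewrite in_itv/= => /andP[ax xb]; rewrite kc// xb ltW.
Qed.

Lemma riemann_sum_cvg (k : R -> R) (a b : R) : a <= b -> continuous k ->
  (b - a) / N.+1%:R * \sum_(j < N.+1) k (a + j%:R * ((b - a) / N.+1%:R))
    @[N --> \oo] --> \int[mu]_(x in `[a, b]) k x.
Proof.
move=> ab ck; apply/cvgrPdist_le => e e0.
have [e' e'0 e'e] : exists2 e' : R, 0 < e' & e' * (b - a) <= e.
  exists (e / (1 + (b - a))); first by rewrite divr_gt0//; lra.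
  rewrite mulrAC ler_pdivrMr; last by lra.
  by apply: ler_wpM2l; lra.
have [r r0 kr] := uniformly_continuous_itv a b ck e'0.
near=> N; set h := (b - a) / N.+1%:R.
have h0 : 0 <= h by rewrite divr_ge0//; lra.
have hN : h * N.+1%:R = b - a by rewrite divfK.
have hr : h < r.
  rewrite ltr_pdivrMr// mulrC -ltr_pdivrMr//.
  have : (b - a) / r < N%:R by near: N; exact: nbhs_infty_gtr.
  by move=> /lt_trans; apply; rewrite ltr_nat.
(* The error on the first [n] cells is kept proportional to their total length, so that the
   induction adds one cell at a time. *)
have H n : (n <= N.+1)%N ->
    `|\int[mu]_(x in `[a, a + n%:R * h]) k x - h * \sum_(j < n) k (a + j%:R * h)|
    <= e' * (n%:R * h).
  elim: n => [|n IH] nN.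
    by rewrite mul0r addr0 big_ord0 set_itv1 Rintegral_set1 !mulr0 subr0 normr0.
  have {}IH := IH (ltnW nN).
  have t0 : a <= a + n%:R * h by rewrite lerDl mulr_ge0.
  have tS : a + n.+1%:R * h = (a + n%:R * h) + h by rewrite -natr1; ring.
  have tb : a + n.+1%:R * h <= b.
    have : n.+1%:R * h <= N.+1%:R * h by rewrite ler_wpM2r// ler_nat.
    by rewrite [X in _ <= X]mulrC hN; lra.
  rewrite big_ord_recr/= tS; rewrite tS in tb; rewrite -natr1.
  set p := a + n%:R * h in t0 tS tb IH *.
  have B : \int[mu]_(x in `[a, p + h]) k x - \int[mu]_(x in `[a, p]) k x =
      \int[mu]_(x in `]p, p + h]) k x.
    apply: Rintegral_itvB; first exact: continuous_integrable_itv.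
      by rewrite bnd_simp.
    by rewrite bnd_simp lerDl.
  have C : `|\int[mu]_(x in `]p, p + h]) k x - k p * (p + h - p)| <= e' * (p + h - p).
    apply: Rintegral_itv_near_cst => //; first by rewrite lerDl.
    move=> x /andP[px xph]; rewrite distrC ltW// kr//.
      by rewrite t0/= (le_trans _ tb)// lerDl.
    by rewrite ler0_norm; lra.
  move: IH C; rewrite -B (_ : p + h - p = h); last by ring.
  rewrite !ler_norml => /andP[? ?] /andP[? ?]; apply/andP; split; lra.
have := H N.+1 (leqnn _); rewrite [_ * h]mulrC hN [a + _]addrC subrK => {}H.
exact: le_trans H _.
Unshelve. all: by end_near. Qed.

End riemann_sums.

(** * Increments of a diffusion *)

Section diffusion_increments.
Context (R : realType) (d : measure_display) (Omega : measurableType d)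
  (P : probability Omega R) (E : topologicalType)
  (gen : (E -> R) -> (E -> R) -> Prop) (F : R -> set (set Omega))
  (x0 : E) (X : R -> Omega -> E).

(** Adaptedness speaks of open sets only: a continuous [f] pulls open rays back to open sets, and
    these rays generate the Borel sets of the line. *)
Lemma adapted_rv_measurable (f : E -> R) (t : R) :
  filtration F -> adapted F X -> continuous f -> 0 <= t ->
  rv_measurable (F t) (fun omega => f (X t omega)).
Proof.
move=> [sF _ _] aX cf t0.
move=> mT; apply: (measurability _ (RGenOInfty.measurableE R)) => //.
move=> /= _ [_ [x ->] <-]; rewrite setTI; apply: sub_sigma_algebra.
apply: (aX t t0 (f @^-1` `]x, +oo[%classic)).
apply: open_comp; last exact: interval_open.
by move=> y _; exact: cf.
Qed.

Lemma rv_measurable_mono (s t : R) (Y : Omega -> R) :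
  filtration F -> 0 <= s -> s <= t ->
  rv_measurable (F s) Y -> rv_measurable (F t) Y.
Proof.
move=> [sF _ Fst] s0 st mY _ B mB; rewrite setTI; apply: sub_sigma_algebra.
apply: (Fst s t) => //; apply: rv_measurable_preimage => //; exact: sF.
Qed.

Lemma rv_measurable_bounded (t : R) (Y : Omega -> R) (C : R) :
  filtration F -> 0 <= t -> rv_measurable (F t) Y ->
  (forall omega, `|Y omega| <= C) -> bounded_rv Y.
Proof.
move=> [sF mF _] t0 mY YC; split; last by exists C.
by apply: (rv_measurableP (sF _ t0)) => //; exact: mF.
Qed.

(** Paths are continuous on [[0, +oo[] only; freezing them at negative times gives functions
    continuous on the whole line, to which [riemann_sum_cvg] applies. *)
Lemma continuous_max0 (x : R -> E) :
  {within `[0%R, +oo[, continuous x} -> continuous (fun u : R => x (Num.max u 0)).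
Proof.
move=> /subspace_continuousP cx u.
have cm : continuous (fun z : R => Num.max z 0).
  by apply: (@max_fun_continuous _ R R id (cst 0)) => z; [exact: cvg_id|exact: cvg_cst].
apply: (@cvg_trans _ (x @ within `[0%R, +oo[%classic (nbhs (Num.max u 0)))).
  move=> U /= xU.
  have := cm u _ xU; apply: (@filterS _ (nbhs u)) => z /=; apply.
  by rewrite in_itv/= andbT le_max lexx orbT.
by apply: cx; rewrite /= in_itv/= andbT le_max lexx orbT.
Qed.

Lemma mean_cst (h c : R) (N : nat) :
  h / N.+1%:R * \sum_(j < N.+1) c = c * h.
Proof. by rewrite sumr_const card_ord -[c *+ _]mulr_natr mulrCA divfK// pnatr_eq0. Qed.

(* Riemann sums stand for the time integral: joint measurability of the process
   in [(t, omega)] is not available. *)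
Lemma dynkin_increment (f g : E -> R) (s t B C : R) :
  diffusion P gen F x0 X -> gen f g -> continuous f -> continuous g ->
  (forall x, `|f x| <= B) -> (forall x, `|g x| <= C) -> 0 <= s -> s <= t ->
  exists Q : Omega -> R, [/\ measurable_fun setT Q,
    {ae P, forall omega,
      (t - s) / N.+1%:R * \sum_(j < N.+1)
        g (X (s + j%:R * ((t - s) / N.+1%:R)) omega) @[N --> \oo] --> Q omega}
  & forall Y C', rv_measurable (F s) Y -> (forall omega, `|Y omega| <= C') ->
    expect P (fun omega => Y omega * (f (X t omega) - f (X s omega))) =
    expect P (fun omega => Y omega * Q omega)].
Proof.
move=> [FF aX _ cX dX] gfg cf cg fB gC s0 st.
have t0 := le_trans s0 st.
have [M [mM aeM]] := dX f g gfg.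
have iM u : 0 <= u -> P.-integrable setT (EFin \o M u) by case: mM => _ + _; exact.
have bf u : 0 <= u -> bounded_rv (fun omega => f (X u omega)).
  move=> u0; apply: (@rv_measurable_bounded u _ B) => //.
  exact: adapted_rv_measurable.
have bfD : bounded_rv (fun omega => f (X t omega) - f (X s omega)).
  by apply: bounded_rvB; exact: bf.
have iMD : P.-integrable setT (EFin \o (fun omega => M t omega - M s omega)).
  exact: (integrableB measurableT (iM _ t0) (iM _ s0)).
have mMD : measurable_fun setT (fun omega => M t omega - M s omega).
  exact/measurable_EFinP/(measurable_int P).
(* This witness is almost surely the time integral of [g] along the path, and it is measurable by
   construction. *)
exists (fun omega => f (X t omega) - f (X s omega) - (M t omega - M s omega)).
split.
- by apply: measurable_funB => //; case: bfD.
- apply: filterS3 cX (aeM s s0) (aeM t t0) => omega cXo -> ->.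
  have ck : continuous (fun u : R => g (X (Num.max u 0) omega)).
    move=> u; apply: (@continuous_comp _ _ _ _ g); last exact: cg.
    exact: (continuous_max0 cXo).
  have ik u : \int[lebesgue_measure]_(r in `[0, u]) g (X r omega) =
      \int[lebesgue_measure]_(r in `[0, u]) g (X (Num.max r 0) omega).
    apply: eq_Rintegral => r; rewrite inE/= in_itv/= => /andP[r0 _].
    by rewrite max_l.
  have := riemann_sum_cvg st ck; rewrite !ik.
  set I := Rintegral _ _ _.
  have -> : f (X t omega) - f (X s omega) -
      (f (X t omega) - f (X 0 omega) -
         \int[lebesgue_measure]_(r in `[0, t]) g (X (Num.max r 0) omega) -
      (f (X s omega) - f (X 0 omega) -
         \int[lebesgue_measure]_(r in `[0, s]) g (X (Num.max r 0) omega))) = I.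
    have := @Rintegral_itvB R (fun u => g (X (Num.max u 0) omega)) (BLeft 0) (BRight t) s
      (continuous_integrable_itv _ _ ck).
    rewrite !bnd_simp => /(_ s0 st).
    have -> : \int[lebesgue_measure]_(x in `]s, t]) g (X (Num.max x 0) omega) = I.
      apply: Rintegral_itv_obnd_cbnd.
      apply: (@integrableS _ _ _ lebesgue_measure `[s, t]) => //.
        by apply: subset_itv; rewrite bnd_simp.
      exact: continuous_integrable_itv.
    by move=> <-; ring.
  apply: cvg_trans; apply: near_eq_cvg; apply: nearW => N /=.
  congr (_ * _); apply: eq_bigr => j _; rewrite max_l//.
  by rewrite addr_ge0// mulr_ge0// divr_ge0// subr_ge0.
- move=> Y C' mY YC.
  have bY := rv_measurable_bounded FF s0 mY YC.
  have := martingale_orthogonal FF mM s0 st mY YC.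
  have iYM := integrable_bounded_mul bY iMD.
  have iYf := bounded_rv_integrable P (bounded_rvM bY bfD).
  move=> /eqP; rewrite -oppr_eq0 => /eqP EM0.
  rewrite -[LHS]addr0 -EM0 -RintegralB//.
  by congr Rintegral; apply/funext => omega; rewrite -mulrBr.
Qed.

(** Dynkin's formula is used twice. For [f], it turns the increment into an average of [g] over
    [[s, s + h]], times [h]. For [g], it shows that each [E[Y g(X_u)]] in this average is within
    [D * h] of its value at time [s]. *)
Lemma diffusion_step (f g g' : E -> R) (s h B C D : R) (Y : Omega -> R) :
  diffusion P gen F x0 X -> gen f g -> gen g g' ->
  continuous f -> continuous g -> continuous g' ->
  (forall x, `|f x| <= B) -> (forall x, `|g x| <= C) ->
  (forall x, `|g' x| <= D) -> 0 <= s -> 0 <= h ->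
  rv_measurable (F s) Y -> (forall omega, `|Y omega| <= 1) ->
  `|expect P (fun omega => Y omega *
      (f (X (s + h) omega) - f (X s omega) - h * g (X s omega)))| <= D * h ^+ 2.
Proof.
move=> dX gf gg cf cg cg' fB gC g'D s0 h0 mY Y1.
have [FF aX _ _ _] := dX.
have D0 : 0 <= D by rewrite (le_trans _ (g'D x0)).
have bY := rv_measurable_bounded FF s0 mY Y1.
have bg u : 0 <= u -> bounded_rv (fun omega => g (X u omega)).
  move=> u0; apply: (@rv_measurable_bounded u _ C) => //.
  exact: adapted_rv_measurable.
have bf u : 0 <= u -> bounded_rv (fun omega => f (X u omega)).
  move=> u0; apply: (@rv_measurable_bounded u _ B) => //.
  exact: adapted_rv_measurable.
have bYg u : 0 <= u -> bounded_rv (fun omega => Y omega * g (X u omega)).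
  by move=> u0; apply: bounded_rvM => //; exact: bg.
have sh0 : 0 <= s + h by rewrite addr_ge0.
have Yg u : s <= u <= s + h ->
    `|expect P (fun omega => Y omega * g (X u omega)) -
      expect P (fun omega => Y omega * g (X s omega))| <= D * h.
  move=> /andP[su uh]; have u0 := le_trans s0 su.
  rewrite -expectB//; [|exact: bYg..].
  have [Q [mQ aeQ /(_ Y 1 mY Y1)]] := dynkin_increment dX gg cg cg' gC g'D s0 su.
  under eq_fun do rewrite mulrBr.
  move=> ->; apply: expect_ae_norm_le; first by rewrite mulr_ge0.
    by apply: measurable_funM => //; case: bY.
  apply: filterS aeQ => omega cQ.
  rewrite normrM -[leRHS]mul1r ler_pM//.
  suff : `|Q omega| <= D * (u - s) by move=> /le_trans; apply; apply: ler_wpM2l => //; lra.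
  apply: (@cvgr_to_le _ _ _ _ _ _ _ (cvg_norm cQ)).
  apply: nearW => N /=.
  rewrite normrM ger0_norm; last by rewrite divr_ge0// subr_ge0.
  apply: (@le_trans _ _ ((u - s) / N.+1%:R * \sum_(j < N.+1) D)).
    apply: ler_wpM2l; first by rewrite divr_ge0// subr_ge0.
    by rewrite (le_trans (ler_norm_sum _ _ _))// ler_sum.
  by rewrite mean_cst.
have ssh : s <= s + h by rewrite lerDl.
have [Q [mQ aeQ /(_ Y 1 mY Y1) EQ]] := dynkin_increment dX gf cf cg fB gC s0 ssh.
rewrite [s + h - s]addrAC subrr add0r in aeQ.
have -> : expect P (fun omega => Y omega *
      (f (X (s + h) omega) - f (X s omega) - h * g (X s omega))) =
    expect P (fun omega => Y omega * Q omega) -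
    h * expect P (fun omega => Y omega * g (X s omega)).
  rewrite -EQ -(expectZ _ _ (bYg s s0)) -expectB.
  - by congr expect; apply/funext => omega; ring.
  - by apply: bounded_rvM => //; apply: bounded_rvB; exact: bf.
  - by apply: bounded_rvM; [exact: bounded_rv_cst|exact: bYg].
pose S N omega := h / N.+1%:R * \sum_(j < N.+1) g (X (s + j%:R * (h / N.+1%:R)) omega).
have u0 N j : 0 <= s + j%:R * (h / N.+1%:R) by rewrite addr_ge0// mulr_ge0// divr_ge0.
have hN N : 0 <= h / N.+1%:R by rewrite divr_ge0.
have bS N : bounded_rv (S N).
  apply: bounded_rvM; first exact: bounded_rv_cst.
  by apply: bounded_rv_sum => j; exact: bg.
(* Taking the limit of the Riemann sums outside the expectation allows the estimate [Yg] to be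
   applied to each term separately. *)
have cvgS : expect P (fun omega => Y omega * S N omega) @[N --> \oo] -->
    expect P (fun omega => Y omega * Q omega).
  apply: (@expect_cvg _ _ _ _ _ _ (C * h)).
  - by move=> N; apply: measurable_funM; [case: bY|case: (bS N)].
  - by apply: measurable_funM => //; case: bY.
  - by apply: filterS aeQ => omega cQ; apply: cvgMr.
  apply: nearW => omega N.
  rewrite normrM -[leRHS]mul1r ler_pM//.
  rewrite normrM ger0_norm//.
  apply: (@le_trans _ _ (h / N.+1%:R * \sum_(j < N.+1) C)).
    by apply: ler_wpM2l => //; rewrite (le_trans (ler_norm_sum _ _ _))// ler_sum.
  by rewrite mean_cst.
set Eg := expect P (fun omega => Y omega * g _).
have cvgD : expect P (fun omega => Y omega * S N omega) - h * Eg @[N --> \oo] -->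
    expect P (fun omega => Y omega * Q omega) - h * Eg.
  by apply: cvgB => //; exact: cvg_cst.
apply: (@cvgr_to_le _ _ _ _ _ _ _ (cvg_norm cvgD)).
apply: nearW => N.
have -> : expect P (fun omega => Y omega * S N omega) =
    h / N.+1%:R * \sum_(j < N.+1) expect P (fun omega =>
      Y omega * g (X (s + j%:R * (h / N.+1%:R)) omega)).
  rewrite -expect_sum; last by move=> j; exact: bYg.
  rewrite -expectZ; last by apply: bounded_rv_sum => j; exact: bYg.
  by congr expect; apply/funext => omega; rewrite /S mulrCA mulr_sumr.
have -> : h * Eg = h / N.+1%:R * \sum_(j < N.+1) Eg.
  by rewrite mean_cst mulrC.
rewrite -mulrBr -sumrB normrM ger0_norm//.
apply: (@le_trans _ _ (h / N.+1%:R * \sum_(j < N.+1) (D * h))).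
  apply: ler_wpM2l => //; rewrite (le_trans (ler_norm_sum _ _ _))// ler_sum// => j _.
  apply: Yg; rewrite lerDl mulr_ge0//= lerD2l mulrCA ler_piMr//.
  by rewrite ler_pdivrMr// mul1r ler_nat ltnW.
by rewrite mean_cst expr2 mulrA.
Qed.

End diffusion_increments.

(** * The Riemannian metric of the quaternionic projective space *)

Section quaternion_coordinates.
Context (R : realType).
Implicit Types p q : 'rV[R]_4.

Lemma sum_ord4 (V : nmodType) (f : 'I_4 -> V) :
  \sum_(k < 4) f k = f (inord 0) + f (inord 1) + f (inord 2) + f (inord 3).
Proof.
rewrite !big_ord_recr big_ord0 /= add0r.
by do !(congr (_ + _)); congr f; apply/val_inj => /=; rewrite inordK.
Qed.

Lemma ord4_ind (Q : 'I_4 -> Prop) : Q (inord 0) -> Q (inord 1) -> Q (inord 2) ->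
  Q (inord 3) -> forall k, Q k.
Proof.
move=> Q0 Q1 Q2 Q3 k; rewrite -(inord_val k).
by case: k => [[|[|[|[|k]]]] lt_k4].
Qed.

Lemma inord4_eq (a b : nat) : (a < 4)%N -> (b < 4)%N ->
  (inord a == inord b :> 'I_4) = (a == b).
Proof. by move=> a4 b4; rewrite -val_eqE /= !inordK. Qed.

Lemma mkquatE (a b c e : R) :
  (mkquat a b c e 0 (inord 0) = a) * (mkquat a b c e 0 (inord 1) = b) *
  (mkquat a b c e 0 (inord 2) = c) * (mkquat a b c e 0 (inord 3) = e).
Proof. by rewrite /mkquat !mxE !inordK. Qed.

Lemma qconjE p :
  (qconj p 0 (inord 0) = p 0 (inord 0)) * (qconj p 0 (inord 1) = - p 0 (inord 1)) *
  (qconj p 0 (inord 2) = - p 0 (inord 2)) * (qconj p 0 (inord 3) = - p 0 (inord 3)).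
Proof.
have e0 k : (k < 4)%N -> (inord k == 0 :> 'I_4) = (k == 0%N).
  by move=> k4; rewrite -val_eqE /= inordK.
by rewrite /qconj !mxE !e0.
Qed.

Definition qunit (a : 'I_4) : 'rV[R]_4 := delta_mx 0 a.

Lemma qunitE (a b : 'I_4) : qunit a 0 b = (b == a)%:R.
Proof. by rewrite /qunit mxE eqxx. Qed.

Lemma qmul0l q : qmul 0 q = 0.
Proof.
by apply/rowP; apply: ord4_ind; rewrite /qmul !mkquatE !mxE; ring.
Qed.

Ltac qexpand := rewrite ?sum_ord4 /qmul !mkquatE !qconjE !qunitE ?inord4_eq//=.

(** Right multiplication by the conjugate of [q] is a similarity of ratio [|q|]: it sends the units
    to an orthogonal frame. *)
Lemma qunit_orthogonal q (k l : 'I_4) :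
  \sum_(a < 4) qmul (qunit a) (qconj q) 0 k * qmul (qunit a) (qconj q) 0 l =
  edot q q * (k == l)%:R.
Proof.
rewrite /edot.
by elim/ord4_ind: k; elim/ord4_ind: l; qexpand; ring.
Qed.

(** Summing [q_a e_a] over the units rebuilds [q], and [q] times its conjugate is the real number
    [|q|^2]. *)
Lemma qunit_real q (k : 'I_4) :
  \sum_(a < 4) q 0 a * qmul (qunit a) (qconj q) 0 k = edot q q * (k == inord 0)%:R.
Proof. by rewrite /edot; elim/ord4_ind: k; qexpand; ring. Qed.

Lemma qunit_coord q (a : 'I_4) : qmul (qunit a) (qconj q) 0 (inord 0) = q 0 a.
Proof. by elim/ord4_ind: a; qexpand; ring. Qed.

Lemma qunit_norm (k : 'I_4) :
  \sum_(a < 4) qmul (qunit a) (qconj (qunit a)) 0 k = 4%:R * (k == inord 0)%:R.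
Proof. by elim/ord4_ind: k; qexpand; ring. Qed.

(* The identity [\sum_a e_a q e_a = - 2 qbar] for the quaternion units [e_a]. *)
Lemma qunit_sandwich q (b : 'I_4) :
  \sum_(a < 4) \sum_(k < 4)
    qmul (qunit a) (qconj q) 0 k * qmul (qunit b) (qconj (qunit a)) 0 k =
  - 2%:R * q 0 b.
Proof. by elim/ord4_ind: b; rewrite !sum_ord4; qexpand; ring. Qed.

End quaternion_coordinates.

(** * Determinant and inverse of the Gram matrix *)

Section gram_matrix.
Context (R : realType) (n : nat).
Implicit Types w x : 'M[R]_(n, 4).

Definition hcoord (i : 'I_(n * 4)) w : R := mxvec w 0 i.

Definition hpair w x : 'rV[R]_4 :=
  \sum_(j < n) qmul (row j x) (qconj (row j w)).

(** The real matrix [B] of the pairing that maps [u] to the sum of the [u_j conj(w_j)]. The Gram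
    matrix is a combination of [1] and [B B^T], while [B^T B] is the scalar [|w|^2]; this puts its
    determinant and its inverse in closed form. *)
Definition hpair_mx w : 'M[R]_(n * 4, 4) := \matrix_(i, k) hpair w (hbasis R n i) 0 k.

Definition hdot w x : R := \sum_i hcoord i w * hcoord i x.

Lemma sum_mxvec (V : nmodType) (f : 'I_(n * 4) -> V) :
  \sum_i f i = \sum_(m < n) \sum_(a < 4) f (mxvec_index m a).
Proof.
rewrite pair_bigA /= (reindex _ (curry_mxvec_bij _ _)) /=.
by apply: eq_bigr => -[].
Qed.

Lemma hbasis_index (m : 'I_n) (a : 'I_4) :
  hbasis R n (mxvec_index m a) = delta_mx m a.
Proof. by rewrite /hbasis vec_mx_delta. Qed.

Lemma row_hbasis (j m : 'I_n) (a : 'I_4) :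
  row j (hbasis R n (mxvec_index m a)) = (j == m)%:R *: qunit R a.
Proof.
rewrite hbasis_index; apply/rowP => b; rewrite !mxE eqxx /=.
by case: (j == m); rewrite ?mul1r ?mul0r.
Qed.

Lemma hpair_index w (m : 'I_n) (a : 'I_4) :
  hpair w (hbasis R n (mxvec_index m a)) = qmul (qunit R a) (qconj (row m w)).
Proof.
rewrite /hpair (bigD1 m) //= row_hbasis eqxx scale1r big1 ?addr0 // => j jm.
by rewrite row_hbasis (negbTE jm) scale0r qmul0l.
Qed.

Lemma hpair_mx_index w (m : 'I_n) (a k : 'I_4) :
  hpair_mx w (mxvec_index m a) k = qmul (qunit R a) (qconj (row m w)) 0 k.
Proof. by rewrite mxE hpair_index. Qed.

Lemma hcoord_index w (m : 'I_n) (a : 'I_4) : hcoord (mxvec_index m a) w = w m a.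
Proof. by rewrite /hcoord mxvecE. Qed.

Lemma hcoord_hbasis (i j : 'I_(n * 4)) : hcoord i (hbasis R n j) = (i == j)%:R.
Proof. by rewrite /hcoord /hbasis vec_mxK mxE eqxx. Qed.

Lemma sum_edot_row w x : \sum_(j < n) edot (row j w) (row j x) = hdot w x.
Proof.
rewrite /hdot sum_mxvec; apply: eq_bigr => m _; apply: eq_bigr => a _.
by rewrite !hcoord_index !mxE.
Qed.

Lemma edot_ge0 (m : nat) (u : 'rV[R]_m) : 0 <= edot u u.
Proof. by apply: sumr_ge0 => i _; rewrite -expr2 sqr_ge0. Qed.

Lemma hnorm2E w : hnorm2 w = \sum_i hcoord i w ^+ 2.
Proof.
rewrite /hnorm2 -[RHS]/(hdot w w) -sum_edot_row; apply: eq_bigr => j _.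
by rewrite sqr_sqrtr// edot_ge0.
Qed.

Lemma hnorm2_ge0 w : 0 <= hnorm2 w.
Proof. by rewrite hnorm2E sumr_ge0// => i _; rewrite sqr_ge0. Qed.

Lemma hpair_mx_orthogonal w : (hpair_mx w)^T *m hpair_mx w = (hnorm2 w)%:M.
Proof.
apply/matrixP => k l; rewrite !mxE sum_mxvec.
under eq_bigr => m _ do under eq_bigr => a _ do rewrite mxE !hpair_mx_index.
under eq_bigr => m _ do rewrite qunit_orthogonal.
by rewrite -mulr_suml sum_edot_row hnorm2E mulr_natr.
Qed.

Lemma hcoord_hpair_mx w (k : 'I_4) :
  \sum_i hcoord i w * hpair_mx w i k = hnorm2 w * (k == inord 0)%:R.
Proof.
rewrite sum_mxvec hnorm2E -[X in _ = X * _]/(hdot w w) -sum_edot_row mulr_suml.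
apply: eq_bigr => m _; rewrite -(qunit_real (row m w) k); apply: eq_bigr => a _.
by rewrite hpair_mx_index hcoord_index; congr (_ * _); rewrite mxE.
Qed.

Lemma hpair_mx_coord w i : hpair_mx w i (inord 0) = hcoord i w.
Proof.
case/mxvec_indexP: i => m a.
by rewrite hpair_mx_index hcoord_index qunit_coord mxE.
Qed.

Lemma hpair_mxD w x : hpair_mx (w + x) = hpair_mx w + hpair_mx x.
Proof.
apply/matrixP => i k; case/mxvec_indexP: i => m a.
rewrite [RHS]mxE !hpair_mx_index.
by elim/ord4_ind: k; rewrite /qmul !mkquatE !qconjE !mxE; ring.
Qed.

Lemma hpair_mxZ c w : hpair_mx (c *: w) = c *: hpair_mx w.
Proof.
apply/matrixP => i k; case/mxvec_indexP: i => m a.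
rewrite [RHS]mxE !hpair_mx_index.
by elim/ord4_ind: k; rewrite /qmul !mkquatE !qconjE !mxE; ring.
Qed.

Lemma hpair_mx_div (k : 'I_4) :
  \sum_i hpair_mx (hbasis R n i) i k = (4 * n)%:R * (k == inord 0)%:R.
Proof.
rewrite sum_mxvec.
under eq_bigr => m _ do under eq_bigr => a _ do
  rewrite hpair_mx_index row_hbasis eqxx scale1r.
under eq_bigr => m _ do rewrite qunit_norm.
by rewrite sumr_const card_ord -mulrnAl natrM -[4%:R *+ n]mulr_natr.
Qed.

Lemma hpair_mx_sandwich w j :
  \sum_i \sum_k hpair_mx w i k * hpair_mx (hbasis R n i) j k =
  - 2%:R * hcoord j w.
Proof.
case/mxvec_indexP: j => l b; rewrite sum_mxvec (bigD1 l)//= [X in _ + X]big1 ?addr0.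
  under eq_bigr => a _ do under eq_bigr => k _ do
    rewrite !hpair_mx_index row_hbasis eqxx scale1r.
  by rewrite qunit_sandwich hcoord_index mxE.
move=> m ml; rewrite big1// => a _; rewrite big1// => k _.
rewrite !hpair_mx_index row_hbasis eq_sym (negbTE ml) scale0r.
rewrite [X in _ * X](_ : _ = 0) ?mulr0//.
by elim/ord4_ind: k; rewrite /qmul !mkquatE !qconjE !mxE; ring.
Qed.

Lemma hp_gramE w :
  hp_gram w = (1 + hnorm2 w)^-1 *: 1%:M -
              (1 + hnorm2 w) ^- 2 *: (hpair_mx w *m (hpair_mx w)^T).
Proof.
apply/matrixP => i j; rewrite mxE [RHS]mxE [X in _ = X + _]mxE [X in _ = _ + X]mxE.
rewrite [X in _ = _ - X]mxE [X in _ * X - _]mxE [X in _ - _ * X]mxE.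
rewrite /hp_metric sum_edot_row mulrC; congr (_ * _ - _).
  rewrite /hdot (bigD1 i)//= !hcoord_hbasis eqxx mul1r big1 ?addr0//.
  by move=> l li; rewrite hcoord_hbasis (negbTE li) mul0r.
rewrite mulrC; congr (_ * _); apply: eq_bigr => k _.
by rewrite [X in _ = _ * X]mxE [X in _ = X * _]mxE [X in _ = _ * X]mxE.
Qed.

(** Sylvester's identity: both sides are the determinant of the block matrix with diagonal blocks
    [1] and other blocks [A], [B], factored in two ways. *)
Lemma det_1_sub_mul (m p : nat) (A : 'M[R]_(m, p)) (B : 'M[R]_(p, m)) :
  \det (1%:M - A *m B) = \det (1%:M - B *m A).
Proof.
have H1 : block_mx 1%:M A B 1%:M =
    block_mx (1%:M - A *m B) A 0 1%:M *m block_mx 1%:M 0 B 1%:M.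
  by rewrite mulmx_block !mulmx1 !mul1mx !mulmx0 ?mul0mx !add0r subrK.
have H2 : block_mx 1%:M A B 1%:M =
    block_mx 1%:M 0 B (1%:M - B *m A) *m block_mx 1%:M A 0 1%:M.
  by rewrite mulmx_block !mulmx1 !mul1mx !mulmx0 ?mul0mx !addr0 addrC subrK.
have := congr1 determinant H1; rewrite H2 !det_mulmx.
by rewrite !det_ublock !det_lblock !det1 !mul1r !mulr1 => ->.
Qed.

Lemma det_hp_gram w : \det (hp_gram w) = (1 + hnorm2 w) ^- (4 * n + 4).
Proof.
have v0 := hnorm2_ge0 w; have v1 : 1 + hnorm2 w != 0 by rewrite gt_eqF//; lra.
have -> : hp_gram w = (1 + hnorm2 w)^-1 *:
    (1%:M - ((1 + hnorm2 w)^-1 *: hpair_mx w) *m (hpair_mx w)^T).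
  by rewrite hp_gramE scalerBr -scalemxAl scalerA -expr2 exprVn.
(* Sylvester's identity passes from size [4 n] to size [4], where the matrix becomes scalar. *)
rewrite detZ det_1_sub_mul -scalemxAr hpair_mx_orthogonal scale_scalar_mx.
have -> : 1%:M - ((1 + hnorm2 w)^-1 * hnorm2 w)%:M = ((1 + hnorm2 w)^-1)%:M :> 'M[R]_4.
  by rewrite -raddfB/=; congr (scalar_mx _); field.
by rewrite det_scalar -exprD exprVn mulnC.
Qed.

Lemma invmx_hp_gram w :
  invmx (hp_gram w) =
  (1 + hnorm2 w) *: (1%:M + hpair_mx w *m (hpair_mx w)^T).
Proof.
have v0 := hnorm2_ge0 w; have v1 : 1 + hnorm2 w != 0 by rewrite gt_eqF//; lra.
have BB : hpair_mx w *m (hpair_mx w)^T *m (hpair_mx w *m (hpair_mx w)^T) =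
    hnorm2 w *: (hpair_mx w *m (hpair_mx w)^T).
  rewrite mulmxA -[hpair_mx w *m _ *m hpair_mx w]mulmxA hpair_mx_orthogonal.
  by rewrite mul_mx_scalar scalemxAl.
set X := (X in _ = X).
have GX : hp_gram w *m X = 1%:M.
  rewrite /X hp_gramE -scalemxAr mulmxBl -!scalemxAl mul1mx mulmxDr mulmx1 BB.
  move: (hpair_mx w *m _) => B.
  by apply/matrixP => i j; rewrite !mxE; case: (i == j); field.
have [uG _] := mulmx1_unit GX.
by rewrite -[LHS]mulmx1 -GX mulKmx.
Qed.

End gram_matrix.

(** * Smooth functions and the Laplace-Beltrami operator *)

Section smooth_real_functions.
Context (R : realType).
Implicit Types (D : set R) (g h : R -> R).

(** The derivative is an existential witness, constrained on [D] only; any formula for it may be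
    supplied, whatever it does off [D]. *)
Fixpoint smooth1_upto D (k : nat) h : Prop :=
  match k with
  | 0 => forall x, D x -> {for x, continuous h}
  | k'.+1 => exists h', (forall x, D x -> is_derive x 1 h (h' x)) /\
                        smooth1_upto D k' h'
  end.

Definition smooth1 D h : Prop := forall k, smooth1_upto D k h.

Lemma is_derive1_continuous h (x dh : R) : is_derive x 1 h dh -> {for x, continuous h}.
Proof.
by case=> dx _; apply: differentiable_continuous; exact/derivable1_diffP.
Qed.

Lemma smooth1_upto_continuous D k h : smooth1_upto D k h ->
  forall x, D x -> {for x, continuous h}.
Proof. by case: k => [//|k] [h' [dh _]] x /dh; exact: is_derive1_continuous. Qed.

Lemma smooth1_upto_pred D k h : smooth1_upto D k.+1 h -> smooth1_upto D k h.
Proof.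
elim: k h => [|k IH] h; first exact: smooth1_upto_continuous.
by case=> h' [dh /IH sh']; exists h'.
Qed.

Lemma smooth1_upto_cst D k c : smooth1_upto D k (fun=> c).
Proof.
elim: k c => [|k IH] c; first by move=> x _; exact: cvg_cst.
by exists (fun=> 0); split=> // x _; exact: is_derive_cst.
Qed.

Lemma smooth1_uptoD D k g h : smooth1_upto D k g -> smooth1_upto D k h ->
  smooth1_upto D k (fun x => g x + h x).
Proof.
elim: k g h => [|k IH] g h.
  by move=> cg ch x Dx; apply: cvgD; [exact: cg|exact: ch].
move=> [g' [dg sg]] [h' [dh sh]]; exists (fun x => g' x + h' x).
by split; [move=> x Dx; apply: is_deriveD; [exact: dg|exact: dh]|exact: IH].
Qed.

Lemma smooth1_uptoM D k g h : smooth1_upto D k g -> smooth1_upto D k h ->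
  smooth1_upto D k (fun x => g x * h x).
Proof.
elim: k g h => [|k IH] g h.
  by move=> cg ch x Dx; apply: cvgM; [exact: cg|exact: ch].
move=> /[dup] /smooth1_upto_pred sg [g' [dg sg']].
move=> /[dup] /smooth1_upto_pred sh [h' [dh sh']].
exists (fun x => g x * h' x + h x * g' x); split.
  by move=> x Dx; apply: is_deriveM; [exact: dg|exact: dh].
by apply: smooth1_uptoD; exact: IH.
Qed.

Lemma smooth1_upto_comp D D' k g h : (forall x, D x -> D' (g x)) ->
  smooth1_upto D k g -> smooth1_upto D' k h ->
  smooth1_upto D k (fun x => h (g x)).
Proof.
move=> DD'; elim: k g h DD' => [|k IH] g h DD'.
  move=> cg ch x Dx.
  by apply: (@continuous_comp _ _ _ g h); [exact: cg|apply: ch; exact: DD'].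
move=> /[dup] /smooth1_upto_pred sg [g' [dg sg']] [h' [dh sh']].
exists (fun x => h' (g x) * g' x); split.
  by move=> x Dx; exact: (is_derive1_comp (dh _ (DD' _ Dx)) (dg _ Dx)).
by apply: smooth1_uptoM => //; exact: IH.
Qed.

(* Derivatives of [exp (- 1 / s)], extended by [0] to [s <= 0], are combinations
   of these functions. *)
Definition flat (j : nat) (s : R) : R :=
  if 0 < s then s ^- j * expR (- s^-1) else 0.

Lemma flat_le0 j s : s <= 0 -> flat j s = 0.
Proof. by rewrite /flat; case: ltP. Qed.

Lemma flat_ge0 j s : 0 <= flat j s.
Proof.
rewrite /flat; case: ltP => // s0.
by rewrite mulr_ge0 ?expR_ge0// invr_ge0 exprn_ge0// ltW.
Qed.

(** The term of order [j + k + 1] in the series of [exp (1 / s)] absorbs [s ^- j] and leaves the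
    power [k + 1]. *)
Lemma flat_bound j k s : 0 < s -> flat j s <= (j + k.+1)`!%:R * s ^+ k.+1.
Proof.
move=> s0; rewrite /flat s0.
have := @expR_ge1Dxn R s^-1 (j + k); rewrite invr_ge0 (ltW s0) => /(_ isT) H.
have {}H : s^-1 ^+ (j + k).+1 / (j + k).+1`!%:R <= expR s^-1.
  by apply: le_trans H; rewrite lerDr.
rewrite expRN addnS ler_pdivrMr; last exact: expR_gt0.
move: H; rewrite ler_pdivrMr ?ltr0n ?fact_gt0// => H.
have -> : s ^- j = s ^+ k.+1 * s^-1 ^+ (j + k).+1.
  rewrite -addnS exprD [_ ^+ j * _]mulrC mulrA -exprMn mulfV ?gt_eqF//.
  by rewrite expr1n mul1r exprVn.
rewrite [leRHS](_ : _ = s ^+ k.+1 * (expR s^-1 * (j + k).+1`!%:R)); last by ring.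
by rewrite ler_wpM2l// exprn_ge0// ltW.
Qed.

Lemma is_derive_flat j (s : R) :
  is_derive s 1 (flat j) (flat j.+2 s - j%:R * flat j.+1 s).
Proof.
have [s0|s0|->] := ltgtP s 0.
- rewrite !flat_le0 ?mulr0 ?subr0 ?ltW//.
  apply: (@near_eq_is_derive _ _ _ (cst 0)).
  by near=> z; rewrite flat_le0//=; apply/ltW; near: z; exact: lt_nbhsl.
- have -> : flat j.+2 s - j%:R * flat j.+1 s =
      s ^- j * (expR (- s^-1) * (s ^- 2)) + expR (- s^-1) * (- (j%:R) * s ^- j.+1).
    rewrite /flat s0 !exprS; field.
    by rewrite !gt_eqF ?exprn_gt0.
  have sn0 : s != 0 by rewrite gt_eqF.
  have dV : is_derive s 1 (fun z : R => z^-1) (- s ^- 2).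
    apply: DeriveDef; first by apply: (@derivableV R _ id) => //; exact: derivable_id.
    by rewrite (@deriveV R _ id)//= ?derive_id ?[_%:A]mulr1//; exact: derivable_id.
  have dX : is_derive s 1 (fun z : R => z ^- j) (- j%:R * s ^- j.+1).
    rewrite (_ : (fun z : R => z ^- j) = (fun z : R => z^-1) ^+ j); last first.
      by apply/funext => z; rewrite exprfctE exprVn.
    apply: (is_derive_eq (is_deriveX j dV)); case: j => [|j /=].
      by rewrite !mul0r oppr0 mul0r scale0r.
    rewrite [LHS](_ : _ = j.+1%:R * s^-1 ^+ j * - s ^- 2)// exprVn mulrN mulNr.
    by rewrite -mulrA -invfM -exprD addn2.
  have dE : is_derive s 1 (fun z : R => expR (- z^-1)) (expR (- s^-1) * s ^- 2).
    apply: (@is_derive1_comp _ expR (fun z : R => - z^-1)).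
    by apply: (is_derive_eq (is_deriveN dV)); rewrite opprK.
  have dF : is_derive s 1 (fun z : R => z ^- j * expR (- z^-1))
      (s ^- j * (expR (- s^-1) * s ^- 2) + expR (- s^-1) * (- j%:R * s ^- j.+1)).
    exact: (is_deriveM dX dE).
  apply: (near_eq_is_derive _ dF).
  by near=> z; rewrite /flat ifT//; near: z; exact: lt_nbhsr.
- rewrite !flat_le0 ?mulr0 ?subr0//.
  (* At the origin, [flat_bound] with [k = 1] bounds the difference quotient by [(j + 2)!] times
     [h]. *)
  have H : (fun h : R => h^-1 *: ((flat j \o shift 0) (h *: 1) - flat j 0)) @ 0^' --> (0 : R).
    apply/cvgrPdist_le => e e0.
    pose C : R := (j + 2)`!%:R.
    have C0 : 0 < C by rewrite ltr0n fact_gt0.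
    near=> h.
    have h0 : h != 0 by near: h; exact: nbhs_dnbhs_neq.
    rewrite (_ : h^-1 *: _ = h^-1 * flat j h); last first.
      by rewrite /= [flat j 0]flat_le0// subr0 addr0 [h%:A]mulr1.
    rewrite sub0r normrN.
    have [hpos|hneg] := ltP 0 h; last by rewrite flat_le0// mulr0 normr0 ltW.
    rewrite ger0_norm ?mulr_ge0 ?flat_ge0 ?invr_ge0 ?(ltW hpos)//.
    rewrite mulrC ler_pdivrMr// (le_trans (flat_bound j 1 hpos))//.
    rewrite expr2 mulrA ler_wpM2r ?(ltW hpos)// mulrC -ler_pdivlMr//.
    rewrite (le_trans (ler_norm _))//.
    by near: h; apply: dnbhs0_le; rewrite divr_gt0.
  by apply: DeriveDef; [apply/cvg_ex; exists 0|exact: cvg_lim].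
Unshelve. all: by end_near. Qed.

Lemma smooth1_flat k j : smooth1_upto setT k (flat j).
Proof.
elim: k j => [|k IH] j.
  by move=> x _; apply: is_derive1_continuous; exact: is_derive_flat.
eexists; split; first by move=> x _; exact: is_derive_flat.
apply: smooth1_uptoD; first exact: IH.
under eq_fun do rewrite -mulNr.
by apply: smooth1_uptoM; [exact: smooth1_upto_cst|exact: IH].
Qed.

End smooth_real_functions.

(** * Calculus of smooth functions on the chart *)

Section smooth_matrix_functions.
Context (R : realType) (n : nat).
Implicit Types (f g : 'M[R]_(n, 4) -> R) (x v : 'M[R]_(n, 4)).

(** Restriction to a line gives access to the one-variable chain rule. *)
Lemma is_derive_line f x v (df : R) :
  is_derive x v f df <-> is_derive (0 : R) 1 (fun t : R => f (t *: v + x)) df.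
Proof.
have E : (fun h : R => h^-1 *: ((f \o shift x) (h *: v) - f x)) =
    (fun h => h^-1 *: (((fun t : R => f (t *: v + x)) \o shift 0) (h *: 1) -
                       f (0 *: v + x))).
  by apply/funext => h /=; rewrite addr0 scale0r add0r [h%:A]mulr1.
by split=> -[d1 d2]; apply: DeriveDef;
  [move: d1; rewrite /derivable E|move: d2; rewrite /derive E|
   move: d1; rewrite /derivable -E|move: d2; rewrite /derive -E].
Qed.

Lemma is_derive_comp1 (h : R -> R) f x v (df dh : R) :
  is_derive (f x) 1 h dh -> is_derive x v f df ->
  is_derive x v (fun w => h (f w)) (dh * df).
Proof.
move=> Dh /is_derive_line Df; apply/is_derive_line.
apply: (@is_derive1_comp _ h (fun t : R => f (t *: v + x))).
by rewrite scale0r add0r.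
Qed.

Lemma is_derive_linear f x v : (forall t : R, f (t *: v + x) = t * f v + f x) ->
  is_derive x v f (f v).
Proof.
move=> fL; apply/is_derive_line.
rewrite (_ : (fun t : R => f (t *: v + x)) = (fun t : R => t * f v + f x)); last exact/funext.
have dl : is_derive (0 : R) 1 (fun t : R => t * f v) (f v).
  have H := is_deriveM (is_derive_id (0 : R) 1) (is_derive_cst (f v) (0 : R) 1).
  by apply: (is_derive_eq H); rewrite scaler0 add0r [_%:A]mulr1.
by apply: (is_derive_eq (is_deriveD dl (is_derive_cst (f x) (0 : R) 1))); rewrite addr0.
Qed.

Definition smooth f : Prop := forall k, Ck k f.

Lemma Ck_continuous k f : Ck k f -> continuous f.
Proof. by case: k => [|k] []. Qed.

Lemma Ck_pred k f : Ck k.+1 f -> Ck k f.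
Proof.
elim: k f => [|k IH] f [cf df]; first by split.
by split=> // i; have [? ?] := df i; split=> //; exact: IH.
Qed.

Lemma Ck_is_derive k f i x : Ck k.+1 f ->
  is_derive x (hbasis R n i) f (partial i f x).
Proof. by case=> _ /(_ i)[df _]; exact: derivableP. Qed.

Lemma partial_is_derive f i (df : 'M[R]_(n, 4) -> R) :
  (forall x, is_derive x (hbasis R n i) f (df x)) -> partial i f = df.
Proof. by move=> H; apply/funext => x; rewrite /partial derive_val. Qed.

Lemma Ck_cst k (c : R) : Ck k (fun _ : 'M[R]_(n, 4) => c).
Proof.
elim: k c => [|k IH] c; split=> //; try exact: cst_continuous.
move=> i; split=> [x|]; first exact: derivable_cst.
by rewrite (@partial_is_derive (fun=> c) i (fun=> 0)); exact: IH.
Qed.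

Lemma is_derive_hcoord i j x :
  is_derive x (hbasis R n i) (hcoord j) ((j == i)%:R : R).
Proof.
rewrite -hcoord_hbasis; apply: is_derive_linear => t.
by rewrite /hcoord linearP !mxE.
Qed.

Lemma continuous_hcoord j : continuous (@hcoord R n j).
Proof.
case/mxvec_indexP: j => m a x.
rewrite (_ : hcoord _ = (fun w : 'M[R]_(n, 4) => w m a)).
  exact: coord_continuous.
by apply/funext => w; rewrite hcoord_index.
Qed.

Lemma Ck_hcoord k j : Ck k (@hcoord R n j).
Proof.
case: k => [|k]; split=> //; try exact: continuous_hcoord.
move=> i; split; first by move=> x; case: (is_derive_hcoord i j x).
by rewrite (partial_is_derive (is_derive_hcoord i j)); exact: Ck_cst.
Qed.

Lemma is_deriveD_partial k f g i x : Ck k.+1 f -> Ck k.+1 g ->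
  is_derive x (hbasis R n i) (fun w => f w + g w) (partial i f x + partial i g x).
Proof.
move=> cf cg; exact: (is_deriveD (Ck_is_derive i x cf) (Ck_is_derive i x cg)).
Qed.

Lemma is_deriveM_partial k f g i x : Ck k.+1 f -> Ck k.+1 g ->
  is_derive x (hbasis R n i) (fun w => f w * g w)
    (f x * partial i g x + partial i f x * g x).
Proof.
move=> cf cg; rewrite [X in _ + X]mulrC.
exact: (is_deriveM (Ck_is_derive i x cf) (Ck_is_derive i x cg)).
Qed.

Lemma CkD k f g : Ck k f -> Ck k g -> Ck k (fun w => f w + g w).
Proof.
elim: k f g => [|k IH] f g cf cg; split=> //.
- move=> x; exact: (cvgD (@Ck_continuous _ _ cf x) (@Ck_continuous _ _ cg x)).
- by move=> x; exact: (cvgD (@Ck_continuous _ _ cf x) (@Ck_continuous _ _ cg x)).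
move=> i; split; first by move=> x; have [] := is_deriveD_partial i x cf cg.
rewrite (@partial_is_derive _ i _ (fun x : 'M[R]_(n, 4) => is_deriveD_partial i x cf cg)).
by case: cf cg => _ /(_ i)[_ cf] [_ /(_ i)[_ cg]]; exact: IH.
Qed.

Lemma CkM k f g : Ck k f -> Ck k g -> Ck k (fun w => f w * g w).
Proof.
elim: k f g => [|k IH] f g cf cg; split=> //.
- by move=> x; exact: (cvgM (@Ck_continuous _ _ cf x) (@Ck_continuous _ _ cg x)).
- by move=> x; exact: (cvgM (@Ck_continuous _ _ cf x) (@Ck_continuous _ _ cg x)).
move=> i; split; first by move=> x; have [] := is_deriveM_partial i x cf cg.
rewrite (@partial_is_derive _ i _ (fun x : 'M[R]_(n, 4) => is_deriveM_partial i x cf cg)).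
have [cf' cg'] := (Ck_pred cf, Ck_pred cg).
by case: cf cg => _ /(_ i)[_ cf] [_ /(_ i)[_ cg]]; apply: CkD; exact: IH.
Qed.

Lemma Ck_sum k (I : Type) (s : seq I) (f : I -> 'M[R]_(n, 4) -> R) :
  (forall i, Ck k (f i)) -> Ck k (fun w => \sum_(i <- s) f i w).
Proof.
move=> cf; elim: s => [|i s IH].
  by under eq_fun do rewrite big_nil; exact: Ck_cst.
by under eq_fun do rewrite big_cons; exact: CkD.
Qed.

Lemma Ck_comp1 k (D : set R) (h : R -> R) f : (forall x, D (f x)) ->
  smooth1_upto D k h -> Ck k f -> Ck k (fun w => h (f w)).
Proof.
move=> Df; elim: k h => [|k IH] h sh cf.
  split=> // x; apply: (@continuous_comp _ _ _ f h); first exact: Ck_continuous cf _.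
  exact: sh.
split.
  move=> x; apply: (@continuous_comp _ _ _ f h); first exact: Ck_continuous cf _.
  exact: smooth1_upto_continuous sh _ _.
case: sh => h' [dh sh] i.
have dhf x : is_derive x (hbasis R n i) (fun w => h (f w)) (h' (f x) * partial i f x).
  by apply: is_derive_comp1; [exact: dh|exact: Ck_is_derive cf].
split; first by move=> x; case: (dhf x).
rewrite (partial_is_derive dhf); apply: CkM; first exact/IH/Ck_pred.
by case: cf => _ /(_ i)[].
Qed.

Lemma smooth_cst (c : R) : smooth (fun=> c).
Proof. by move=> k; exact: Ck_cst. Qed.

Lemma smooth_hcoord j : smooth (@hcoord R n j).
Proof. by move=> k; exact: Ck_hcoord. Qed.

Lemma smoothD f g : smooth f -> smooth g -> smooth (fun w => f w + g w).
Proof. by move=> sf sg k; exact: CkD. Qed.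

Lemma smoothM f g : smooth f -> smooth g -> smooth (fun w => f w * g w).
Proof. by move=> sf sg k; exact: CkM. Qed.

Lemma smooth_sum (I : Type) (s : seq I) (f : I -> 'M[R]_(n, 4) -> R) :
  (forall i, smooth (f i)) -> smooth (fun w => \sum_(i <- s) f i w).
Proof. by move=> sf k; apply: Ck_sum => i; exact: sf. Qed.

Lemma smooth_continuous f : smooth f -> continuous f.
Proof. by move=> /(_ 0%N) /Ck_continuous. Qed.

Lemma smooth_partial f i : smooth f -> smooth (partial i f).
Proof. by move=> sf k; case: (sf k.+1) => _ /(_ i)[]. Qed.

Lemma smooth_is_derive f i x : smooth f ->
  is_derive x (hbasis R n i) f (partial i f x).
Proof. by move=> /(_ 1%N); exact: Ck_is_derive. Qed.

Lemma partial_cst i (c : R) :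
  partial i (fun _ : 'M[R]_(n, 4) => c) = (fun=> 0).
Proof. by apply: partial_is_derive => x; exact: is_derive_cst. Qed.

Lemma partial_hcoord i j : partial i (@hcoord R n j) = (fun=> (j == i)%:R).
Proof. by apply: partial_is_derive => x; exact: is_derive_hcoord. Qed.

Lemma partialD i f g : smooth f -> smooth g ->
  partial i (fun w => f w + g w) = (fun w => partial i f w + partial i g w).
Proof.
move=> sf sg; apply: partial_is_derive => x.
exact: is_deriveD_partial (sf 1%N) (sg 1%N).
Qed.

Lemma partialM i f g : smooth f -> smooth g ->
  partial i (fun w => f w * g w) =
  (fun w => f w * partial i g w + partial i f w * g w).
Proof.
move=> sf sg; apply: partial_is_derive => x.
exact: is_deriveM_partial (sf 1%N) (sg 1%N).
Qed.

Lemma partial_sum (I : Type) (s : seq I) (f : I -> 'M[R]_(n, 4) -> R) i :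
  (forall j, smooth (f j)) -> partial i (fun w => \sum_(j <- s) f j w) =
  (fun w => \sum_(j <- s) partial i (f j) w).
Proof.
move=> sf; elim: s => [|j s IH].
  under eq_fun do rewrite big_nil.
  by rewrite partial_cst; apply/funext => w; rewrite big_nil.
under eq_fun do rewrite big_cons.
rewrite partialD//; last exact: smooth_sum.
by rewrite IH; apply/funext => w; rewrite big_cons.
Qed.

Lemma partial_comp1 i (h h' : R -> R) f : smooth f ->
  (forall x, is_derive (f x) 1 h (h' (f x))) ->
  partial i (fun w => h (f w)) = (fun w => h' (f w) * partial i f w).
Proof.
move=> sf dh; apply: partial_is_derive => x.
exact: (is_derive_comp1 (dh x) (smooth_is_derive i x sf)).
Qed.

(* Locked, so that [rewrite] and [ring] do not unfold derivatives when they
   compare terms. *)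
Fact pd_key : unit. Proof. by []. Qed.
Definition pd := locked_with pd_key (@partial R n).

Lemma pdE i f : pd i f = partial i f.
Proof. by rewrite /pd unlock. Qed.

Lemma smooth_pd i f : smooth f -> smooth (pd i f).
Proof. by rewrite pdE; exact: smooth_partial. Qed.

Lemma pd_cst i (c : R) : pd i (fun _ : 'M[R]_(n, 4) => c) = (fun=> 0).
Proof. by rewrite pdE partial_cst. Qed.

Lemma pd_hcoord i j : pd i (@hcoord R n j) = (fun=> (j == i)%:R).
Proof. by rewrite pdE partial_hcoord. Qed.

Lemma pdD i f g : smooth f -> smooth g ->
  pd i (fun w => f w + g w) = (fun w => pd i f w + pd i g w).
Proof. by move=> sf sg; rewrite !pdE partialD. Qed.

Lemma pdM i f g : smooth f -> smooth g ->
  pd i (fun w => f w * g w) = (fun w => f w * pd i g w + pd i f w * g w).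
Proof. by move=> sf sg; rewrite !pdE partialM. Qed.

Lemma pd_sum (I : Type) (s : seq I) (f : I -> 'M[R]_(n, 4) -> R) i :
  (forall j, smooth (f j)) -> pd i (fun w => \sum_(j <- s) f j w) =
  (fun w => \sum_(j <- s) pd i (f j) w).
Proof.
move=> sf; rewrite pdE partial_sum//; apply/funext => w.
by apply: eq_bigr => j _; rewrite pdE.
Qed.

End smooth_matrix_functions.

(** * The Laplace-Beltrami operator in coordinates *)

Section laplace_beltrami_formula.
Context (R : realType) (n : nat).
Implicit Types (f g : 'M[R]_(n, 4) -> R) (w x : 'M[R]_(n, 4)).

Lemma hbasis_decomposition w : w = \sum_j hcoord j w *: hbasis R n j.
Proof.
rewrite -[LHS]mxvecK [X in vec_mx X]row_sum_delta linear_sum.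
by apply: eq_bigr => j _; rewrite linearZ.
Qed.

Lemma hpair_mxE w i k :
  hpair_mx w i k = \sum_j hcoord j w * hpair_mx (hbasis R n j) i k.
Proof.
rewrite {1}(hbasis_decomposition w).
have -> : hpair_mx (\sum_j hcoord j w *: hbasis R n j) =
    \sum_j hcoord j w *: hpair_mx (hbasis R n j).
  elim/big_ind2: _ => [|_ x _ y <- <-|j _]; last exact: hpair_mxZ.
    by rewrite -[X in hpair_mx X](scale0r 0) hpair_mxZ scale0r.
  exact: hpair_mxD.
by rewrite summxE; apply: eq_bigr => j _; rewrite mxE.
Qed.

Lemma smooth_hpair_mx i k : smooth (fun w => hpair_mx w i k).
Proof.
under eq_fun do rewrite hpair_mxE.
by apply: smooth_sum => j; apply: smoothM; [exact: smooth_hcoord|exact: smooth_cst].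
Qed.

Lemma partial_hpair_mx i j k :
  partial i (fun w => hpair_mx w j k) = (fun=> hpair_mx (hbasis R n i) j k).
Proof.
under eq_fun do rewrite hpair_mxE.
rewrite partial_sum; last first.
  by move=> l; apply: smoothM; [exact: smooth_hcoord|exact: smooth_cst].
apply/funext => w; rewrite (bigD1 i)//= big1 ?addr0 => [|l li];
  rewrite partialM; [|exact: smooth_hcoord|exact: smooth_cst|
                      |exact: smooth_hcoord|exact: smooth_cst];
  rewrite partial_cst partial_hcoord mulr0 add0r.
  by rewrite eqxx mul1r.
by rewrite (negbTE li) mul0r.
Qed.

Lemma hnorm2_funE : @hnorm2 R n = (fun w => \sum_j hcoord j w * hcoord j w).
Proof. by apply/funext => w; rewrite hnorm2E; apply: eq_bigr => j _; rewrite expr2. Qed.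

Lemma smooth_hnorm2 : smooth (@hnorm2 R n).
Proof.
rewrite hnorm2_funE; apply: smooth_sum => i.
by apply: smoothM; exact: smooth_hcoord.
Qed.

Lemma partial_hnorm2 i : partial i (@hnorm2 R n) = (fun w => 2 * hcoord i w).
Proof.
rewrite hnorm2_funE partial_sum; last by move=> j; apply: smoothM; exact: smooth_hcoord.
apply/funext => w; rewrite (bigD1 i)//= big1 ?addr0 => [|l li];
  rewrite partialM; try exact: smooth_hcoord; rewrite partial_hcoord/=.
  by rewrite eqxx mulr1 mul1r; ring.
by rewrite (negbTE li) mulr0 mul0r addr0.
Qed.

Definition hpair_gram w : 'M[R]_(n * 4) := hpair_mx w *m (hpair_mx w)^T.

Lemma hpair_gramE w i j :
  hpair_gram w i j = \sum_k hpair_mx w i k * hpair_mx w j k.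
Proof. by rewrite mxE; apply: eq_bigr => k _; rewrite [X in _ * X]mxE. Qed.

Lemma smooth_hpair_gram i j : smooth (fun w => hpair_gram w i j).
Proof.
under eq_fun do rewrite hpair_gramE.
by apply: smooth_sum => k; apply: smoothM; exact: smooth_hpair_mx.
Qed.

(** The pairing of [w] with itself is the real number [|w|^2], and the real column of [hpair_mx w]
    is [w]: the radial direction is an eigenvector of [hpair_gram]. *)
Lemma hcoord_hpair_gram w j :
  \sum_i hcoord i w * hpair_gram w i j = hnorm2 w * hcoord j w.
Proof.
under eq_bigr do rewrite hpair_gramE mulr_sumr.
rewrite exchange_big/=.
under eq_bigr => k _ do under eq_bigr do rewrite mulrA.
under eq_bigr => k _ do rewrite -mulr_suml hcoord_hpair_mx.
rewrite (bigD1 (inord 0))//= eqxx mulr1 hpair_mx_coord big1 ?addr0// => k k0.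
by rewrite (negbTE k0) mulr0 mul0r.
Qed.

(** The product rule gives two sums: the divergence of the columns of [hpair_mx] contributes
    [4 n w_j], and the sandwich of [w] between the quaternion units contributes [- 2 w_j]. *)
Lemma div_hpair_gram w j :
  \sum_i partial i (fun w => hpair_gram w i j) w =
  (4 * n%:R - 2) * hcoord j w.
Proof.
under eq_bigr => i _.
  under eq_fun do rewrite hpair_gramE.
  rewrite partial_sum; last by move=> k; apply: smoothM; exact: smooth_hpair_mx.
  under eq_bigr => k _.
    rewrite partialM; [|exact: smooth_hpair_mx..].
    rewrite !partial_hpair_mx.
  over.
  rewrite big_split/=.
over.
rewrite big_split/= hpair_mx_sandwich exchange_big/=.
under eq_bigr => k _ do rewrite -mulr_suml hpair_mx_div.
rewrite (bigD1 (inord 0))//= eqxx mulr1 hpair_mx_coord big1 ?addr0 => [|k k0].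
  by rewrite natrM; ring.
by rewrite (negbTE k0) mulr0 mul0r.
Qed.

(** One half of the Laplace-Beltrami operator in non-divergence form; its drift is
    [- 2 (1 + |w|^2) w]. *)
Definition hp_generator f w : R :=
  2^-1 * (1 + hnorm2 w) *
  (\sum_i pd i (pd i f) w +
   \sum_i \sum_j hpair_gram w i j * pd i (pd j f) w -
   4 * \sum_i hcoord i w * pd i f w).

Lemma is_derive_powR1D (b s : R) : -1 < s ->
  is_derive s 1 (fun s : R => (1 + s) `^ b) (b * (1 + s) `^ (b - 1)).
Proof.
move=> s1; have s0 : 0 < 1 + s by lra.
have d1 : is_derive s 1 (fun s : R => 1 + s) 1.
  have := is_deriveD (is_derive_cst (1 : R) s (1 : R)) (is_derive_id s (1 : R)).
  by rewrite add0r.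
have := is_derive1_comp (is_derive1_powR b s0) d1.
by rewrite mulr1.
Qed.

(** The domain [-1 < s] is an open neighbourhood of the values of [|w|^2], so that derivatives at
    [0] are two-sided. *)
Lemma smooth1_powR1D (a : R) k :
  smooth1_upto [set s | -1 < s] k (fun s : R => (1 + s) `^ a).
Proof.
elim: k a => [|k IH] a.
  by move=> s /= s1; apply: is_derive1_continuous; exact: is_derive_powR1D.
exists (fun s => a * (1 + s) `^ (a - 1)); split; first by move=> s /= /is_derive_powR1D.
by apply: smooth1_uptoM; [exact: smooth1_upto_cst|exact: IH].
Qed.

Lemma hnorm2_gtN1 w : [set s : R | -1 < s] (hnorm2 w).
Proof. by rewrite /= (lt_le_trans _ (hnorm2_ge0 w))// ltrN10. Qed.

Lemma onePhnorm2_gt0 w : 0 < 1 + hnorm2 w.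
Proof. by have := hnorm2_ge0 w; lra. Qed.

Lemma smooth_radial (h : R -> R) : smooth1 [set s | -1 < s] h ->
  smooth (fun w : 'M[R]_(n, 4) => h (hnorm2 w)).
Proof.
move=> sh k; apply: (@Ck_comp1 _ _ k [set s | -1 < s]); first exact: hnorm2_gtN1.
  exact: sh.
exact: smooth_hnorm2.
Qed.

Lemma partial_radial i (h h' : R -> R) :
  (forall s : R, -1 < s -> is_derive s 1 h (h' s)) ->
  partial i (fun w : 'M[R]_(n, 4) => h (hnorm2 w)) =
  (fun w => h' (hnorm2 w) * (2 * hcoord i w)).
Proof.
move=> dh.
have dh' w : is_derive (hnorm2 w) 1 h (h' (hnorm2 w)) by apply: dh; exact: hnorm2_gtN1.
by rewrite (partial_comp1 i smooth_hnorm2 dh') partial_hnorm2.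
Qed.

Lemma pd_radial i (h h' : R -> R) :
  (forall s : R, -1 < s -> is_derive s 1 h (h' s)) ->
  pd i (fun w : 'M[R]_(n, 4) => h (hnorm2 w)) =
  (fun w => h' (hnorm2 w) * (2 * hcoord i w)).
Proof. by move=> dh; rewrite pdE (partial_radial i dh). Qed.

Lemma sqrt_det_hp_gram w :
  Num.sqrt (\det (hp_gram w)) = (1 + hnorm2 w) ^- (2 * n + 2).
Proof.
rewrite det_hp_gram.
have -> : (4 * n + 4 = (2 * n + 2) * 2)%N by rewrite mulnDl mulnAC.
rewrite exprM -exprVn sqrtr_sqr ger0_norm// invr_ge0 exprn_ge0// ltW//.
exact: onePhnorm2_gt0.
Qed.

Lemma laplace_beltramiE f w : smooth f ->
  2^-1 * laplace_beltrami f w = hp_generator f w.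
Proof.
move=> sf.
(* The volume density [(1 + v)^-(2 n + 2)] and the factor [1 + v] of the inverse metric combine into
   this power. *)
pose a : R := - (2 * n + 1)%:R.
have sp : smooth (fun x => (1 + hnorm2 x) `^ a).
  exact: (smooth_radial (smooth1_powR1D a)).
have sG i j : smooth (fun x => (i == j)%:R + hpair_gram x i j : R).
  by apply: smoothD; [exact: smooth_cst|exact: smooth_hpair_gram].
have wE (i j : 'I_(n * 4)) : (fun y => Num.sqrt (\det (hp_gram y)) *
      invmx (hp_gram y) i j * partial j f y) =
    (fun y => (1 + hnorm2 y) `^ a *
              (((i == j)%:R + hpair_gram y i j) * partial j f y)).
  apply/funext => y; rewrite sqrt_det_hp_gram invmx_hp_gram mulrA.
  congr (_ * _); rewrite mxE [X in _ * (_ * X)]mxE [X in _ * (_ * (X + _))]mxE mulrA.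
  congr (_ * _); have y0 := onePhnorm2_gt0 y.
  rewrite /a powR_invn ?(ltW y0)// (_ : (2 * n + 2 = (2 * n + 1).+1)%N).
    by rewrite exprS; field; rewrite ?gt_eqF ?exprn_gt0.
  by rewrite addn2 addn1.
have S1 : \sum_i \sum_j ((i == j)%:R + hpair_gram w i j) * partial i (partial j f) w =
    \sum_i partial i (partial i f) w +
    \sum_i \sum_j hpair_gram w i j * partial i (partial j f) w.
  rewrite -big_split; apply: eq_bigr => i _ /=.
  under eq_bigr do rewrite mulrDl; rewrite big_split/=; congr (_ + _).
  rewrite (bigD1 i)//= eqxx mul1r big1 ?addr0// => j ji.
  by rewrite eq_sym (negbTE ji) mul0r.
have S2 : \sum_i \sum_j partial i (fun x => hpair_gram x i j) w * partial j f w =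
    (4 * n%:R - 2) * \sum_j hcoord j w * partial j f w.
  rewrite exchange_big mulr_sumr; apply: eq_bigr => j _ /=.
  by rewrite -mulr_suml div_hpair_gram mulrA.
have S3 : \sum_i \sum_j hcoord i w * (((i == j)%:R + hpair_gram w i j) * partial j f w) =
    (1 + hnorm2 w) * \sum_j hcoord j w * partial j f w.
  rewrite exchange_big mulr_sumr; apply: eq_bigr => j _ /=.
  under eq_bigr do rewrite mulrA; rewrite -mulr_suml mulrA; congr (_ * _).
  under eq_bigr do rewrite mulrDr; rewrite big_split/= hcoord_hpair_gram mulrDl mul1r.
  congr (_ + _); rewrite (bigD1 j)//= eqxx mulr1 big1 ?addr0// => i ij.
  by rewrite (negbTE ij) mulr0.
(* The three terms are the second-order part, the divergence of [hpair_gram], which contributes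
   [4 n - 2] to the radial drift, and the derivative of the power, which contributes
   [2 a = - 4 n - 2]. The drift coefficient [- 4] of [hp_generator] is their sum. *)
have T i j : partial i (fun y => Num.sqrt (\det (hp_gram y)) *
      invmx (hp_gram y) i j * partial j f y) w =
    (1 + hnorm2 w) `^ a * (((i == j)%:R + hpair_gram w i j) * partial i (partial j f) w) +
    (1 + hnorm2 w) `^ a * (partial i (fun x => hpair_gram x i j) w * partial j f w) +
    2 * a * (1 + hnorm2 w) `^ (a - 1) *
      (hcoord i w * (((i == j)%:R + hpair_gram w i j) * partial j f w)).
  rewrite wE partialM//; last by apply: smoothM => //; exact: smooth_partial.
  rewrite partialM//; last exact: smooth_partial.
  rewrite partialD; [|exact: smooth_cst|exact: smooth_hpair_gram].
  rewrite partial_cst (partial_radial i (is_derive_powR1D a)) add0r.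
  by ring.
rewrite /laplace_beltrami.
under eq_bigr => i _ do under eq_bigr => j _ do rewrite T.
have -> : \sum_i \sum_j
    ((1 + hnorm2 w) `^ a * (((i == j)%:R + hpair_gram w i j) * partial i (partial j f) w) +
    (1 + hnorm2 w) `^ a * (partial i (fun x => hpair_gram x i j) w * partial j f w) +
    2 * a * (1 + hnorm2 w) `^ (a - 1) *
      (hcoord i w * (((i == j)%:R + hpair_gram w i j) * partial j f w))) =
    (1 + hnorm2 w) `^ a *
      (\sum_i \sum_j ((i == j)%:R + hpair_gram w i j) * partial i (partial j f) w) +
    (1 + hnorm2 w) `^ a *
      (\sum_i \sum_j partial i (fun x => hpair_gram x i j) w * partial j f w) +
    2 * a * (1 + hnorm2 w) `^ (a - 1) *
      (\sum_i \sum_j hcoord i w * (((i == j)%:R + hpair_gram w i j) * partial j f w)).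
  rewrite !mulr_sumr -!big_split; apply: eq_bigr => i _ /=.
  by rewrite !mulr_sumr -!big_split.
rewrite S1 S2 S3 sqrt_det_hp_gram /hp_generator.
have -> : \sum_i pd i (pd i f) w = \sum_i partial i (partial i f) w.
  by apply: eq_bigr => i _; rewrite !pdE.
have -> : \sum_i \sum_j hpair_gram w i j * pd i (pd j f) w =
    \sum_i \sum_j hpair_gram w i j * partial i (partial j f) w.
  by apply: eq_bigr => i _; apply: eq_bigr => j _; rewrite !pdE.
have -> : \sum_i hcoord i w * pd i f w = \sum_i hcoord i w * partial i f w.
  by apply: eq_bigr => i _; rewrite !pdE.
have y0 := onePhnorm2_gt0 w.
have -> : (1 + hnorm2 w) `^ (a - 1) = (1 + hnorm2 w) `^ a / (1 + hnorm2 w).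
  by rewrite powRB ?(gt_eqF y0) ?implybT// powRr1 ?(ltW y0).
have -> : (1 + hnorm2 w) `^ a = (1 + hnorm2 w) ^- (2 * n + 1).
  by rewrite /a powR_invn ?(ltW y0).
rewrite (_ : (2 * n + 2 = (2 * n + 1).+1)%N); last by rewrite addn2 addn1.
rewrite exprS /a natrD natrM; field.
by rewrite ?gt_eqF ?exprn_gt0.
Qed.

End laplace_beltrami_formula.

(** * Leibniz rule, radial functions and linear functions *)

Section generator_calculus.

Context (R : realType) (n : nat).
Implicit Types (f g h : 'M[R]_(n, 4) -> R) (w y z : 'M[R]_(n, 4)).

(** The carre du champ of [hp_generator], normalized to be exactly the defect in the Leibniz rule
    [hp_generatorM]; it is the density of the bracket of [f] and [g] along the Brownian motion. *)
Definition hp_gamma f g w : R :=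
  (1 + hnorm2 w) *
  (\sum_i pd i f w * pd i g w +
   \sum_i \sum_j hpair_gram w i j * (pd i f w * pd j g w)).

Lemma hpair_gram_sym w i j : hpair_gram w i j = hpair_gram w j i.
Proof. by rewrite !hpair_gramE; apply: eq_bigr => k _; rewrite mulrC. Qed.

Lemma hp_gammaC f g w : hp_gamma f g w = hp_gamma g f w.
Proof.
rewrite /hp_gamma; congr (_ * (_ + _)).
  by apply: eq_bigr => i _; rewrite mulrC.
rewrite exchange_big; apply: eq_bigr => i _; apply: eq_bigr => j _.
by rewrite hpair_gram_sym [X in _ * X]mulrC.
Qed.

Lemma hp_gammaM f g h w : smooth g -> smooth h ->
  hp_gamma f (fun z => g z * h z) w = g w * hp_gamma f h w + h w * hp_gamma f g w.
Proof.
move=> sg sh.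
have E1 : \sum_i pd i f w * pd i (fun z => g z * h z) w =
    g w * (\sum_i pd i f w * pd i h w) +
    h w * (\sum_i pd i f w * pd i g w).
  rewrite !mulr_sumr -!big_split; apply: eq_bigr => i _ /=.
  by rewrite (pdM _ sg sh); ring.
have E2 : \sum_i \sum_j hpair_gram w i j *
      (pd i f w * pd j (fun z => g z * h z) w) =
    g w * (\sum_i \sum_j hpair_gram w i j * (pd i f w * pd j h w)) +
    h w * (\sum_i \sum_j hpair_gram w i j * (pd i f w * pd j g w)).
  rewrite !mulr_sumr -!big_split; apply: eq_bigr => i _ /=.
  rewrite !mulr_sumr -!big_split; apply: eq_bigr => j _ /=.
  by rewrite (pdM _ sg sh); ring.
by rewrite /hp_gamma E1 E2; ring.
Qed.

Lemma hp_generatorM f g w : smooth f -> smooth g ->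
  hp_generator (fun z => f z * g z) w =
  f w * hp_generator g w + g w * hp_generator f w + hp_gamma f g w.
Proof.
move=> sf sg.
have D2 i j : pd i (pd j (fun z => f z * g z)) w =
    f w * pd i (pd j g) w + g w * pd i (pd j f) w +
    (pd i f w * pd j g w + pd j f w * pd i g w).
  have sf' := smooth_pd j sf; have sg' := smooth_pd j sg.
  rewrite (pdM j sf sg) (pdD i (smoothM sf sg') (smoothM sf' sg)).
  rewrite (pdM i sf sg') (pdM i sf' sg).
  by ring.
have E1 : \sum_i pd i (pd i (fun z => f z * g z)) w =
    f w * (\sum_i pd i (pd i g) w) + g w * (\sum_i pd i (pd i f) w) +
    2 * \sum_i pd i f w * pd i g w.
  rewrite !mulr_sumr -!big_split; apply: eq_bigr => i _ /=.
  rewrite (D2 i i).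
  by ring.
have E2 : \sum_i \sum_j hpair_gram w i j * pd i (pd j (fun z => f z * g z)) w =
    f w * (\sum_i \sum_j hpair_gram w i j * pd i (pd j g) w) +
    g w * (\sum_i \sum_j hpair_gram w i j * pd i (pd j f) w) +
    (\sum_i \sum_j hpair_gram w i j * (pd i f w * pd j g w) +
     \sum_i \sum_j hpair_gram w i j * (pd j f w * pd i g w)).
  rewrite !mulr_sumr -!big_split; apply: eq_bigr => i _ /=.
  rewrite !mulr_sumr -!big_split; apply: eq_bigr => j _ /=.
  rewrite (D2 i j).
  by ring.
have E3 : \sum_i \sum_j hpair_gram w i j * (pd j f w * pd i g w) =
    \sum_i \sum_j hpair_gram w i j * (pd i f w * pd j g w).
  rewrite exchange_big; apply: eq_bigr => i _; apply: eq_bigr => j _.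
  by rewrite hpair_gram_sym.
have E4 : \sum_i hcoord i w * pd i (fun z => f z * g z) w =
    f w * (\sum_i hcoord i w * pd i g w) + g w * (\sum_i hcoord i w * pd i f w).
  rewrite !mulr_sumr -!big_split; apply: eq_bigr => i _ /=.
  by rewrite (pdM _ sf sg); ring.
by rewrite /hp_generator /hp_gamma E1 E2 E3 E4; field.
Qed.

Lemma hpair_gram_trace w : \sum_i hpair_gram w i i = 4 * hnorm2 w.
Proof.
rewrite -[LHS]/(\tr (hpair_gram w)) mxtrace_mulC hpair_mx_orthogonal.
by rewrite mxtrace_scalar mulr_natl.
Qed.

(** The Hessian of a radial function is a combination of [w^T w] and the identity, so [hpair_gram]
    enters only through its radial eigenvalue [|w|^2] and its trace [4 |w|^2]. *)
Lemma hp_generator_radial (p p' p'' : R -> R) w :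
  smooth1 [set s | -1 < s] p' ->
  (forall s : R, -1 < s -> is_derive s 1 p (p' s)) ->
  (forall s : R, -1 < s -> is_derive s 1 p' (p'' s)) ->
  hp_generator (fun z => p (hnorm2 z)) w =
  2 * hnorm2 w * (1 + hnorm2 w) ^+ 2 * p'' (hnorm2 w) +
  4 * n%:R * (1 + hnorm2 w) * p' (hnorm2 w).
Proof.
move=> sp' dp dp'.
have D2 i j : pd i (pd j (fun z => p (hnorm2 z))) w =
    4 * p'' (hnorm2 w) * (hcoord i w * hcoord j w) + 2 * p' (hnorm2 w) * (i == j)%:R.
  rewrite (pd_radial j dp) pdM; [|exact: smooth_radial|]; last first.
    by apply: smoothM; [exact: smooth_cst|exact: smooth_hcoord].
  rewrite (pd_radial i dp') pdM; [|exact: smooth_cst|exact: smooth_hcoord].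
  by rewrite pd_cst pd_hcoord eq_sym; ring.
have E1 : \sum_i pd i (pd i (fun z => p (hnorm2 z))) w =
    4 * p'' (hnorm2 w) * hnorm2 w + 8 * n%:R * p' (hnorm2 w).
  under eq_bigr do rewrite D2 eqxx mulr1.
  rewrite big_split/= -mulr_sumr sumr_const card_ord; congr (_ + _).
    by rewrite hnorm2E; congr (_ * _); apply: eq_bigr => i _; rewrite expr2.
  by rewrite -[LHS]mulr_natr natrM; ring.
have E2 : \sum_i \sum_j hpair_gram w i j * pd i (pd j (fun z => p (hnorm2 z))) w =
    4 * p'' (hnorm2 w) * hnorm2 w ^+ 2 + 8 * p' (hnorm2 w) * hnorm2 w.
  under eq_bigr => i _ do under eq_bigr => j _ do rewrite D2 mulrDr.
  under eq_bigr => i _ do rewrite big_split/=.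
  rewrite big_split/=; congr (_ + _).
    rewrite exchange_big/= [RHS](_ : _ = \sum_j 4 * p'' (hnorm2 w) * hcoord j w *
      (hnorm2 w * hcoord j w)); last first.
      rewrite (_ : _ * _ ^+ 2 = 4 * p'' (hnorm2 w) * hnorm2 w *
        \sum_j hcoord j w ^+ 2); last by rewrite -hnorm2E; ring.
      by rewrite mulr_sumr; apply: eq_bigr => j _; ring.
    apply: eq_bigr => j _; rewrite -hcoord_hpair_gram mulr_sumr.
    by apply: eq_bigr => i _; ring.
  rewrite (_ : 8 * _ * _ = 2 * p' (hnorm2 w) * (4 * hnorm2 w)); last by ring.
  rewrite -hpair_gram_trace mulr_sumr; apply: eq_bigr => i _.
  rewrite (bigD1 i)//= eqxx mulr1 big1 ?addr0 => [|j ji]; first by ring.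
  by rewrite eq_sym (negbTE ji) !mulr0.
have E4 : \sum_i hcoord i w * pd i (fun z => p (hnorm2 z)) w =
    2 * p' (hnorm2 w) * hnorm2 w.
  rewrite [in RHS]hnorm2E mulr_sumr; apply: eq_bigr => i _.
  by rewrite (pd_radial i dp) -hnorm2E; ring.
by rewrite /hp_generator E1 E2 E4; field.
Qed.

Lemma hp_gamma_radial f (p p' : R -> R) w :
  (forall s : R, -1 < s -> is_derive s 1 p (p' s)) ->
  hp_gamma f (fun z => p (hnorm2 z)) w =
  2 * (1 + hnorm2 w) ^+ 2 * p' (hnorm2 w) * \sum_i hcoord i w * pd i f w.
Proof.
move=> dp; rewrite /hp_gamma.
have -> : \sum_i pd i f w * pd i (fun z => p (hnorm2 z)) w =
    2 * p' (hnorm2 w) * \sum_i hcoord i w * pd i f w.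
  rewrite mulr_sumr; apply: eq_bigr => i _.
  by rewrite (pd_radial i dp); ring.
have -> : \sum_i \sum_j hpair_gram w i j *
      (pd i f w * pd j (fun z => p (hnorm2 z)) w) =
    2 * p' (hnorm2 w) * hnorm2 w * \sum_i hcoord i w * pd i f w.
  rewrite mulr_sumr; apply: eq_bigr => i _.
  rewrite (_ : 2 * _ * _ * _ = 2 * p' (hnorm2 w) * pd i f w * (hnorm2 w * hcoord i w));
    last by ring.
  rewrite -hcoord_hpair_gram mulr_sumr; apply: eq_bigr => j _.
  by rewrite (pd_radial j dp) hpair_gram_sym; ring.
by ring.
Qed.

Lemma pd_hdot z i : pd i (hdot z) = (fun=> hcoord i z).
Proof.
rewrite /hdot pd_sum; last first.
  by move=> l; apply: smoothM; [exact: smooth_cst|exact: smooth_hcoord].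
apply/funext => w; rewrite (bigD1 i)//= big1 ?addr0 => [|l li];
  rewrite pdM; [|exact: smooth_cst|exact: smooth_hcoord|
                      |exact: smooth_cst|exact: smooth_hcoord];
  rewrite pd_cst pd_hcoord mul0r addr0.
  by rewrite eqxx mulr1.
by rewrite (negbTE li) mulr0.
Qed.

Lemma smooth_hdot z : smooth (hdot z).
Proof.
by apply: smooth_sum => i; apply: smoothM; [exact: smooth_cst|exact: smooth_hcoord].
Qed.

Lemma hp_generator_hdot z w :
  hp_generator (hdot z) w = - 2 * (1 + hnorm2 w) * hdot z w.
Proof.
rewrite /hp_generator.
have D2 i j : pd i (pd j (hdot z)) w = 0 by rewrite pd_hdot pd_cst.
under eq_bigr do rewrite D2; rewrite big1//.
under eq_bigr => i _ do under eq_bigr => j _ do rewrite D2 mulr0.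
under eq_bigr => i _ do rewrite big1//.
rewrite big1// addr0 sub0r.
have -> : \sum_i hcoord i w * pd i (hdot z) w = hdot z w.
  by apply: eq_bigr => i _; rewrite pd_hdot mulrC.
by field.
Qed.

Lemma hp_gamma_hdot_radial z (p p' : R -> R) w :
  (forall s : R, -1 < s -> is_derive s 1 p (p' s)) ->
  hp_gamma (hdot z) (fun z => p (hnorm2 z)) w =
  2 * (1 + hnorm2 w) ^+ 2 * p' (hnorm2 w) * hdot z w.
Proof.
move=> dp; rewrite (hp_gamma_radial _ _ dp); congr (_ * _).
by apply: eq_bigr => i _; rewrite pd_hdot mulrC.
Qed.

Lemma sum_hpair_mx z w k : \sum_i hcoord i z * hpair_mx w i k = hpair w z 0 k.
Proof.
rewrite sum_mxvec /hpair summxE; apply: eq_bigr => m _.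
under eq_bigr do rewrite hpair_mx_index hcoord_index.
rewrite sum_ord4; elim/ord4_ind: k;
  by rewrite /qmul !mkquatE !qconjE !qunitE ?inord4_eq//= !mxE; ring.
Qed.

Lemma hp_gamma_hdot z w :
  hp_gamma (hdot z) (hdot z) w =
  (1 + hnorm2 w) * (hdot z z + edot (hpair w z) (hpair w z)).
Proof.
rewrite /hp_gamma; congr (_ * (_ + _)).
  by apply: eq_bigr => i _; rewrite !pd_hdot.
rewrite /edot; under [RHS]eq_bigr do rewrite -sum_hpair_mx mulr_suml.
rewrite [RHS]exchange_big; apply: eq_bigr => i _ /=.
under [RHS]eq_bigr do rewrite mulr_sumr.
rewrite [RHS]exchange_big; apply: eq_bigr => j _ /=.
rewrite hpair_gramE mulr_suml; apply: eq_bigr => k _.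
by rewrite !pd_hdot; ring.
Qed.

End generator_calculus.

(** * Increments of the area *)

Section area_kernel.
Context (R : realType) (n : nat) (lambda : 'rV[R]_3).
Implicit Types (w y z : 'M[R]_(n, 4)) (p q : 'rV[R]_4).

Definition imquat : 'rV[R]_4 :=
  mkquat 0 (lambda 0 (inord 0)) (lambda 0 (inord 1)) (lambda 0 (inord 2)).

(** Left multiplication by the imaginary quaternion [lambda]. It represents the area form: the
    differential of [lambda . a] is the scalar product of [imrot w] with [dw], divided by
    [1 + |w|^2]. *)
Definition imrot y : 'M[R]_(n, 4) := \matrix_(j < n) qmul imquat (row j y).

Lemma row_imrot j y : row j (imrot y) = qmul imquat (row j y).
Proof. exact: rowK. Qed.

Lemma sum_ord3 (V : nmodType) (f : 'I_3 -> V) :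
  \sum_(k < 3) f k = f (inord 0) + f (inord 1) + f (inord 2).
Proof.
rewrite !big_ord_recr big_ord0 /= add0r.
by do !(congr (_ + _)); congr f; apply/val_inj => /=; rewrite inordK.
Qed.

Lemma qimE p :
  (qim p 0 (inord 0) = p 0 (inord 1)) * (qim p 0 (inord 1) = p 0 (inord 2)) *
  (qim p 0 (inord 2) = p 0 (inord 3)).
Proof.
by rewrite /qim !mxE; do !split; congr (p 0 _); apply/val_inj; rewrite /= !inordK.
Qed.

Lemma edot_qim p q :
  edot lambda (qim (qmul p (qconj q))) = edot (qmul imquat q) p.
Proof. by rewrite /edot sum_ord3 sum_ord4 !qimE /qmul !mkquatE !qconjE; ring. Qed.

Lemma edot_imquat_anti p q : edot (qmul imquat p) q = - edot (qmul imquat q) p.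
Proof. by rewrite /edot !sum_ord4 /qmul !mkquatE; ring. Qed.

Lemma edot_imquat p : edot (qmul imquat p) (qmul imquat p) = edot lambda lambda * edot p p.
Proof. by rewrite /edot !sum_ord4 sum_ord3 /qmul !mkquatE; ring. Qed.

Lemma qmul_imquat_conj p : qmul (qmul imquat p) (qconj p) = edot p p *: imquat.
Proof.
by apply/rowP; apply: ord4_ind;
  rewrite [RHS]mxE /edot sum_ord4 /imquat /qmul !mkquatE !qconjE; ring.
Qed.

Lemma edot_imquat_self : edot imquat imquat = edot lambda lambda.
Proof. by rewrite /edot sum_ord4 sum_ord3 !mkquatE; ring. Qed.

Lemma hdot_imrot y z :
  hdot (imrot y) z = \sum_j edot lambda (qim (qmul (row j z) (qconj (row j y)))).
Proof. by rewrite -sum_edot_row; apply: eq_bigr => j _; rewrite row_imrot edot_qim. Qed.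

Lemma hdot_imrot_anti y z : hdot (imrot y) z = - hdot (imrot z) y.
Proof.
rewrite -!sum_edot_row -sumrN; apply: eq_bigr => j _.
by rewrite !row_imrot edot_imquat_anti.
Qed.

Lemma hdot_imrot_self y : hdot (imrot y) y = 0.
Proof. by have := hdot_imrot_anti y y; lra. Qed.

Lemma hdot_self y : hdot y y = hnorm2 y.
Proof. by rewrite hnorm2E; apply: eq_bigr => i _; rewrite expr2. Qed.

Lemma hdot_imrot_imrot y : hdot (imrot y) (imrot y) = edot lambda lambda * hnorm2 y.
Proof.
rewrite -sum_edot_row -hdot_self -sum_edot_row mulr_sumr.
by apply: eq_bigr => j _; rewrite !row_imrot edot_imquat.
Qed.

Lemma hpair_imrot y : hpair y (imrot y) = hnorm2 y *: imquat.
Proof.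
rewrite /hpair -hdot_self -sum_edot_row scaler_suml.
by apply: eq_bigr => j _; rewrite row_imrot qmul_imquat_conj.
Qed.

Lemma hcoord_imrot y i : hcoord i (imrot y) = - hdot (imrot (hbasis R n i)) y.
Proof.
rewrite -hdot_imrot_anti /hdot (bigD1 i)//= hcoord_hbasis eqxx mulr1 big1 ?addr0//.
by move=> j ji; rewrite hcoord_hbasis (negbTE ji) mulr0.
Qed.

(** Written as a real power, so that [smooth1_powR1D] gives its smoothness. *)
Definition rho w : R := (1 + hnorm2 w) `^ (-1).

Lemma rhoE w : rho w = (1 + hnorm2 w)^-1.
Proof. by rewrite /rho powR_inv1// ltW// onePhnorm2_gt0. Qed.

Lemma smooth_rho : smooth rho.
Proof.
exact: (@smooth_radial R n (fun s => (1 + s) `^ (-1)) (smooth1_powR1D (-1))).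
Qed.

(** One term of the midpoint sum of [lambda . a], for consecutive positions [y] and [z]. The
    increment [z - y] may be replaced by [z] because [imrot y] is orthogonal to [y]; see
    [stratonovich_term]. *)
Definition area_incr y z : R := 2^-1 * (rho y + rho z) * hdot (imrot y) z.

Let avg y (s : R) : R := 2^-1 * (rho y + (1 + s) `^ (-1)).

Let avg' (s : R) : R := 2^-1 * (-1 * (1 + s) `^ (-1 - 1)).

Let is_derive_avg y (s : R) : -1 < s -> is_derive s 1 (avg y) (avg' s).
Proof.
move=> s1; have H := is_derive_powR1D (-1) s1.
have := is_deriveM (is_derive_cst (2^-1 : R) s 1)
                   (is_deriveD (is_derive_cst (rho y) s 1) H).
by rewrite add0r scaler0 addr0.
Qed.

Let smooth1_avg y : smooth1 [set s | -1 < s] (avg y).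
Proof.
move=> k; apply: smooth1_uptoM; first exact: smooth1_upto_cst.
by apply: smooth1_uptoD; [exact: smooth1_upto_cst|exact: smooth1_powR1D].
Qed.

Let area_incrE y : area_incr y = (fun z => avg y (hnorm2 z) * hdot (imrot y) z).
Proof. by []. Qed.

Let smooth_avg y : smooth (fun z : 'M[R]_(n, 4) => avg y (hnorm2 z)).
Proof. exact: (@smooth_radial R n (avg y) (smooth1_avg y)). Qed.

Lemma smooth_area_incr y : smooth (area_incr y).
Proof. by rewrite area_incrE; apply: smoothM => //; exact: smooth_hdot. Qed.

Lemma area_incr_self y : area_incr y y = 0.
Proof. by rewrite /area_incr hdot_imrot_self mulr0. Qed.

(** Each term of the Leibniz rule carries the scalar product of [imrot y] with [y], which is zero.
    This expresses that [lambda . a] has no drift. *)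
Lemma hp_generator_area_incr y : hp_generator (area_incr y) y = 0.
Proof.
rewrite area_incrE (hp_generatorM _ (smooth_avg y) (smooth_hdot _)).
rewrite hp_generator_hdot hp_gammaC (hp_gamma_hdot_radial _ _ (is_derive_avg y)).
by rewrite hdot_imrot_self !(mulr0, mul0r) !addr0.
Qed.

(** The field [imrot] is tangent to the spheres centred at the origin, hence has no bracket with
    radial functions. *)
Lemma hp_gamma_area_incr_radial y (h h' : R -> R) :
  smooth1 [set s | -1 < s] h ->
  (forall s : R, -1 < s -> is_derive s 1 h (h' s)) ->
  hp_gamma (area_incr y) (fun z => h (hnorm2 z)) y = 0.
Proof.
move=> sh dh; rewrite hp_gammaC area_incrE.
rewrite (hp_gammaM _ _ (smooth_avg y) (smooth_hdot _)).
by rewrite [hp_gamma _ (hdot _) _]hp_gammaC (hp_gamma_hdot_radial _ _ dh)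
  hdot_imrot_self !(mulr0, mul0r) addr0.
Qed.

(** Writing [v = |y|^2], the squared length of [imrot y] is [|lambda|^2 v] and that of its pairing
    with [y] is [|lambda|^2 v^2]; the factor [1 + v] of their sum cancels against
    [rho^2 (1 + v)]. *)
Lemma hp_gamma_area_incr y :
  hp_gamma (area_incr y) (area_incr y) y = edot lambda lambda * hnorm2 y.
Proof.
rewrite {2}area_incrE (hp_gammaM _ _ (smooth_avg y) (smooth_hdot _)).
rewrite hdot_imrot_self mul0r addr0 hp_gammaC area_incrE.
rewrite (hp_gammaM _ _ (smooth_avg y) (smooth_hdot _)) hdot_imrot_self mul0r addr0.
rewrite hp_gamma_hdot hdot_imrot_imrot hpair_imrot.
have -> : edot (hnorm2 y *: imquat) (hnorm2 y *: imquat) =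
    hnorm2 y ^+ 2 * edot lambda lambda.
  rewrite -edot_imquat_self /edot mulr_sumr; apply: eq_bigr => k _.
  by rewrite !mxE; ring.
rewrite /avg -/(rho y) rhoE; field.
by rewrite gt_eqF// onePhnorm2_gt0.
Qed.

(* The martingale problem applies to [z |-> k y z], [y] being frozen at an earlier
   time, as soon as [k] is a finite sum of products. *)
Definition separable (k : 'M[R]_(n, 4) -> 'M[R]_(n, 4) -> R) : Prop :=
  exists (I : finType) (g h : I -> 'M[R]_(n, 4) -> R),
    [/\ forall i, continuous (g i), forall i, smooth (h i)
      & forall y z, k y z = \sum_i g i y * h i z].

Lemma separable_mul (g h : 'M[R]_(n, 4) -> R) : continuous g -> smooth h ->
  separable (fun y z => g y * h z).
Proof.
move=> cg sh; exists unit, (fun=> g), (fun=> h); split=> // y z.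
by rewrite (big_pred1 tt)// => -[].
Qed.

Lemma separableD k l : separable k -> separable l ->
  separable (fun y z => k y z + l y z).
Proof.
move=> [I [g [h [cg sh kE]]]] [J [g' [h' [cg' sh' lE]]]].
exists (I + J)%type, (fun i => match i with inl a => g a | inr b => g' b end),
  (fun i => match i with inl a => h a | inr b => h' b end); split.
- by case.
- by case.
- by move=> y z; rewrite big_sumType/= kE lE.
Qed.

Lemma separableM k l : separable k -> separable l ->
  separable (fun y z => k y z * l y z).
Proof.
move=> [I [g [h [cg sh kE]]]] [J [g' [h' [cg' sh' lE]]]].
exists (I * J)%type, (fun i y => g i.1 y * g' i.2 y), (fun i z => h i.1 z * h' i.2 z).
split.
- by move=> [i j] y; exact: (cvgM (cg i y) (cg' j y)).
- by move=> [i j]; exact: smoothM.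
- move=> y z; rewrite kE lE big_distrlr/= pair_bigA/=.
  by apply: eq_bigr => -[i j] _ /=; ring.
Qed.

Lemma separable_sum (I : finType) (k : I -> 'M[R]_(n, 4) -> 'M[R]_(n, 4) -> R) :
  (forall i, separable (k i)) -> separable (fun y z => \sum_i k i y z).
Proof.
move=> sk; suff : forall s : seq I, separable (fun y z => \sum_(i <- s) k i y z).
  by move=> /(_ (index_enum I)).
elim=> [|i s IH].
  have -> : (fun y z => \sum_(i <- [::]) k i y z) =
      (fun y z : 'M[R]_(n, 4) => (0 : R) * (0 : R)).
    by apply/funext => y; apply/funext => z; rewrite big_nil mul0r.
  by apply: (@separable_mul (fun=> 0) (fun=> 0));
    [exact: cst_continuous|exact: smooth_cst].
have -> : (fun y z => \sum_(l <- i :: s) k l y z) =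
    (fun y z => k i y z + \sum_(l <- s) k l y z).
  by apply/funext => y; apply/funext => z; rewrite big_cons.
exact: separableD.
Qed.

Lemma separable_area_incr : separable area_incr.
Proof.
have sr : separable (fun y z => 2^-1 * (rho y + rho z)).
  have -> : (fun y z => 2^-1 * (rho y + rho z)) =
      (fun y z : 'M[R]_(n, 4) => rho y * 2^-1 + 2^-1 * rho z).
    by apply/funext => y; apply/funext => z; ring.
  apply: separableD.
    apply: (@separable_mul rho (fun=> 2^-1)); last exact: smooth_cst.
    exact: smooth_continuous smooth_rho.
  by apply: (@separable_mul (fun=> 2^-1) rho); [exact: cst_continuous|exact: smooth_rho].
apply: (separableM sr); rewrite /hdot.
apply: separable_sum => i.
apply: (@separable_mul (fun y => hcoord i (imrot y)) (hcoord i)); last exact: smooth_hcoord.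
apply: smooth_continuous.
(* By antisymmetry this coordinate of [imrot y] is a linear form in [y]. *)
have -> : (fun y => hcoord i (imrot y)) =
    (fun y => (-1) * hdot (imrot (hbasis R n i)) y).
  by apply/funext => y; rewrite hcoord_imrot mulN1r.
by apply: smoothM; [exact: smooth_cst|exact: smooth_hdot].
Qed.

End area_kernel.

(** * Compactly supported test functions *)

Section test_functions.
Context (R : realType) (n : nat).
Implicit Types (f g : 'M[R]_(n, 4) -> R) (w x : 'M[R]_(n, 4)).

Lemma continuous_vec_mx : continuous (vec_mx : 'rV[R]_(n * 4) -> 'M[R]_(n, 4)).
Proof.
move=> u A /nbhs_ballP[e e0 eA]; apply/nbhs_ballP; exists e => //= u' H.
by apply: eA; split=> // i j; rewrite !mxE; case: H => _ /(_ 0 (mxvec_index i j)).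
Qed.

Lemma compact_hball (K : R) : compact [set w : 'M[R]_(n, 4) | hnorm2 w <= K].
Proof.
have [K0|K0] := ltP K 0.
  rewrite (_ : [set w | _] = set0); first exact: compact0.
  by apply/seteqP; split=> // w /= /le_lt_trans /(_ K0); rewrite ltNge hnorm2_ge0.
(* The half-side [1 + K] works because every coordinate satisfies [u_i^2 <= K <= (1 + K)^2]. *)
pose I (i : 'I_(n * 4)) : set R := `[- (1 + K), 1 + K]%classic.
have cI := rV_compact (fun i => @segment_compact R (- (1 + K)) (1 + K) : compact (I i)).
pose S := [set u : 'rV[R]_(n * 4) | hnorm2 (vec_mx u : 'M[R]_(n, 4)) <= K].
have clS : closed S.
  rewrite (_ : S = (fun u => hnorm2 (vec_mx u : 'M[R]_(n, 4))) @^-1` `]-oo, K]%classic).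
    apply: closed_comp; last exact: interval_closed.
    move=> u _; apply: (@continuous_comp _ _ _ vec_mx (@hnorm2 R n)).
      exact: continuous_vec_mx.
    exact: smooth_continuous (@smooth_hnorm2 R n) _.
  by apply/seteqP; split=> u /=; rewrite in_itv.
have cS : compact S.
  apply: (subclosed_compact clS cI) => u /= uS i.
  rewrite /I/= in_itv/= -ler_norml.
  have : u 0 i ^+ 2 <= K.
    apply: le_trans uS; rewrite hnorm2E (bigD1 i)//= /hcoord vec_mxK lerDl.
    by apply: sumr_ge0 => j _; exact: sqr_ge0.
  move=> uK; rewrite -(@ler_pXn2r _ 2)// ?nnegrE ?addr_ge0// real_normK ?num_real//.
  by apply: (le_trans uK); nra.
rewrite (_ : [set w | _] = vec_mx @` S).
  exact: continuous_compact (continuous_subspaceT continuous_vec_mx) cS.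
apply/seteqP; split=> [w wK|w [u uS <-]//].
by exists (mxvec w); rewrite ?/S/= mxvecK.
Qed.

Lemma continuous_bounded_hball f (K : R) : continuous f ->
  exists C : R, forall w, hnorm2 w <= K -> `|f w| <= C.
Proof.
move=> cf.
have := continuous_compact (continuous_subspaceT cf) (@compact_hball K).
move=> /compact_bounded [M [_ /(_ (M + 1))]].
rewrite ltrDl ltr01 => /(_ isT) H; exists (M + 1) => w wK.
by apply: H; exists w.
Qed.

(** Naming the ball, rather than asking for some compact support, makes the class visibly stable
    under the generator and under products with smooth functions. *)
Definition testfn (K : R) f : Prop :=
  smooth f /\ forall w, K < hnorm2 w -> f w = 0.

Lemma testfn_bounded K f : testfn K f -> exists C : R, forall w, `|f w| <= C.
Proof.
move=> [sf f0]; have [C CP] := continuous_bounded_hball K (smooth_continuous sf).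
exists (Num.max 0 C) => w; rewrite le_max.
have [wK|Kw] := leP (hnorm2 w) K; first by rewrite CP ?orbT.
by rewrite f0// normr0 lexx.
Qed.

Lemma testfn_test_function K f : testfn K f -> test_function f.
Proof.
move=> [sf f0]; split; first exact: sf.
apply: (subclosed_compact (@closed_closure _ _) (@compact_hball K)).
have clK : closed [set w : 'M[R]_(n, 4) | hnorm2 w <= K].
  by apply: compact_closed; [exact: norm_hausdorff|exact: compact_hball].
rewrite ((closure_id _).1 clK); apply: closure_subset => w /= /eqP fw.
by rewrite leNgt; apply/negP => /f0.
Qed.

Lemma testfnM K f g : testfn K f -> smooth g -> testfn K (fun w => g w * f w).
Proof.
move=> [sf f0] sg; split; first exact: smoothM.
by move=> w /f0 ->; rewrite mulr0.
Qed.

Lemma pd_vanish K f i w : (forall x, K < hnorm2 x -> f x = 0) -> K < hnorm2 w ->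
  pd i f w = 0.
Proof.
move=> f0 wK; rewrite pdE /partial -[RHS](derive_cst 0 w (hbasis R n i)).
apply: near_eq_derive.
have := @smooth_continuous _ _ _ (@smooth_hnorm2 R n) w.
move=> /(@cvgr_gt _ _ _ _ _ _) /(_ _ wK); apply: filterS => x.
exact: f0.
Qed.

Lemma smooth_hp_generator f : smooth f -> smooth (hp_generator f).
Proof.
move=> sf; apply: smoothM.
  apply: smoothM; first exact: smooth_cst.
  by apply: smoothD; [exact: smooth_cst|exact: smooth_hnorm2].
apply: smoothD.
  apply: smoothD; first by apply: smooth_sum => i; do 2 apply: smooth_pd.
  apply: smooth_sum => i; apply: smooth_sum => j; apply: smoothM.
    exact: smooth_hpair_gram.
  by do 2 apply: smooth_pd.
under eq_fun do rewrite -mulNr.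
apply: smoothM; first exact: smooth_cst.
apply: smooth_sum => i; apply: smoothM; first exact: smooth_hcoord.
exact: smooth_pd.
Qed.

Lemma testfn_hp_generator K f : testfn K f -> testfn K (hp_generator f).
Proof.
move=> [sf f0]; split; first exact: smooth_hp_generator.
move=> w wK; rewrite /hp_generator.
have p0 i x : K < hnorm2 x -> pd i f x = 0 by exact: pd_vanish.
have p00 i j : pd i (pd j f) w = 0 by apply: pd_vanish wK => x; exact: p0.
under eq_bigr do rewrite p00; rewrite big1//.
under eq_bigr => i _ do under eq_bigr => j _ do rewrite p00 mulr0.
under eq_bigr => i _ do rewrite big1//.
under [X in _ - _ * X]eq_bigr do rewrite p0// mulr0.
by rewrite !big1// !mulr0 !addr0 subr0 mulr0.
Qed.

(** [diffusion_step] asks for bounds on [f], on its generator and on the generator applied twice;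
    all three functions are supported in the same ball. *)
Lemma brownian_motion_HP_step (d : measure_display) (Omega : measurableType d)
    (P : probability Omega R) (F : R -> set (set Omega))
    (w : R -> Omega -> 'M[R]_(n, 4)) (K : R) f :
  brownian_motion_HP P F w -> testfn K f ->
  exists2 C : R, 0 <= C & forall (s h : R) (Y : Omega -> R), 0 <= s -> 0 <= h ->
    rv_measurable (F s) Y -> (forall omega, `|Y omega| <= 1) ->
    `|expect P (fun omega => Y omega *
        (f (w (s + h) omega) - f (w s omega) - h * hp_generator f (w s omega)))|
    <= C * h ^+ 2.
Proof.
move=> BM tf; have tLf := testfn_hp_generator tf; have tLLf := testfn_hp_generator tLf.
have [B fB] := testfn_bounded tf; have [C LfC] := testfn_bounded tLf.
have [D LLfD] := testfn_bounded tLLf.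
have gen g : testfn K g ->
    test_function g /\ hp_generator g = (fun x => 2^-1 * laplace_beltrami g x).
  move=> tg; split; first exact: testfn_test_function tg.
  by case: tg => sg _; apply/funext => x; rewrite laplace_beltramiE.
exists D; first by rewrite (le_trans _ (LLfD 0)).
move=> s h Y s0 h0 mY Y1.
by apply: (diffusion_step BM (gen _ tf) (gen _ tLf) _ _ _ fB LfC LLfD) => //;
  apply: smooth_continuous; [case: tf|case: tLf|case: tLLf].
Qed.

End test_functions.

(** * Second-order Taylor formula for the cosine *)

Section cosine_taylor.
Context (R : realType).

Lemma mean_value_bound (f f' : R -> R) (x M : R) :
  (forall y : R, is_derive y 1 f (f' y)) ->
  (forall c, `|c| <= `|x| -> `|f' c| <= M) -> `|f x - f 0| <= M * `|x|.
Proof.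
move=> df f'M.
have cf (a b : R) : {within `[a, b], continuous f}.
  by apply: continuous_subspaceT => y; apply: is_derive1_continuous; exact: df.
have [x0|x0] := leP 0 x.
  have [c] := @MVT_segment R f f' 0 x x0 (fun y _ => df y) (cf _ _).
  rewrite in_itv/= => /andP[c0 cx] ->; rewrite subr0 normrM ler_wpM2r//.
  by apply: f'M; rewrite !ger0_norm.
have [c] := @MVT_segment R f f' x 0 (ltW x0) (fun y _ => df y) (cf _ _).
rewrite in_itv/= => /andP[c0 cx] H; rewrite distrC H sub0r normrM normrN ler_wpM2r//.
by apply: f'M; rewrite !ler0_norm ?lerN2// ltW.
Qed.

(** Starting from [|sin| <= 1], three mean value bounds in a row give [|H| <= |y|], [|G| <= |y|^2]
    and the claim; the constant is [1] since suprema are taken instead of integrals. *)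
Lemma cos_taylor2 (t a : R) :
  `|cos (t + a) - (cos t - a * sin t - 2^-1 * a ^+ 2 * cos t)| <= `|a| ^+ 3.
Proof.
have dt (y : R) : is_derive y 1 (fun y => t + y) 1.
  have := is_deriveD (is_derive_cst (t : R) y (1 : R)) (is_derive_id y (1 : R)).
  by rewrite add0r.
have dc (y : R) : is_derive y 1 (fun y => cos (t + y)) (- sin (t + y)).
  by have := is_derive1_comp (is_derive_cos (t + y)) (dt y); rewrite mulr1.
have ds (y : R) : is_derive y 1 (fun y => sin (t + y)) (cos (t + y)).
  by have := is_derive1_comp (is_derive_sin (t + y)) (dt y); rewrite mulr1.
have dl (c y : R) : is_derive y 1 (fun y => c * y) c.
  have := is_deriveM (is_derive_cst (c : R) y (1 : R)) (is_derive_id y (1 : R)).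
  by move=> H; apply: (is_derive_eq H); rewrite scaler0 addr0 [_%:A]mulr1.
have dq (c y : R) : is_derive y 1 (fun y => c * (y * y)) (c * y + c * y).
  have := is_deriveM (is_derive_id y (1 : R)) (is_derive_id y (1 : R)).
  move=> /(is_deriveM (is_derive_cst (c : R) y (1 : R))) H.
  by apply: (is_derive_eq H); rewrite scaler0 addr0 [y%:A]mulr1 -mulrDr.
pose H y := cos t - cos (t + y).
have dH (y : R) : is_derive y 1 H (sin (t + y)).
  have := is_deriveB (is_derive_cst (cos t) y (1 : R)) (dc y).
  by rewrite sub0r opprK.
have HB y : `|H y| <= `|y|.
  have := @mean_value_bound H _ y 1 dH.
  rewrite /H addr0 subrr subr0 mul1r; apply => c _.
  by rewrite ler_norml sin_geN1 sin_le1.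
pose G y := sin t + cos t * y - sin (t + y).
have dG (y : R) : is_derive y 1 G (H y).
  have := is_deriveB (is_deriveD (is_derive_cst (sin t) y (1 : R)) (dl (cos t) y)) (ds y).
  by rewrite add0r.
have GB y : `|G y| <= `|y| * `|y|.
  have := @mean_value_bound G _ y `|y| dG.
  rewrite /G addr0 mulr0 addr0 subrr subr0; apply => c cy.
  exact: le_trans cy.
pose E y := cos (t + y) + sin t * y + 2^-1 * cos t * (y * y).
have dE (y : R) : is_derive y 1 E (G y).
  have := is_deriveD (is_deriveD (dc y) (dl (sin t) y)) (dq (2^-1 * cos t) y).
  by move=> K; apply: (is_derive_eq K); rewrite /G; field.
rewrite (_ : cos (t + a) - _ = E a - E 0); last by rewrite /E addr0; ring.
have -> : `|a| ^+ 3 = `|a| * `|a| * `|a| by ring.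
apply: (mean_value_bound dE) => c ca; apply: le_trans (GB c) _.
by rewrite ler_pM.
Qed.

End cosine_taylor.

(** * One-step estimate for functions of two consecutive positions *)

Section separable_increments.
Context (R : realType) (n : nat) (d : measure_display) (Omega : measurableType d)
  (P : probability Omega R) (F : R -> set (set Omega))
  (w : R -> Omega -> 'M[R]_(n, 4)) (BM : brownian_motion_HP P F w).

Lemma hp_generator_cst (c : R) y : hp_generator (fun _ : 'M[R]_(n, 4) => c) y = 0.
Proof.
rewrite /hp_generator.
under eq_bigr do rewrite !pd_cst.
under [X in _ + X - _]eq_bigr => i _ do under eq_bigr => j _ do rewrite !pd_cst mulr0.
under [X in _ + X - _]eq_bigr => i _ do rewrite big1//.
under [X in _ - _ * X]eq_bigr do rewrite pd_cst mulr0.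
by rewrite !big1// !mulr0 !addr0 subr0 mulr0.
Qed.

Lemma hp_gamma_cst (c : R) (f : 'M[R]_(n, 4) -> R) y : hp_gamma f (fun=> c) y = 0.
Proof.
rewrite /hp_gamma; under eq_bigr do rewrite pd_cst mulr0.
under [X in _ * (_ + X)]eq_bigr => i _ do under eq_bigr => j _ do rewrite pd_cst !mulr0.
under [X in _ * (_ + X)]eq_bigr => i _ do rewrite big1//.
by rewrite !big1// addr0 mulr0.
Qed.

Lemma hp_generatorZ (c : R) (f : 'M[R]_(n, 4) -> R) y : smooth f ->
  hp_generator (fun z => c * f z) y = c * hp_generator f y.
Proof.
move=> sf; rewrite (hp_generatorM _ (smooth_cst n c) sf) hp_generator_cst mulr0 addr0.
by rewrite hp_gammaC hp_gamma_cst addr0.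
Qed.

Lemma hp_generatorD (f g : 'M[R]_(n, 4) -> R) y : smooth f -> smooth g ->
  hp_generator (fun z => f z + g z) y = hp_generator f y + hp_generator g y.
Proof.
move=> sf sg; rewrite /hp_generator.
have D2 i j : pd i (pd j (fun z => f z + g z)) y =
    pd i (pd j f) y + pd i (pd j g) y.
  by rewrite (pdD j sf sg) (pdD i (smooth_pd j sf) (smooth_pd j sg)).
under eq_bigr do rewrite D2.
under [X in _ + X - _]eq_bigr => i _ do under eq_bigr => j _ do rewrite D2 mulrDr.
under [X in _ + X - _]eq_bigr => i _ do rewrite big_split/=.
under [X in _ - _ * X]eq_bigr do rewrite (pdD _ sf sg) mulrDr.
by rewrite !big_split/=; ring.
Qed.

Lemma hp_generator_sum (I : Type) (s : seq I) (f : I -> 'M[R]_(n, 4) -> R) y :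
  (forall i, smooth (f i)) ->
  hp_generator (fun z => \sum_(i <- s) f i z) y = \sum_(i <- s) hp_generator (f i) y.
Proof.
move=> sf; elim: s => [|i s IH].
  by under eq_fun do rewrite big_nil; rewrite hp_generator_cst big_nil.
under eq_fun do rewrite big_cons.
rewrite hp_generatorD; [by rewrite IH big_cons|exact: sf|exact: smooth_sum].
Qed.

Definition hball_indic (K : R) (y : 'M[R]_(n, 4)) : R := (hnorm2 y <= K)%R%:R.

Lemma hball_indic_measurable K s : 0 <= s ->
  rv_measurable (F s) (fun omega => hball_indic K (w s omega)).
Proof.
move=> s0; have [FF aw _ _ _] := BM.
have mv := adapted_rv_measurable FF aw (smooth_continuous (@smooth_hnorm2 R n)) s0.
rewrite (_ : (fun omega => _) =
    (\1_`]-oo, K]%classic : R -> R) \o (fun omega => hnorm2 (w s omega))).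
  by apply: measurableT_comp mv; exact: measurable_indic.
by apply/funext => omega /=; rewrite indicE mem_setE in_itv.
Qed.

Lemma hball_indic_norm K y : `|hball_indic K y| <= 1.
Proof. by rewrite /hball_indic; case: (hnorm2 y <= K); rewrite ?normr1 ?normr0. Qed.

Lemma separable_step (K : R) (k : 'M[R]_(n, 4) -> 'M[R]_(n, 4) -> R)
    (phi : 'M[R]_(n, 4) -> R) :
  separable k -> testfn K phi ->
  exists2 C : R, 0 <= C & forall (s h : R) (Y : Omega -> R), 0 <= s -> 0 <= h ->
    rv_measurable (F s) Y -> (forall omega, `|Y omega| <= 1) ->
    `|expect P (fun omega => Y omega * hball_indic K (w s omega) *
        (k (w s omega) (w (s + h) omega) * phi (w (s + h) omega) -
         k (w s omega) (w s omega) * phi (w s omega) -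
         h * hp_generator (fun z => k (w s omega) z * phi z) (w s omega)))|
    <= C * h ^+ 2.
Proof.
move=> [I [g [f [cg sf kE]]]] tphi.
have [FF aw _ _ _] := BM.
have tf i : testfn K (fun z => f i z * phi z) by exact: testfnM.
have /fin_all_exists[C CP] : forall i, exists C : R, 0 <= C /\
    forall (s h : R) (Y : Omega -> R), 0 <= s -> 0 <= h ->
    rv_measurable (F s) Y -> (forall omega, `|Y omega| <= 1) ->
    `|expect P (fun omega => Y omega *
        (f i (w (s + h) omega) * phi (w (s + h) omega) -
         f i (w s omega) * phi (w s omega) -
         h * hp_generator (fun z => f i z * phi z) (w s omega)))| <= C * h ^+ 2.
  by move=> i; have [C C0 CP] := brownian_motion_HP_step BM (tf i); exists C.
have /fin_all_exists[G GP] : forall i, exists G : R,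
    forall y, hnorm2 y <= K -> `|g i y| <= G.
  by move=> i; exact: continuous_bounded_hball.
pose G' i := 1 + `|G i|.
have G'0 i : 0 < G' i by rewrite ltr_pwDl.
exists (\sum_i G' i * C i).
  by apply: sumr_ge0 => i _; rewrite mulr_ge0 ?(ltW (G'0 i))//; case: (CP i).
move=> s h Y s0 h0 mY Y1.
have sh0 : 0 <= s + h by rewrite addr_ge0.
pose Z i omega := Y omega * hball_indic K (w s omega) * (g i (w s omega) / G' i).
pose D i omega := f i (w (s + h) omega) * phi (w (s + h) omega) -
         f i (w s omega) * phi (w s omega) -
         h * hp_generator (fun z => f i z * phi z) (w s omega).
have mZ i : rv_measurable (F s) (Z i).
  apply: measurable_funM.
    by apply: measurable_funM => //; exact: hball_indic_measurable.
  apply: measurable_funM => //.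
  exact: (adapted_rv_measurable FF aw (cg i) s0).
have Z1 i omega : `|Z i omega| <= 1.
  rewrite /Z normrM normrM.
  rewrite /hball_indic; have [vK|Kv] := leP (hnorm2 (w s omega)) K; last first.
    by rewrite normr0 mulr0 mul0r.
  rewrite normr1 mulr1 mulr_ile1// normrM normfV (gtr0_norm (G'0 i)).
  rewrite ler_pdivrMr// mul1r (le_trans (GP i _ vK))// /G'.
  by rewrite (le_trans (ler_norm _))// lerDr.
have bZ i : bounded_rv (Z i) by exact: (rv_measurable_bounded FF s0 (mZ i) (Z1 i)).
have bD i : bounded_rv (D i).
  have tLf := testfn_hp_generator (tf i).
  have bt g' u : testfn K g' -> 0 <= u -> bounded_rv (fun omega => g' (w u omega)).
    move=> tg u0; have [B gB] := testfn_bounded tg.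
    apply: (@rv_measurable_bounded _ _ _ F u _ B FF u0) => //.
    exact: (adapted_rv_measurable FF aw (smooth_continuous (proj1 tg)) u0).
  apply: bounded_rvB.
    by apply: bounded_rvB; exact: (bt (fun z => f i z * phi z)).
  by apply: bounded_rvM; [exact: bounded_rv_cst|exact: bt tLf s0].
have -> : (fun omega => Y omega * hball_indic K (w s omega) *
        (k (w s omega) (w (s + h) omega) * phi (w (s + h) omega) -
         k (w s omega) (w s omega) * phi (w s omega) -
         h * hp_generator (fun z => k (w s omega) z * phi z) (w s omega))) =
    (fun omega => \sum_i G' i * (Z i omega * D i omega)).
  apply/funext => omega.
  have -> : hp_generator (fun z => k (w s omega) z * phi z) (w s omega) =
      \sum_i g i (w s omega) * hp_generator (fun z => f i z * phi z) (w s omega).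
    have -> : (fun z => k (w s omega) z * phi z) =
        (fun z => \sum_i g i (w s omega) * (f i z * phi z)).
      apply/funext => z; rewrite kE mulr_suml.
      by apply: eq_bigr => i _; rewrite mulrA.
    have stf i : smooth (fun z => f i z * phi z) by case: (tf i).
    rewrite hp_generator_sum => [|i]; last by apply: smoothM => //; exact: smooth_cst.
    by apply: eq_bigr => i _; rewrite hp_generatorZ.
  rewrite !kE !mulr_suml mulr_sumr -!sumrB mulr_sumr; apply: eq_bigr => i _.
  rewrite /Z /D; move: (hp_generator _ _) => L; field.
  by rewrite gt_eqF.
rewrite expect_sum; last first.
  by move=> i; apply: bounded_rvM; [exact: bounded_rv_cst|exact: bounded_rvM].
rewrite (le_trans (ler_norm_sum _ _ _))// mulr_suml ler_sum// => i _.
rewrite expectZ; last exact: bounded_rvM.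
rewrite normrM (gtr0_norm (G'0 i)) -mulrA ler_pM2l//.
by case: (CP i) => _; apply.
Qed.

End separable_increments.

(** * One step of the phase along the Brownian motion *)

Section area_step.
Context (R : realType) (n : nat) (d : measure_display) (Omega : measurableType d)
  (P : probability Omega R) (F : R -> set (set Omega))
  (w : R -> Omega -> 'M[R]_(n, 4)) (BM : brownian_motion_HP P F w).

Lemma continuous_comp_measurable (f : 'M[R]_(n, 4) -> R) s t :
  continuous f -> 0 <= s -> s <= t ->
  rv_measurable (F t) (fun omega => f (w s omega)).
Proof.
move=> cf s0 st; have [FF aw _ _ _] := BM.
apply: (rv_measurable_mono FF s0 st).
exact: (adapted_rv_measurable FF aw cf s0).
Qed.

Lemma separable_measurable (k : 'M[R]_(n, 4) -> 'M[R]_(n, 4) -> R) s t :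
  separable k -> 0 <= s -> s <= t ->
  rv_measurable (F t) (fun omega => k (w s omega) (w t omega)).
Proof.
move=> [I [g [h [cg sh kE]]]] s0 st; have t0 := le_trans s0 st.
rewrite /rv_measurable; under eq_fun do rewrite kE.
apply: measurable_sum => i; apply: measurable_funM.
  exact: (continuous_comp_measurable (cg i) s0 st).
exact: (continuous_comp_measurable (smooth_continuous (sh i)) t0 (lexx t)).
Qed.

Lemma bounded_rv_cos (T : Omega -> R) :
  measurable_fun setT T -> bounded_rv (fun omega => cos (T omega)).
Proof.
move=> mT; split.
  apply: (measurableT_comp (f := @cos R)) => //.
  by apply: continuous_measurable_fun; exact: continuous_cos.
by exists 1 => omega; rewrite ler_norml cos_geN1 cos_le1.
Qed.

Lemma bounded_rv_sin (T : Omega -> R) :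
  measurable_fun setT T -> bounded_rv (fun omega => sin (T omega)).
Proof.
move=> mT; split.
  apply: (measurableT_comp (f := @sin R)) => //.
  by apply: continuous_measurable_fun; exact: continuous_sin.
by exists 1 => omega; rewrite ler_norml sin_geN1 sin_le1.
Qed.

Lemma testfn_bounded_rv (K : R) f t :
  testfn K f -> 0 <= t -> bounded_rv (fun omega => f (w t omega)).
Proof.
move=> tf t0; have [FF _ _ _ _] := BM; have [B fB] := testfn_bounded tf.
apply: (@rv_measurable_bounded _ _ _ F t _ B FF t0) => //.
exact: (continuous_comp_measurable (smooth_continuous (proj1 tf)) t0 (lexx t)).
Qed.

Lemma hball_indic_bounded K s : 0 <= s ->
  bounded_rv (fun omega => hball_indic K (w s omega)).
Proof.
move=> s0; have [FF _ _ _ _] := BM.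
apply: (@rv_measurable_bounded _ _ _ F s _ 1 FF s0).
  exact: (hball_indic_measurable BM).
by move=> omega; exact: hball_indic_norm.
Qed.

Lemma separable_bounded (K : R) (k : 'M[R]_(n, 4) -> 'M[R]_(n, 4) -> R)
    (phi : 'M[R]_(n, 4) -> R) s t :
  separable k -> testfn K phi -> 0 <= s -> s <= t ->
  bounded_rv (fun omega => hball_indic K (w s omega) *
    (k (w s omega) (w t omega) * phi (w t omega))).
Proof.
move=> [I [g [h [cg sh kE]]]] tphi s0 st; have t0 := le_trans s0 st.
have -> : (fun omega => hball_indic K (w s omega) *
    (k (w s omega) (w t omega) * phi (w t omega))) =
    (fun omega => \sum_i (hball_indic K (w s omega) * g i (w s omega)) *
       (h i (w t omega) * phi (w t omega))).
  apply/funext => omega; rewrite kE mulr_suml mulr_sumr.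
  by apply: eq_bigr => i _; ring.
apply: bounded_rv_sum => i; apply: bounded_rvM; last first.
  exact: (testfn_bounded_rv (testfnM tphi (sh i)) t0).
have [B gB] := continuous_bounded_hball K (cg i).
have [FF _ _ _ _] := BM.
apply: (@rv_measurable_bounded _ _ _ F s _ `|B| FF s0).
  apply: measurable_funM; first exact: (hball_indic_measurable BM).
  exact: (continuous_comp_measurable (cg i) s0 (lexx s)).
move=> omega; rewrite /hball_indic; have [vK|Kv] := leP (hnorm2 (w s omega)) K.
  by rewrite mul1r (le_trans (gB _ vK))// ler_norm.
by rewrite mul0r normr0.
Qed.

Context (lambda : 'rV[R]_3) (K : R) (p p' : R -> R)
  (sp : smooth1 [set s | -1 < s] p)
  (dp : forall s : R, -1 < s -> is_derive s 1 p (p' s))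
  (pK : forall s, K < s -> p s = 0) (p0 : forall s, 0 <= p s).

Let phi (z : 'M[R]_(n, 4)) : R := p (hnorm2 z).
Let A := @area_incr R n lambda.
Let A2 y z := A y z * A y z.
Let A4 y z := A2 y z * A2 y z.
Let Lam := edot lambda lambda.

Let sphi : smooth phi.
Proof. exact: (@smooth_radial R n p sp). Qed.

Let tphi : testfn K phi.
Proof. by split=> // z; exact: pK. Qed.

Let sA y : smooth (A y).
Proof. exact: smooth_area_incr. Qed.

Let sA2 y : smooth (A2 y).
Proof. exact: smoothM. Qed.

Let LA1 y : hp_generator (fun z => A y z * phi z) y = 0.
Proof.
rewrite (hp_generatorM _ (sA y) sphi) hp_generator_area_incr /A area_incr_self.
by rewrite (hp_gamma_area_incr_radial _ _ sp dp) mulr0 mul0r !addr0.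
Qed.

(** [A y] vanishes at [y], so its square vanishes there together with its gradient. *)
Let gammaA2 y (f : 'M[R]_(n, 4) -> R) : hp_gamma (A2 y) f y = 0.
Proof.
by rewrite hp_gammaC (hp_gammaM _ _ (sA y) (sA y)) /A area_incr_self !mul0r addr0.
Qed.

Let LA2 y : hp_generator (fun z => A2 y z * phi z) y = Lam * hnorm2 y * phi y.
Proof.
rewrite (hp_generatorM _ (sA2 y) sphi) gammaA2 (hp_generatorM _ (sA y) (sA y)).
rewrite hp_generator_area_incr hp_gamma_area_incr /A2 /A area_incr_self.
by rewrite !(mul0r, mulr0, add0r, addr0) mulrC.
Qed.

Let LA4 y : hp_generator (fun z => A4 y z * phi z) y = 0.
Proof.
have s4 : smooth (A4 y) by exact: smoothM.
rewrite (hp_generatorM _ s4 sphi) (hp_generatorM _ (sA2 y) (sA2 y)).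
rewrite gammaA2 hp_gammaC (hp_gammaM _ _ (sA2 y) (sA2 y)) /A4 /A2 /A area_incr_self.
by rewrite !(mul0r, mulr0, add0r, addr0).
Qed.

(* [r] is the square root of the time step.  The Taylor remainder [|a|^3] is at most
   [(r a^2 + a^4 / r) / 2]; up to [O(r^4)], the conditional mean of [a^2] is
   [r^2 |lambda|^2 |w|^2] and that of [a^4] vanishes. *)
Lemma area_step :
  exists2 C : R, 0 <= C & forall (s r : R) (T : Omega -> R), 0 <= s -> 0 < r ->
    r <= 1 -> rv_measurable (F s) T ->
    `|expect P (fun omega =>
        cos (T omega + A (w s omega) (w (s + r ^+ 2) omega)) *
        phi (w (s + r ^+ 2) omega) -
        cos (T omega) * phi (w s omega) -
        r ^+ 2 * (cos (T omega) * (hp_generator phi (w s omega) -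
          2^-1 * Lam * hnorm2 (w s omega) * phi (w s omega))))| <= C * r ^+ 3.
Proof.
have [FF aw _ _ _] := BM.
have kA : separable A by exact: separable_area_incr.
have kA2 : separable A2 by exact: separableM.
have kA4 : separable A4 by exact: separableM.
have [C0 C00 S0] := brownian_motion_HP_step BM tphi.
have [C1 C10 S1] := separable_step BM kA tphi.
have [C2 C20 S2] := separable_step BM kA2 tphi.
have [C4 C40 S4] := separable_step BM kA4 tphi.
have tv : testfn K (fun z => Lam * hnorm2 z * phi z).
  apply: testfnM tphi _; apply: smoothM; first exact: smooth_cst.
  exact: smooth_hnorm2.
have tL := testfn_hp_generator tphi.
have [B vB] := testfn_bounded tv.
have B0 : 0 <= B by rewrite (le_trans _ (vB 0)).
exists (C0 + C0 + C1 + C2 + B + C2 + C4); first by rewrite !addr_ge0.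
move=> s r T s0 r0 r1 mT; set h := r ^+ 2.
have h0 : 0 <= h by rewrite exprn_ge0// ltW.
have ssh : s <= s + h by rewrite lerDl.
have sh0 : 0 <= s + h := le_trans s0 ssh.
pose I omega := hball_indic K (w s omega).
pose c omega := cos (T omega).
pose a omega := A (w s omega) (w (s + h) omega).
pose f0 omega := phi (w s omega).
pose f1 omega := phi (w (s + h) omega).
pose Lf omega := hp_generator phi (w s omega).
pose vf omega := Lam * hnorm2 (w s omega) * phi (w s omega).
have mT' : measurable_fun setT T.
  have [sF mF _] := FF; exact: (rv_measurableP (sF _ s0) (mF _ s0) mT).
have ma : measurable_fun setT a.
  have [sF mF _] := FF; apply: (rv_measurableP (sF _ sh0) (mF _ sh0)).
  exact: (separable_measurable kA).
have mI : rv_measurable (F s) I by exact: (hball_indic_measurable BM).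
have mc : rv_measurable (F s) c.
  apply: (measurableT_comp (f := @cos R)) => //.
  by apply: continuous_measurable_fun; exact: continuous_cos.
have ms : rv_measurable (F s) (fun omega => sin (T omega)).
  apply: (measurableT_comp (f := @sin R)) => //.
  by apply: continuous_measurable_fun; exact: continuous_sin.
have bI : bounded_rv I by exact: hball_indic_bounded.
have bc : bounded_rv c by exact: bounded_rv_cos.
have bs : bounded_rv (fun omega => sin (T omega)) by exact: bounded_rv_sin.
have bf0 : bounded_rv f0 by exact: testfn_bounded_rv tphi s0.
have bf1 : bounded_rv f1 by exact: testfn_bounded_rv tphi sh0.
have bLf : bounded_rv Lf by exact: testfn_bounded_rv tL s0.
have bvf : bounded_rv vf by exact: testfn_bounded_rv tv s0.
have bcT : bounded_rv (fun omega => cos (T omega + a omega)).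
  by apply: bounded_rv_cos; exact: measurable_funD.
have bA1 : bounded_rv (fun omega => I omega * (a omega * f1 omega)).
  exact: (separable_bounded kA tphi s0 ssh).
have bA2 : bounded_rv (fun omega => I omega * (a omega * a omega * f1 omega)).
  exact: (separable_bounded kA2 tphi s0 ssh).
have bA4 : bounded_rv (fun omega =>
    I omega * (a omega * a omega * (a omega * a omega) * f1 omega)).
  exact: (separable_bounded kA4 tphi s0 ssh).
have I01 omega : I omega = 0 \/ I omega = 1.
  by rewrite /I /hball_indic; case: (_ <= K); [right|left].
have If omega : I omega * f0 omega = f0 omega.
  rewrite /I /hball_indic; case: leP => Kv; first by rewrite mul1r.
  by rewrite mul0r /f0 /phi pK.
have IL omega : I omega * Lf omega = Lf omega.
  rewrite /I /hball_indic; case: leP => Kv; first by rewrite mul1r.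
  by rewrite mul0r /Lf (proj2 tL).
have Iv omega : I omega * vf omega = vf omega.
  rewrite /I /hball_indic; case: leP => Kv; first by rewrite mul1r.
  by rewrite mul0r /vf /phi pK ?mulr0.
have cos1 (x : R) : `|cos x| <= 1 by rewrite ler_norml cos_geN1 cos_le1.
have sin1 (x : R) : `|sin x| <= 1 by rewrite ler_norml sin_geN1 sin_le1.
(* [X1] is the part outside the ball at time [s]. Inside it, [X2], [X3] and [X4] come from the
   Taylor terms of order zero, one and two in the area increment, each compensated by its
   conditional mean, and [X5] is the remainder. *)
pose X1 omega := (1 - I omega) * (cos (T omega + a omega) * f1 omega).
pose X2 omega := c omega * I omega * (f1 omega - f0 omega - h * Lf omega).
pose X3 omega := sin (T omega) * (I omega * (a omega * f1 omega)).
pose X4 omega := c omega * (I omega * (a omega * a omega * f1 omega) - h * vf omega).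
pose e omega := cos (T omega + a omega) -
  (c omega - a omega * sin (T omega) - 2^-1 * a omega ^+ 2 * c omega).
pose X5 omega := I omega * (e omega * f1 omega).
have bX1 : bounded_rv X1.
  apply: bounded_rvM; last exact: bounded_rvM.
  by apply: bounded_rvB => //; exact: bounded_rv_cst.
have bX2 : bounded_rv X2.
  apply: bounded_rvM; first exact: bounded_rvM.
  apply: bounded_rvB; first exact: bounded_rvB.
  by apply: bounded_rvM => //; exact: bounded_rv_cst.
have bX3 : bounded_rv X3 by exact: bounded_rvM.
have bX4 : bounded_rv X4.
  apply: bounded_rvM => //; apply: bounded_rvB => //.
  by apply: bounded_rvM => //; exact: bounded_rv_cst.
have bX4' : bounded_rv (fun omega => 2^-1 * X4 omega).
  by apply: bounded_rvM => //; exact: bounded_rv_cst.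
have X5E : X5 = (fun omega => I omega * (cos (T omega + a omega) * f1 omega) -
    c omega * I omega * f1 omega + X3 omega +
    2^-1 * c omega * (I omega * (a omega * a omega * f1 omega))).
  by apply/funext => omega; rewrite /X5 /X3 /e; field.
have bX5 : bounded_rv X5.
  rewrite X5E; apply: bounded_rvD; last first.
    by apply: bounded_rvM => //; apply: bounded_rvM => //; exact: bounded_rv_cst.
  apply: bounded_rvD => //; apply: bounded_rvB.
    by apply: bounded_rvM => //; exact: bounded_rvM.
  by apply: bounded_rvM => //; exact: bounded_rvM.
have -> : (fun omega =>
        cos (T omega + A (w s omega) (w (s + h) omega)) * phi (w (s + h) omega) -
        cos (T omega) * phi (w s omega) -
        h * (cos (T omega) * (hp_generator phi (w s omega) -
          2^-1 * Lam * hnorm2 (w s omega) * phi (w s omega)))) =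
    (fun omega => X1 omega + X2 omega - X3 omega - 2^-1 * X4 omega + X5 omega).
  apply/funext => omega; rewrite X5E /X1 /X2 /X4.
  transitivity (cos (T omega + a omega) * f1 omega - c omega * (I omega * f0 omega) -
     h * (c omega * (I omega * Lf omega - 2^-1 * vf omega))).
    by rewrite If IL /c /a /f0 /f1 /Lf /vf; ring.
  by ring.
rewrite expectD//; last first.
  by apply: bounded_rvB => //; apply: bounded_rvB => //; exact: bounded_rvD.
rewrite expectB//; last by apply: bounded_rvB => //; exact: bounded_rvD.
rewrite expectB//; last exact: bounded_rvD.
rewrite expectD// expectZ//.
have h2 : h ^+ 2 = r ^+ 3 * r by rewrite /h; ring.
have r30 : 0 <= r ^+ 3 by rewrite exprn_ge0// ltW.
have hr C : 0 <= C -> C * h ^+ 2 <= C * r ^+ 3.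
  by move=> C_ge0; rewrite ler_wpM2l// h2 ler_piMr.
(* Where [I = 0], both [phi] and its generator vanish at time [s], so the one-step estimate with
   multiplier [1 - I] says that the mean of [(1 - I) f1] is of order [h^2]. Since [f1] is
   nonnegative, the cosine can be bounded by [1]. *)
have B1 : `|expect P X1| <= C0 * r ^+ 3.
  apply: le_trans (hr _ C00).
  apply: (@le_trans _ _ (expect P (fun omega => (1 - I omega) * f1 omega))).
    apply: le_expect_norm => //.
      by apply: bounded_rvM => //; apply: bounded_rvB => //; exact: bounded_rv_cst.
    move=> omega; rewrite /X1 normrM normrM [`|f1 _|]ger0_norm; last exact: p0.
    have f10 : 0 <= f1 omega by exact: p0.
    by case: (I01 omega) => ->; rewrite ?subrr ?subr0 ?normr0 ?normr1 ?mul0r// !mul1r ler_piMl.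
  have := S0 s h (fun omega => 1 - I omega) s0 h0.
  have -> : (fun omega => (1 - I omega) *
      (phi (w (s + h) omega) - phi (w s omega) - h * hp_generator phi (w s omega))) =
      (fun omega => (1 - I omega) * f1 omega).
    apply/funext => omega; transitivity ((1 - I omega) * f1 omega -
      (f0 omega - I omega * f0 omega) - h * (Lf omega - I omega * Lf omega)).
      by rewrite /f0 /f1 /Lf; ring.
    by rewrite If IL; ring.
  move=> H; apply: (le_trans (ler_norm _)); apply: H.
    by apply: measurable_funB => //; exact: measurable_cst.
  by move=> omega; case: (I01 omega) => ->; rewrite ?subrr ?subr0 ?normr0 ?normr1.
have B2 : `|expect P X2| <= C0 * r ^+ 3.
  apply: le_trans (hr _ C00); apply: S0 => //; first exact: measurable_funM.
  by move=> omega; rewrite normrM mulr_ile1//; [exact: cos1|exact: hball_indic_norm].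
have B3 : `|expect P X3| <= C1 * r ^+ 3.
  apply: le_trans (hr _ C10).
  have := S1 s h _ s0 h0 ms (fun omega => sin1 _).
  congr (`|expect P _| <= _); apply/funext => omega.
  by rewrite LA1 /A area_incr_self mul0r mulr0 !subr0 /X3 /I /a /f1 /A; ring.
have B4 : `|expect P X4| <= C2 * r ^+ 3.
  apply: le_trans (hr _ C20).
  have := S2 s h _ s0 h0 mc (fun omega => cos1 _).
  congr (`|expect P _| <= _); apply/funext => omega.
  rewrite LA2 /A2 /A area_incr_self !mul0r subr0 /X4 -Iv /vf.
  by rewrite /c /a /f1 /I /A; ring.
have B5 : `|expect P X5| <= (B + C2 + C4) * r ^+ 3.
  pose Y2 omega := I omega * (a omega * a omega * f1 omega).
  pose Y4 omega := I omega * (a omega * a omega * (a omega * a omega) * f1 omega).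
  have one1 (omega : Omega) : `|1 : R| <= 1 by rewrite normr1.
  have m1 : rv_measurable (F s) (fun=> 1 : R).
    by rewrite /rv_measurable; exact: measurable_cst.
  have E2 : expect P Y2 <= h * B + C2 * h ^+ 2.
    have H : `|expect P (fun omega => Y2 omega - h * vf omega)| <= C2 * h ^+ 2.
      have := S2 s h _ s0 h0 m1 one1.
      congr (`|expect P _| <= _); apply/funext => omega.
      rewrite LA2 /A2 /A area_incr_self !mul0r subr0 /Y2 -Iv /vf.
      by rewrite /a /f1 /I /A; ring.
    have bhv : bounded_rv (fun omega => h * vf omega).
      by apply: bounded_rvM => //; exact: bounded_rv_cst.
    rewrite expectB// expectZ// in H.
    have Ev : expect P vf <= B.
      apply: (le_trans (ler_norm _)); apply: expect_norm_le => // omega.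
      exact: vB.
    move: H; rewrite ler_norml => /andP[_]; rewrite lerBlDl => /le_trans; apply.
    by rewrite lerD2r ler_wpM2l.
  have E4 : expect P Y4 <= C4 * h ^+ 2.
    have := S4 s h _ s0 h0 m1 one1.
    rewrite (_ : (fun omega => _) = Y4); first exact/le_trans/ler_norm.
    apply/funext => omega.
    by rewrite LA4 /A4 /A2 /A area_incr_self !mul0r mulr0 !subr0 mul1r.
  have bY2 : bounded_rv (fun omega => 2^-1 * r * Y2 omega).
    by apply: bounded_rvM => //; exact: bounded_rv_cst.
  have bY4 : bounded_rv (fun omega => 2^-1 * r^-1 * Y4 omega).
    by apply: bounded_rvM => //; exact: bounded_rv_cst.
  apply: (@le_trans _ _ (expect P (fun omega => 2^-1 * r * Y2 omega + 2^-1 * r^-1 * Y4 omega))).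
    apply: le_expect_norm => //; first exact: bounded_rvD.
    move=> omega; rewrite /X5 /Y2 /Y4.
    have f10 : 0 <= f1 omega by exact: p0.
    case: (I01 omega) => ->; first by rewrite !mul0r normr0 !mulr0 addr0.
    rewrite !mul1r normrM [`|f1 _|]ger0_norm//.
    rewrite (_ : _ + _ = 2^-1 * (r * a omega ^+ 2 + r^-1 * a omega ^+ 4) * f1 omega); last by ring.
    apply: ler_wpM2r => //; apply: (le_trans (cos_taylor2 _ _)).
    rewrite -[a omega ^+ 2]real_normK ?num_real//.
    have -> : a omega ^+ 4 = `|a omega| ^+ 4.
      by rewrite -[4%N]/(2 * 2)%N !exprM real_normK ?num_real.
    move: `|a omega| (normr_ge0 (a omega)) => x x0.
    rewrite -subr_ge0 (_ : _ - _ = 2^-1 * r^-1 * (x * (r - x)) ^+ 2).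
      by rewrite mulr_ge0 ?sqr_ge0// mulr_ge0 ?invr_ge0 ?(ltW r0).
    by field; rewrite gt_eqF.
  rewrite expectD// !expectZ//.
  apply: (@le_trans _ _ (2^-1 * r * (h * B + C2 * h ^+ 2) + 2^-1 * r^-1 * (C4 * h ^+ 2))).
    apply: lerD; apply: ler_wpM2l => //.
      by rewrite mulr_ge0// ltW.
    by rewrite mulr_ge0// invr_ge0 ltW.
  rewrite (_ : _ + _ = 2^-1 * (B + C2 * r ^+ 2 + C4) * r ^+ 3); last first.
    by rewrite /h; field; rewrite gt_eqF.
  apply: ler_wpM2r => //.
  have : C2 * r ^+ 2 <= C2 by rewrite ler_piMr// expr_le1// ltW.
  by move: (C2 * r ^+ 2) => x xC; clear one1; lra.
have B4' : `|2^-1 * expect P X4| <= C2 * r ^+ 3.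
  rewrite normrM ger0_norm//; apply: le_trans B4.
  by rewrite ler_piMl// invf_le1// ler1n.
rewrite (_ : _ * r ^+ 3 = C0 * r ^+ 3 + C0 * r ^+ 3 + C1 * r ^+ 3 + C2 * r ^+ 3 +
  (B + C2 + C4) * r ^+ 3); last by ring.
apply: (le_trans (ler_normD _ _)); apply: lerD => //.
apply: (le_trans (ler_normB _ _)); apply: lerD => //.
apply: (le_trans (ler_normB _ _)); apply: lerD => //.
by apply: (le_trans (ler_normD _ _)); apply: lerD.
Qed.

End area_step.

(** * Cutoffs and the recursion for the moments *)

Section cutoff.
Context (R : realType) (n : nat).
Notation D1 := [set s : R | -1 < s].
Implicit Types (M s v : R).

Lemma is_derive_ln1D v : -1 < v -> is_derive v 1 (fun v : R => ln (1 + v)) (1 + v)^-1.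
Proof.
move=> v1; have v0 : 0 < 1 + v by lra.
have d1 : is_derive v 1 (fun v : R => 1 + v) 1.
  have := is_deriveD (is_derive_cst (1 : R) v (1 : R)) (is_derive_id v (1 : R)).
  by rewrite add0r.
by have := is_derive1_comp (is_derive1_ln v0) d1; rewrite mulr1.
Qed.

Lemma is_derive_inv1D v : -1 < v ->
  is_derive v 1 (fun v : R => (1 + v)^-1) (- (1 + v) ^- 2).
Proof.
move=> v1; have v0 : 0 < 1 + v by lra.
have -> : - (1 + v) ^- 2 = -1 * (1 + v) `^ (-1 - 1).
  by rewrite -opprD -[1 + 1]/(2%:R) powR_invn ?ltW// mulN1r.
apply: (near_eq_is_derive _ (is_derive_powR1D (-1) v1)).
near=> z; rewrite powR_inv1//.
suff : -1 < z by move=> ?; lra.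
by near: z; exact: lt_nbhsr.
Unshelve. all: by end_near. Qed.

Lemma smooth1_ln1D : smooth1 D1 (fun v : R => ln (1 + v)).
Proof.
case=> [|k].
  by move=> v v1; apply: is_derive1_continuous; exact: is_derive_ln1D.
exists (fun v => (1 + v) `^ (-1)); split; last exact: smooth1_powR1D.
move=> v /= v1; rewrite powR_inv1; first exact: is_derive_ln1D.
by move: v1; lra.
Qed.

(** Decreases from [1/2] at [v = 0] to [0] at [ln (1 + v) = M]. The value [1/2] is the end of the
    interval on which [exp (- 1 / s)] is convex, which gives a sign in [hp_generator_cutoff_ge]. *)
Definition cutoff_arg M v : R := 2^-1 * (1 - M^-1 * ln (1 + v)).

Definition cutoff M v : R := (flat 0 (2^-1 : R))^-1 * flat 0 (cutoff_arg M v).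

Let d1 M v : R := - (2 * M)^-1 * (1 + v)^-1.

Let is_derive_arg M v : -1 < v -> is_derive v 1 (cutoff_arg M) (d1 M v).
Proof.
move=> v1; have H := is_deriveM (is_derive_cst (M^-1 : R) v (1 : R)) (is_derive_ln1D v1).
have K := is_deriveM (is_derive_cst (2^-1 : R) v (1 : R))
  (is_deriveB (is_derive_cst (1 : R) v (1 : R)) H).
apply: (is_derive_eq K); rewrite !scaler0 addr0 !addr0 sub0r.
rewrite [LHS](_ : _ = 2^-1 * - (M^-1 * (1 + v)^-1))// /d1 invfM; ring.
Qed.

Definition cutoff1 M v : R :=
  (flat 0 (2^-1 : R))^-1 * (flat 2 (cutoff_arg M v) * d1 M v).

Definition cutoff2 M v : R :=
  (flat 0 (2^-1 : R))^-1 *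
  ((flat 4 (cutoff_arg M v) - 2 * flat 3 (cutoff_arg M v)) * d1 M v ^+ 2 +
   flat 2 (cutoff_arg M v) * ((2 * M)^-1 * (1 + v) ^- 2)).

Lemma is_derive_cutoff M v : -1 < v -> is_derive v 1 (cutoff M) (cutoff1 M v).
Proof.
move=> v1.
have H := is_derive1_comp (is_derive_flat 0 (cutoff_arg M v)) (is_derive_arg M v1).
have K := is_deriveM (is_derive_cst ((flat 0 (2^-1 : R))^-1) v (1 : R)) H.
apply: (is_derive_eq K); rewrite scaler0 addr0 mul0r subr0.
by [].
Qed.

Lemma is_derive_cutoff1 M v : -1 < v -> is_derive v 1 (cutoff1 M) (cutoff2 M v).
Proof.
move=> v1.
have H := is_derive1_comp (is_derive_flat 2 (cutoff_arg M v)) (is_derive_arg M v1).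
have L := is_deriveM (is_derive_cst (- (2 * M)^-1 : R) v (1 : R)) (is_derive_inv1D v1).
have K := is_deriveM (is_derive_cst ((flat 0 (2^-1 : R))^-1) v (1 : R)) (is_deriveM H L).
apply: (is_derive_eq K); rewrite !scaler0 !addr0 /cutoff2.
set E := (flat 0 _)^-1; set f2 := flat 2 _; set f3 := flat 3 _; set f4 := flat 4 _.
rewrite [LHS](_ : _ = E * (f2 * (- (2 * M)^-1 * - (1 + v) ^- 2) +
  d1 M v * ((f4 - 2 * f3) * d1 M v)))//.
by rewrite mulrNN; ring.
Qed.

Lemma smooth1_upto_ext k (g h : R -> R) : (forall s, -1 < s -> g s = h s) ->
  smooth1_upto D1 k g -> smooth1_upto D1 k h.
Proof.
move=> gh; have nE (s : R) : -1 < s -> \near s, g s = h s.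
  by move=> s1; near=> z; apply: gh; near: z; exact: lt_nbhsr.
case: k => [|k] /=.
  move=> cg s s1; rewrite /prop_for/= /continuous_at -(gh _ s1).
  exact: (cvg_trans (near_eq_cvg (nE _ s1)) (cg _ s1)).
case=> g' [dg sg']; exists g'; split=> // s s1.
exact: (near_eq_is_derive (nE _ s1) (dg _ s1)).
Unshelve. all: by end_near. Qed.

(** Derivatives are unique, so an explicit derivative agrees on the domain with the witness hidden
    in [smooth1]. *)
Lemma smooth1_is_derive (g g' : R -> R) : smooth1 D1 g ->
  (forall s, -1 < s -> is_derive s 1 g (g' s)) -> smooth1 D1 g'.
Proof.
move=> sg dg k; have [h [dh sh]] := sg k.+1.
apply: smooth1_upto_ext sh => s s1.
by have [_ <-] := dh _ s1; have [_ <-] := dg _ s1.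
Qed.

Lemma smooth1_cutoff M : smooth1 D1 (cutoff M).
Proof.
move=> k; apply: smooth1_uptoM; first exact: smooth1_upto_cst.
apply: (@smooth1_upto_comp _ D1 setT k (cutoff_arg M) (flat 0)) => //; last exact: smooth1_flat.
apply: smooth1_uptoM; first exact: smooth1_upto_cst.
apply: (@smooth1_upto_ext k (fun v => 1 + (- M^-1) * ln (1 + v))).
  by move=> s _; rewrite mulNr.
apply: smooth1_uptoD; first exact: smooth1_upto_cst.
by apply: smooth1_uptoM; [exact: smooth1_upto_cst|exact: smooth1_ln1D].
Qed.

Lemma smooth1_cutoff1 M : smooth1 D1 (cutoff1 M).
Proof. exact: smooth1_is_derive (smooth1_cutoff M) (@is_derive_cutoff M). Qed.

Lemma flat0_half_gt0 : 0 < flat 0 (2^-1 : R).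
Proof. by rewrite /flat ifT ?invr_gt0// mulr_gt0 ?expR_gt0 ?invr_gt0. Qed.

Lemma flat0_le s : s <= 2^-1 -> flat 0 s <= flat 0 (2^-1 : R).
Proof.
move=> s2; rewrite /flat; case: ltP => s0; last first.
  by rewrite ifT ?invr_gt0// mulr_ge0 ?expR_ge0.
rewrite ifT ?invr_gt0// expr0 invr1 !mul1r ler_expR lerN2 invrK.
by rewrite -[leLHS]invrK lef_pV2// posrE invr_gt0.
Qed.

Lemma cutoff_arg_le M v : 0 < M -> 0 <= v -> cutoff_arg M v <= 2^-1.
Proof.
move=> M0 v0; rewrite /cutoff_arg ler_piMr// gerBl mulr_ge0 ?invr_ge0 ?(ltW M0)//.
by rewrite ln_ge0// lerDl.
Qed.

Lemma cutoff_ge0 M v : 0 <= cutoff M v.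
Proof. by rewrite mulr_ge0 ?invr_ge0 ?flat_ge0. Qed.

Lemma cutoff_le1 M v : 0 < M -> 0 <= v -> cutoff M v <= 1.
Proof.
move=> M0 v0; rewrite /cutoff mulrC ler_pdivrMr ?flat0_half_gt0// mul1r.
by rewrite flat0_le// cutoff_arg_le.
Qed.

Lemma cutoff0 M : cutoff M 0 = 1.
Proof.
rewrite /cutoff /cutoff_arg addr0 ln1 mulr0 subr0 mulr1 mulVf//.
by rewrite gt_eqF// flat0_half_gt0.
Qed.

Lemma cutoff_arg_lt0 M v : 0 < M -> expR M - 1 < v -> cutoff_arg M v < 0.
Proof.
move=> M0 Mv; rewrite /cutoff_arg pmulr_rlt0// subr_lt0 mulrC ltr_pdivlMr// mul1r.
rewrite -ltr_expR lnK ?posrE; first by lra.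
by have := expR_gt0 M; lra.
Qed.

Lemma cutoff_vanish M v : 0 < M -> expR M - 1 < v -> cutoff M v = 0.
Proof.
move=> M0 Mv; have /ltW s0 := cutoff_arg_lt0 M0 Mv.
by rewrite /cutoff (flat_le0 0 s0) mulr0.
Qed.

Lemma cutoff_cvg v : -1 < v -> cutoff N.+1%:R v @[N --> \oo] --> (1 : R).
Proof.
move=> v1; rewrite -[X in _ --> X](cutoff0 1).
have c1 : cutoff_arg N.+1%:R v @[N --> \oo] --> cutoff_arg 1 0.
  rewrite /cutoff_arg; apply: cvgM; first exact: cvg_cst.
  apply: cvgB; first exact: cvg_cst.
  rewrite addr0 ln1 mulr0 -[X in _ --> X](mul0r (ln (1 + v))).
  by apply: cvgM; [exact: cvg_harmonic|exact: cvg_cst].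
have c2 := cvg_comp _ _ c1 (is_derive1_continuous (is_derive_flat 0 _)).
by apply: cvgM; [exact: cvg_cst|exact: c2].
Qed.

Lemma flat_half_bound j s : s <= 2^-1 -> flat j s <= j.+1`!%:R.
Proof.
move=> s2; have [s0|s0] := leP s 0; first by rewrite flat_le0.
apply: (le_trans (flat_bound j 0 s0)); rewrite addn1 expr1 ler_piMr//.
by rewrite (le_trans s2)// invf_le1// ler1n.
Qed.

(** No power of [1 + v] remains, because the cutoff depends on [ln (1 + v)], whose generator is
    [4 n - 2 v] and whose carre du champ is [4 v]. *)
Lemma hp_generator_cutoff M (w : 'M[R]_(n, 4)) : 0 < M ->
  hp_generator (fun z => cutoff M (hnorm2 z)) w =
  (flat 0 (2^-1 : R))^-1 *
  (hnorm2 w * ((flat 4 (cutoff_arg M (hnorm2 w)) -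
                2 * flat 3 (cutoff_arg M (hnorm2 w))) * (2 * M ^+ 2)^-1 +
               flat 2 (cutoff_arg M (hnorm2 w)) * M^-1) -
   2 * n%:R * flat 2 (cutoff_arg M (hnorm2 w)) * M^-1).
Proof.
move=> M0; rewrite (hp_generator_radial _ (@smooth1_cutoff1 M) (@is_derive_cutoff M)
  (@is_derive_cutoff1 M)) /cutoff2 /cutoff1 /d1.
have := onePhnorm2_gt0 w; have := flat0_half_gt0; have := hnorm2_ge0 w.
move: (hnorm2 w) (flat 0 _) (flat 2 _) (flat 3 _) (flat 4 _) => v E f2 f3 f4 v0 E0 v1.
by field; rewrite !gt_eqF.
Qed.

Lemma flat_quarter s : 4^-1 <= s -> s <= 2^-1 -> expR (- 4) <= flat 2 s.
Proof.
move=> s4 s2; have s0 : 0 < s by rewrite (lt_le_trans _ s4)// invr_gt0.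
rewrite /flat s0 -[leLHS]mul1r ler_pM ?expR_ge0//.
- rewrite invf_ge1 ?exprn_gt0// expr_le1//; last exact: ltW.
  by rewrite (le_trans s2)// invf_le1// ler1n.
- by rewrite ler_expR lerN2 -[leRHS]invrK lef_pV2// posrE// invr_gt0.
Qed.

Lemma cutoff_arg_ge M v : 0 < M -> -1 < v -> v <= expR M - 1 ->
  4^-1 <= cutoff_arg (2 * M) v.
Proof.
move=> M0 v1 vM; rewrite /cutoff_arg.
have : ln (1 + v) <= M.
  by rewrite -ler_expR lnK ?posrE; lra.
move: (ln _) => l lM; rewrite invfM -mulrA.
have : M^-1 * l <= 1 by rewrite mulrC ler_pdivrMr// mul1r.
by move: (M^-1 * l) => x ?; lra.
Qed.

(* The generator of this multiple of a cutoff controls [1 + |w|^2] from above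
   on the ball where [ln (1 + |w|^2) <= M]. *)
Lemma hp_generator_cutoff_ge M (w : 'M[R]_(n, 4)) : 0 < M ->
  expR (- 4) * (hball_indic (expR M - 1) w * (1 + hnorm2 w)) <=
  hp_generator (fun z => 2 * M * flat 0 (2^-1 : R) * cutoff (2 * M) (hnorm2 z)) w
  + (2 * n%:R + 1) * 6.
Proof.
move=> M0; have M20 : 0 < 2 * M by rewrite mulr_gt0.
rewrite hp_generatorZ; last exact: (@smooth_radial R n _ (@smooth1_cutoff (2 * M))).
rewrite hp_generator_cutoff//.
have v0 := hnorm2_ge0 w.
have s2 := cutoff_arg_le M20 v0.
have f2b := flat_half_bound 2 s2; have f20 := flat_ge0 2 (cutoff_arg (2 * M) (hnorm2 w)).
have E0 := flat0_half_gt0.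
(* This is the second derivative of [exp (- 1 / s)], nonnegative for [s <= 1/2]. *)
have f43 : 0 <= flat 4 (cutoff_arg (2 * M) (hnorm2 w)) -
    2 * flat 3 (cutoff_arg (2 * M) (hnorm2 w)).
  rewrite /flat; case: ltP => s0; last by rewrite mulr0 subrr.
  rewrite mulrA -mulrBl mulr_ge0 ?expR_ge0//.
  set a := cutoff_arg _ _ in s0 s2 *.
  have -> : a ^- 4 - 2 * a ^- 3 = (1 - 2 * a) * a ^- 4 by field; rewrite gt_eqF.
  by rewrite mulr_ge0 ?invr_ge0 ?exprn_ge0 ?(ltW s0)//; lra.
(* On the ball of level [M], the cutoff of level [2 M] still has an argument between [1/4] and
   [1/2], where [flat 2] is at least [exp (- 4)]. *)
have I1 : expR (- 4) * (hball_indic (expR M - 1) w * (1 + hnorm2 w)) <=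
    flat 2 (cutoff_arg (2 * M) (hnorm2 w)) * (1 + hnorm2 w).
  rewrite mulrA ler_wpM2r ?addr_ge0// /hball_indic.
  case: (leP (hnorm2 w) (expR M - 1)) => [vM|_]; last by rewrite mulr0.
  rewrite mulr1 flat_quarter// cutoff_arg_ge//.
  by rewrite (lt_le_trans _ v0)// ltrN10.
apply: (le_trans I1).
set f2 := flat 2 _ in f2b f20 *; set f4 := flat 4 _ in f43 *.
set f3 := flat 3 _ in f43 *; move: (hnorm2 w) v0 => v v0.
rewrite [leRHS](_ : _ = v * (f4 - 2 * f3) * (4 * M)^-1 + v * f2 - 2 * n%:R * f2 +
    (2 * n%:R + 1) * 6); last first.
  by field; rewrite !gt_eqF.
have : 0 <= v * (f4 - 2 * f3) * (4 * M)^-1.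
  by rewrite mulr_ge0 ?invr_ge0 ?(ltW (mulr_gt0 _ M0))// mulr_ge0.
(* The constant [6 = 3!] bounds [flat 2] on [s <= 1/2], by [flat_half_bound]. *)
have : (2 * n%:R + 1) * f2 <= (2 * n%:R + 1) * 6 :> R.
  by rewrite ler_wpM2l// addr_ge0// mulr_ge0.
lra.
Qed.

End cutoff.

(** * Powers of [1 + |w|^2] under the generator with potential *)

Section magnetic_eigenfunctions.
Context (R : realType) (n : nat) (mu : R) (mu0 : 0 <= mu).
Implicit Types (M : R) (w : 'M[R]_(n, 4)) (m : nat).

Definition weight m : R := mu / 2 + m%:R.

(* For [mu^2 + 2 mu = |lambda|^2], the generator minus the potential
   [|lambda|^2 |w|^2 / 2] maps [hpow m (|w|^2)] to
   [coef_d m * hpow m.-1 (|w|^2) - coef_c m * hpow m (|w|^2)]. *)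
Definition coef_d m : R := 2 * m%:R * (m%:R + mu + 1).

Definition coef_c m : R := coef_d m + 4 * n%:R * weight m.

Definition hpow m (v : R) : R := (1 + v) `^ (- weight m).

Definition hpow_cutoff m M (v : R) : R := hpow m v * cutoff M v.

Lemma weight_ge0 m : 0 <= weight m.
Proof. by rewrite addr_ge0// mulr_ge0. Qed.

Lemma coef_c_ge0 m : 0 <= coef_c m.
Proof.
by rewrite addr_ge0// ?mulr_ge0 ?weight_ge0// !addr_ge0.
Qed.

Lemma hpow_ge0 m v : 0 <= hpow m v.
Proof. exact: powR_ge0. Qed.

Lemma hpow_le1 m v : 0 <= v -> hpow m v <= 1.
Proof.
move=> v0; rewrite /hpow powRN invf_le1 ?powR_gt0//; last by lra.
rewrite -[leLHS](powRr0 (1 + v)); apply: ler_powR; last exact: weight_ge0.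
by lra.
Qed.

Lemma smooth1_hpow m : smooth1 [set s : R | -1 < s] (hpow m).
Proof. by move=> k; exact: smooth1_powR1D. Qed.

Lemma smooth1_hpow_cutoff m M : smooth1 [set s : R | -1 < s] (hpow_cutoff m M).
Proof. by move=> k; apply: smooth1_uptoM; [exact: smooth1_hpow|exact: smooth1_cutoff]. Qed.

Lemma hpow_cutoff_ge0 m M v : 0 <= hpow_cutoff m M v.
Proof. by rewrite mulr_ge0 ?hpow_ge0 ?cutoff_ge0. Qed.

Lemma hpow_cutoff_le1 m M v : 0 < M -> 0 <= v -> hpow_cutoff m M v <= 1.
Proof. by move=> M0 v0; rewrite mulr_ile1 ?hpow_ge0 ?cutoff_ge0 ?hpow_le1 ?cutoff_le1. Qed.

Lemma testfn_hpow_cutoff m M : 0 < M ->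
  testfn (expR M - 1) (fun z : 'M[R]_(n, 4) => hpow_cutoff m M (hnorm2 z)).
Proof.
move=> M0; split; first exact: (@smooth_radial R n _ (@smooth1_hpow_cutoff m M)).
by move=> w wM; rewrite /hpow_cutoff cutoff_vanish// mulr0.
Qed.

(** The defect that the cutoff causes in the recursion between the powers [hpow]; with [1] in place
    of the cutoff it would be zero. *)
Definition cutoff_error m M w : R :=
  hp_generator (fun z => hpow_cutoff m M (hnorm2 z)) w -
  2^-1 * (mu ^+ 2 + 2 * mu) * hnorm2 w * hpow_cutoff m M (hnorm2 w) -
  (coef_d m * hpow_cutoff m.-1 M (hnorm2 w) - coef_c m * hpow_cutoff m M (hnorm2 w)).

(** The factor [coef_d m] vanishes at [m = 0], where [m.-1] is again [0] and the exponents would not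
    match. *)
Lemma hpow_pred m v : -1 < v -> coef_d m * hpow m.-1 v = coef_d m * ((1 + v) * hpow m v).
Proof.
move=> v1; case: m => [|m] /=; first by rewrite /coef_d mulr0 !mul0r.
congr (_ * _); rewrite /hpow.
have -> : - weight m = 1 + - weight m.+1 by rewrite /weight -natr1; ring.
have y0 : 0 < 1 + v by lra.
rewrite powRD ?powRr1 ?(ltW y0)//.
by apply/implyP => _; rewrite gt_eqF.
Qed.

(** By the Leibniz rule the generator splits into three terms. The cutoff times the generator of
    [hpow] cancels against the potential and the recursion; what survives is [hpow] times the
    generator of the cutoff, and the carre du champ of the two factors. *)
Lemma cutoff_errorE m M w : 0 < M -> cutoff_error m M w =
  (flat 0 (2^-1 : R))^-1 * hpow m (hnorm2 w) *
  (hnorm2 w * ((flat 4 (cutoff_arg M (hnorm2 w)) -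
                2 * flat 3 (cutoff_arg M (hnorm2 w))) * (2 * M ^+ 2)^-1 +
               flat 2 (cutoff_arg M (hnorm2 w)) * M^-1) -
   2 * n%:R * flat 2 (cutoff_arg M (hnorm2 w)) * M^-1 +
   2 * hnorm2 w * weight m * flat 2 (cutoff_arg M (hnorm2 w)) * M^-1).
Proof.
move=> M0; rewrite /cutoff_error.
have sH : smooth (fun z : 'M[R]_(n, 4) => hpow m (hnorm2 z)).
  exact: (@smooth_radial R n _ (@smooth1_hpow m)).
have sX : smooth (fun z : 'M[R]_(n, 4) => cutoff M (hnorm2 z)).
  exact: (@smooth_radial R n _ (@smooth1_cutoff R M)).
have dH := @is_derive_powR1D R (- weight m).
pose H' (s : R) := - weight m * (1 + s) `^ (- weight m - 1).
pose H'' (s : R) := - weight m * ((- weight m - 1) * (1 + s) `^ (- weight m - 1 - 1)).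
have dH' (s : R) : -1 < s -> is_derive s 1 H' (H'' s).
  move=> s1.
  have := is_deriveM (is_derive_cst (- weight m : R) s (1 : R))
    (@is_derive_powR1D R (- weight m - 1) s s1).
  by move=> K; apply: (is_derive_eq K); rewrite scaler0 addr0.
have sH' := smooth1_is_derive (@smooth1_hpow m) dH.
rewrite (hp_generatorM _ sH sX) (hp_generator_cutoff _ M0).
rewrite (hp_generator_radial _ sH' dH dH').
rewrite (hp_gamma_radial _ _ (@is_derive_cutoff R M)).
have -> : \sum_i hcoord i w * pd i (fun z => hpow m (hnorm2 z)) w =
    2 * H' (hnorm2 w) * hnorm2 w.
  rewrite [in RHS]hnorm2E mulr_sumr; apply: eq_bigr => i _.
  by rewrite (pd_radial i dH) -hnorm2E /H'; ring.
have vN1 : -1 < hnorm2 w by exact: hnorm2_gtN1.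
rewrite {1}/hpow_cutoff mulrA [coef_d m * (_ * _)]mulrA (hpow_pred m vN1).
rewrite /hpow_cutoff /cutoff1 /H'' /H' /hpow.
have y0 := onePhnorm2_gt0 w.
have pB (a : R) : (1 + hnorm2 w) `^ (a - 1) = (1 + hnorm2 w) `^ a / (1 + hnorm2 w).
  by rewrite powRB ?(gt_eqF y0) ?implybT// powRr1 ?(ltW y0).
rewrite !pB; have E0 := @flat0_half_gt0 R.
rewrite /cutoff /coef_c /coef_d /weight.
move: (flat 2 _) (flat 3 _) (flat 4 _) (flat 0 (cutoff_arg _ _)) (flat 0 _) ((1 + hnorm2 w) `^ _) E0
  => f2 f3 f4 f0 E p E0.
move: (hnorm2 w) y0 => v y0; move: (m%:R : R) => k.
by field; rewrite !gt_eqF.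
Qed.

Lemma cutoff_error_bound m : exists2 C : R, 0 <= C & forall M w, 1 <= M ->
  `|cutoff_error m M w| <=
  C / M * (hball_indic (expR M - 1) w * (1 + hnorm2 w)).
Proof.
have E0 := @flat0_half_gt0 R.
have iE0 : 0 <= (flat 0 (2^-1 : R))^-1 by rewrite invr_ge0 ltW.
(* The numbers come from the bounds [6], [24] and [120] of [flat 2], [flat 3] and [flat 4] on the
   range of the cutoff argument. *)
exists ((flat 0 (2^-1 : R))^-1 * (90 + 12 * n%:R + 12 * weight m)).
  by rewrite mulr_ge0// !addr_ge0 ?mulr_ge0 ?weight_ge0.
move=> M w M1; have M0 : 0 < M by rewrite (lt_le_trans _ M1).
rewrite cutoff_errorE// /hball_indic.
have v0 := hnorm2_ge0 w.
have [vM|Mv] := leP (hnorm2 w) (expR M - 1); last first.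
  have /ltW s0 := cutoff_arg_lt0 M0 Mv.
  by rewrite !(flat_le0 _ s0) !(mul0r, mulr0, subr0, addr0) normr0.
have s2 := cutoff_arg_le M0 v0.
have := flat_half_bound 2 s2; have := flat_ge0 2 (cutoff_arg M (hnorm2 w)).
have := flat_half_bound 3 s2; have := flat_ge0 3 (cutoff_arg M (hnorm2 w)).
have := flat_half_bound 4 s2; have := flat_ge0 4 (cutoff_arg M (hnorm2 w)).
rewrite -[5`!]/120%N -[4`!]/24%N -[3`!]/6%N.
have := hpow_ge0 m (hnorm2 w); have := hpow_le1 m v0; have := weight_ge0 m.
move: (flat 2 _) (flat 3 _) (flat 4 _) (hpow _ _) (weight m) => f2 f3 f4 p k
  k0 p1 p0 f40 f4b f30 f3b f20 f2b.
rewrite mulr1n mul1r -!mulrA normrM (ger0_norm iE0) ler_wpM2l//.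
rewrite normrM (ger0_norm p0).
have iM0 : 0 <= M^-1 by rewrite invr_ge0 ltW.
have iM1 : M^-1 <= 1 by rewrite invf_le1.
set b : R := (X in p * X <= _).
apply: (@le_trans _ _ (1 * b)); first by rewrite ler_wpM2r// normr_ge0.
rewrite mul1r /b invfM -exprVn -[2^-1 * _]mulrC.
move: (hnorm2 w) (M^-1) (n%:R : R) v0 iM0 iM1 (ler0n R n) => v q N v0 q0 q1 N0.
rewrite (_ : _ + _ = q * (v * ((f4 - 2 * f3) * 2^-1 * q + f2) - 2 * N * f2 + 2 * v * k * f2));
  last by ring.
rewrite normrM ger0_norm// mulrCA ler_wpM2l//.
set z := (f4 - 2 * f3) * 2^-1 * q.
have z1 : z <= 60.
  have : f4 * q <= 120 by rewrite -[leRHS]mulr1 ler_pM.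
  have : 0 <= f3 * q by rewrite mulr_ge0.
  by rewrite /z; lra.
have z2 : - 24 <= z.
  have : f3 * q <= 24 by rewrite -[leRHS]mulr1 ler_pM.
  have : 0 <= f4 * q by rewrite mulr_ge0.
  by rewrite /z; lra.
have a1 : v * (z + f2) <= v * 66 by rewrite ler_wpM2l//; lra.
have a2 : v * (- 24) <= v * (z + f2) by rewrite ler_wpM2l//; lra.
have a3 : N * f2 <= N * 6 by rewrite ler_wpM2l.
have a4 : 0 <= N * f2 by rewrite mulr_ge0.
have vk0 : 0 <= v * k by rewrite mulr_ge0.
have a5 : v * k * f2 <= v * k * 6 by rewrite ler_wpM2l.
have a6 : 0 <= v * k * f2 by rewrite mulr_ge0.
have a7 : 0 <= N * v by rewrite mulr_ge0.
by rewrite ler_norml; apply/andP; split; lra.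
Qed.

End magnetic_eigenfunctions.

(** * Discretized recursion for the means *)

Section discrete_recursion.
Context (R : realType).

(** As [0 <= a <= 1], past errors are never amplified and simply add up. It serves with
    [a = 1 - coef_c * h]. *)
Lemma discrete_gronwall (D eps : nat -> R) (a : R) (N : nat) :
  D 0%N = 0 -> 0 <= a <= 1 ->
  (forall i, (i < N)%N -> `|D i.+1 - a * D i| <= eps i) ->
  forall i, (i <= N)%N -> `|D i| <= \sum_(j < i) eps j.
Proof.
move=> D0 /andP[a0 a1] DS; elim=> [|i IH] iN; first by rewrite D0 normr0 big_ord0.
rewrite big_ord_recr/= (_ : D i.+1 = a * D i + (D i.+1 - a * D i)); last by ring.
apply: (le_trans (ler_normD _ _)); apply: lerD; last exact: DS.
rewrite normrM ger0_norm//; apply: le_trans (IH (ltnW iN)).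
by rewrite ler_piMl.
Qed.

Lemma telescope_le (e l : nat -> R) (x : R) (k : nat) :
  (forall i, l i <= e i.+1 - e i + x) ->
  \sum_(i < k) l i <= e k - e 0%N + k%:R * x.
Proof.
move=> le; elim: k => [|k IH]; first by rewrite big_ord0 mul0r addr0 subrr.
rewrite big_ord_recr/=; apply: (le_trans (lerD IH (le k))).
by rewrite -natr1 le_eqVlt; apply/orP; left; apply/eqP; ring.
Qed.

Lemma near_sqrt_small (t C e : R) : 0 < e ->
  \forall N \near \oo, C * Num.sqrt (t / N.+1%:R) <= e.
Proof.
move=> e0.
have c1 : t / N.+1%:R @[N --> \oo] --> (0 : R).
  by rewrite -[X in _ --> X](mulr0 t); apply: cvgM; [exact: cvg_cst|exact: cvg_harmonic].
have c2 : C * Num.sqrt (t / N.+1%:R) @[N --> \oo] --> (0 : R).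
  rewrite -[X in _ --> X](mulr0 C); apply: cvgM; first exact: cvg_cst.
  rewrite -[X in _ --> X](@sqrtr0 R).
  exact: (cvg_comp _ _ c1 (@sqrt_continuous R 0)).
exact: (cvgr_le _ c2).
Qed.

Context (n : nat) (d : measure_display) (Omega : measurableType d)
  (P : probability Omega R) (F : R -> set (set Omega))
  (w : R -> Omega -> 'M[R]_(n, 4)) (BM : brownian_motion_HP P F w)
  (lambda : 'rV[R]_3) (mu : R) (mu0 : 0 <= mu)
  (mu_lambda : edot lambda lambda = mu ^+ 2 + 2 * mu).

Definition phase (tau h : R) (i : nat) (omega : Omega) : R :=
  tau + \sum_(j < i) area_incr lambda (w (j%:R * h) omega) (w (j.+1%:R * h) omega).

Definition phase_mean (tau M h : R) (m i : nat) : R :=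
  expect P (fun omega => cos (phase tau h i omega) *
                         hpow_cutoff mu m M (hnorm2 (w (i%:R * h) omega))).

(** The mean of the weight that bounds the cutoff error in [cutoff_error_bound]; its sum over the
    time steps is what gets controlled uniformly in [M]. *)
Definition occupation (M s : R) : R :=
  expect P (fun omega => hball_indic (expR M - 1) (w s omega) *
                         (1 + hnorm2 (w s omega))).

Lemma phase_measurable tau h i : 0 <= h ->
  rv_measurable (F (i%:R * h)) (phase tau h i).
Proof.
move=> h0; have [FF _ _ _ _] := BM.
apply: measurable_funD; first exact: measurable_cst.
apply: measurable_sum => j.
have t0 : 0 <= j%:R * h by rewrite mulr_ge0.
have tS : j%:R * h <= j.+1%:R * h by rewrite ler_wpM2r// ler_nat.
have ti : j.+1%:R * h <= i%:R * h by rewrite ler_wpM2r// ler_nat.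
apply: (rv_measurable_mono FF (le_trans t0 tS) ti).
exact: (separable_measurable BM (@separable_area_incr R n lambda) t0 tS).
Qed.

Lemma rv_measurable_fun (s : R) (Y : Omega -> R) :
  0 <= s -> rv_measurable (F s) Y -> measurable_fun setT Y.
Proof.
move=> s0 mY; have [[sF mF _] _ _ _ _] := BM.
exact: (rv_measurableP (sF _ s0) (mF _ s0) mY).
Qed.

Lemma hball_weight_bounded M s : 0 <= s ->
  bounded_rv (fun omega => hball_indic (expR M - 1) (w s omega) *
                           (1 + hnorm2 (w s omega))).
Proof.
move=> s0; split.
  apply: measurable_funM; first by case: (hball_indic_bounded BM (expR M - 1) s0).
  apply: measurable_funD; first exact: measurable_cst.
  apply: (rv_measurable_fun s0).
  exact: (continuous_comp_measurable BM (smooth_continuous (@smooth_hnorm2 R n)) s0 (lexx s)).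
exists (expR M) => omega; rewrite /hball_indic.
have v0 := hnorm2_ge0 (w s omega).
case: (leP (hnorm2 (w s omega)) (expR M - 1)) => vM.
  by rewrite mul1r ger0_norm; lra.
by rewrite mul0r normr0 expR_ge0.
Qed.

(** This is [area_step] with [r = sqrt h]: its error [r^3] is [h * sqrt h], still negligible after
    summing over about [t / h] steps. The remaining term is the mean of the cutoff error. *)
Lemma phase_mean_step (m : nat) (M C' : R) : 1 <= M ->
  (forall M w, 1 <= M -> `|@cutoff_error R n mu m M w| <=
     C' / M * (hball_indic (expR M - 1) w * (1 + hnorm2 w))) ->
  exists2 C : R, 0 <= C &
  forall (tau h : R) (i : nat), 0 < h -> h <= 1 ->
    `|phase_mean tau M h m i.+1 - phase_mean tau M h m i -
      h * (coef_d mu m * phase_mean tau M h m.-1 i -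
           coef_c n mu m * phase_mean tau M h m i)| <=
    C * (h * Num.sqrt h) + h * (C' / M * occupation M (i%:R * h)).
Proof.
move=> M1 EC'; have M0 : 0 < M by rewrite (lt_le_trans _ M1).
have pK (s : R) : expR M - 1 < s -> hpow_cutoff mu m M s = 0.
  by move=> sM; rewrite /hpow_cutoff cutoff_vanish// mulr0.
have sp := @smooth1_hpow_cutoff R mu m M.
have [p' [dp _]] := sp 1%N.
have [C C0 SC] := area_step BM lambda sp dp pK (@hpow_cutoff_ge0 R mu m M).
exists C => // tau h i h0 h1.
have r0 : 0 < Num.sqrt h by rewrite sqrtr_gt0.
have rh : Num.sqrt h ^+ 2 = h by rewrite sqr_sqrtr// ltW.
have r1 : Num.sqrt h <= 1 by rewrite -sqrtr1 ler_wsqrtr.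
have s0 : 0 <= i%:R * h by rewrite mulr_ge0// ltW.
have mT := @phase_measurable tau h i (ltW h0).
have := SC _ _ _ s0 r0 r1 mT.
have -> : Num.sqrt h ^+ 3 = h * Num.sqrt h by rewrite exprS rh mulrC.
rewrite rh (_ : i%:R * h + h = i.+1%:R * h); last by rewrite -natr1; ring.
set s := i%:R * h in s0 mT *; set s' := i.+1%:R * h.
have s'0 : 0 <= s' by rewrite mulr_ge0// ltW.
set X := fun omega => _; move=> XC.
pose c omega := cos (phase tau h i omega).
pose f m' omega := hpow_cutoff mu m' M (hnorm2 (w s omega)).
pose er omega := cutoff_error mu m M (w s omega).
have bc : bounded_rv c by apply: bounded_rv_cos; exact: rv_measurable_fun mT.
have bf m' : bounded_rv (f m').
  exact: (testfn_bounded_rv BM (@testfn_hpow_cutoff R n mu m' M M0) s0).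
have bcf m' : bounded_rv (fun omega => c omega * f m' omega) by exact: bounded_rvM.
have bX' : bounded_rv (fun omega => cos (phase tau h i.+1 omega) *
      hpow_cutoff mu m M (hnorm2 (w s' omega))).
  apply: bounded_rvM.
    by apply: bounded_rv_cos; apply: (rv_measurable_fun s'0);
      exact: (@phase_measurable tau h i.+1 (ltW h0)).
  exact: (testfn_bounded_rv BM (@testfn_hpow_cutoff R n mu m M M0) s'0).
have ber : bounded_rv er.
  have tphi := @testfn_hpow_cutoff R n mu m M M0.
  have tphi' := @testfn_hpow_cutoff R n mu m.-1 M M0.
  have tL := testfn_hp_generator tphi.
  apply: bounded_rvB; last first.
    by apply: bounded_rvB; apply: bounded_rvM;
      [exact: bounded_rv_cst|exact: bf|exact: bounded_rv_cst|exact: bf].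
  apply: bounded_rvB; first exact: (testfn_bounded_rv BM tL s0).
  have tv := testfnM tphi
    (@smoothM R n _ _ (smooth_cst n (2^-1 * (mu ^+ 2 + 2 * mu))) (@smooth_hnorm2 R n)).
  exact: (testfn_bounded_rv BM tv s0).
have bcer : bounded_rv (fun omega => c omega * er omega) by exact: bounded_rvM.
have XE : X = (fun omega =>
    cos (phase tau h i.+1 omega) * hpow_cutoff mu m M (hnorm2 (w s' omega)) -
    c omega * f m omega -
    h * (coef_d mu m * (c omega * f m.-1 omega) - coef_c n mu m * (c omega * f m omega)) -
    h * (c omega * er omega)).
  apply/funext => omega; rewrite /X /er /cutoff_error mu_lambda.
  have -> : phase tau h i.+1 omega = phase tau h i omega +
      area_incr lambda (w s omega) (w s' omega).
    by rewrite /phase big_ord_recr/= addrA.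
  rewrite /c /f.
  move: (hnorm2 (w s omega)) (hpow_cutoff mu m M (hnorm2 (w s omega)))
    (hpow_cutoff mu m.-1 M (hnorm2 (w s omega)))
    (hpow_cutoff mu m M (hnorm2 (w s' omega)))
    (cos (phase tau h i omega))
    (cos (phase tau h i omega + area_incr _ _ _)) (hp_generator _ _)
    => v p0 p1 p2 c0 c1 L.
  by ring.
have scl (c0 : R) (Y : Omega -> R) : bounded_rv Y -> bounded_rv (fun omega => c0 * Y omega).
  by move=> bY; apply: bounded_rvM => //; exact: bounded_rv_cst.
have bdc : bounded_rv (fun omega => coef_d mu m * (c omega * f m.-1 omega) -
    coef_c n mu m * (c omega * f m omega)).
  exact: (bounded_rvB (scl (coef_d mu m) _ (bcf m.-1)) (scl (coef_c n mu m) _ (bcf m))).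
have EX : expect P X = phase_mean tau M h m i.+1 - phase_mean tau M h m i -
      h * (coef_d mu m * phase_mean tau M h m.-1 i -
           coef_c n mu m * phase_mean tau M h m i) -
      h * expect P (fun omega => c omega * er omega).
  rewrite XE (expectB P (bounded_rvB (bounded_rvB bX' (bcf m)) (scl h _ bdc)) (scl h _ bcer)).
  rewrite (expectB P (bounded_rvB bX' (bcf m)) (scl h _ bdc)) (expectB P bX' (bcf m)).
  rewrite (expectZ P h bdc) (expectZ P h bcer).
  rewrite (expectB P (scl (coef_d mu m) _ (bcf m.-1)) (scl (coef_c n mu m) _ (bcf m))).
  by rewrite (expectZ P _ (bcf m.-1)) (expectZ P _ (bcf m)).
rewrite EX in XC.
have Ee : `|expect P (fun omega => c omega * er omega)| <= C' / M * occupation M s.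
  have bO := hball_weight_bounded M s0.
  rewrite -expectZ//; apply: le_expect_norm => //; first exact: scl.
  move=> omega; rewrite normrM; apply: le_trans (EC' _ _ M1).
  by rewrite ler_piMl// ler_norml cos_geN1 cos_le1.
rewrite -[X in `|X| <= _](subrK (h * expect P (fun omega => c omega * er omega))).
apply: (le_trans (ler_normD _ _)); apply: lerD => //.
by rewrite normrM gtr0_norm// ler_pM2l.
Qed.

(* The left-hand side is at most the total increase of the mean of a function
   bounded independently of time, see [hp_generator_cutoff_ge]. *)
Lemma occupation_bound (M : R) : 1 <= M ->
  exists2 C : R, 0 <= C & forall (h : R) (k : nat), 0 <= h ->
    \sum_(i < k) h * occupation M (i%:R * h) <=
    expR 4 * ((2 * n%:R + 1) * 6 * (k%:R * h) + C * (k%:R * h) * h).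
Proof.
move=> M1; have M0 : 0 < M by rewrite (lt_le_trans _ M1).
have M20 : 0 < 2 * M by rewrite mulr_gt0.
pose E0 := flat 0 (2^-1 : R); have E00 : 0 < E0 := @flat0_half_gt0 R.
pose g (z : 'M[R]_(n, 4)) := 2 * M * E0 * cutoff (2 * M) (hnorm2 z).
have tg : testfn (expR (2 * M) - 1) g.
  split; last by move=> z zM; rewrite /g cutoff_vanish// mulr0.
  apply: smoothM; first exact: smooth_cst.
  exact: (@smooth_radial R n _ (@smooth1_cutoff R (2 * M))).
have [C C0 SC] := brownian_motion_HP_step BM tg.
exists C => // h k h0.
have tL := testfn_hp_generator tg.
have u0 i : 0 <= i%:R * h :> R by rewrite mulr_ge0.
have bg s : 0 <= s -> bounded_rv (fun omega => g (w s omega)) := testfn_bounded_rv BM tg.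
have bL s : 0 <= s -> bounded_rv (fun omega => hp_generator g (w s omega)) :=
  testfn_bounded_rv BM tL.
have step i : h * expect P (fun omega => hp_generator g (w (i%:R * h) omega)) <=
    expect P (fun omega => g (w (i.+1%:R * h) omega)) -
    expect P (fun omega => g (w (i%:R * h) omega)) + C * h ^+ 2.
  have m1 : rv_measurable (F (i%:R * h)) (fun=> 1 : R).
    by rewrite /rv_measurable; exact: measurable_cst.
  have n1 (omega : Omega) : `|1 : R| <= 1 by rewrite normr1.
  have := SC _ h (fun=> 1) (u0 i) h0 m1 n1; clear n1.
  rewrite (_ : i%:R * h + h = i.+1%:R * h); last by rewrite -natr1; ring.
  under eq_fun do rewrite mul1r.
  have bL' := bounded_rvM (bounded_rv_cst Omega h) (bL _ (u0 i)).
  rewrite (expectB P (bounded_rvB (bg _ (u0 i.+1)) (bg _ (u0 i))) bL').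
  rewrite (expectB P (bg _ (u0 i.+1)) (bg _ (u0 i))) (expectZ P h (bL _ (u0 i))).
  rewrite ler_norml => /andP[+ _].
  by rewrite lerBrDr addrC lerBlDr.
have tele := telescope_le k step.
have g_le s : 0 <= s -> expect P (fun omega => g (w s omega)) <= 2 * M * E0.
  move=> s0; rewrite -[leRHS](expect_cst P); apply: le_expect; [exact: bg|exact: bounded_rv_cst|].
  move=> omega; rewrite /g ler_piMr ?mulr_ge0 ?(ltW M0) ?(ltW E00)//.
  by rewrite cutoff_le1// hnorm2_ge0.
(* [g] is largest at the starting point, so its mean never exceeds the initial one. The telescoped
   increase is therefore at most zero, although [g] itself grows with [M]. *)
have g_0 : expect P (fun omega => g (w 0 omega)) = 2 * M * E0.
  rewrite -[RHS](expect_cst P); apply: expect_ae.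
  - by case: (bg _ (lexx 0)).
  - exact: measurable_cst.
  case: BM => _ _ w0 _ _; apply: filterS w0 => omega ->.
  by rewrite /g (_ : hnorm2 0 = 0) ?cutoff0 ?mulr1// hnorm2E big1// => i _;
    rewrite /hcoord linear0 mxE expr0n.
have occ i : occupation M (i%:R * h) <= expR 4 *
    (expect P (fun omega => hp_generator g (w (i%:R * h) omega)) + (2 * n%:R + 1) * 6).
  have bO := hball_weight_bounded M (u0 i).
  have -> : occupation M (i%:R * h) =
      expR 4 * (expR (- 4) * occupation M (i%:R * h)).
    by rewrite mulrA -expRD subrr expR0 mul1r.
  rewrite ler_pM2l ?expR_gt0//.
  rewrite -(expectZ P _ bO).
  have bc6 := bounded_rv_cst Omega ((2 * n%:R + 1) * 6 : R).
  have -> : expect P (fun omega => hp_generator g (w (i%:R * h) omega)) +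
      (2 * n%:R + 1) * 6 =
      expect P (fun omega => hp_generator g (w (i%:R * h) omega) + (2 * n%:R + 1) * 6).
    by rewrite (expectD P (bL _ (u0 i)) bc6) expect_cst.
  apply: le_expect.
  - by apply: bounded_rvM => //; exact: bounded_rv_cst.
  - by apply: bounded_rvD; [exact: bL|exact: bounded_rv_cst].
  by move=> omega; exact: hp_generator_cutoff_ge.
apply: (@le_trans _ _ (\sum_(i < k) (expR 4 * (h *
    expect P (fun omega => hp_generator g (w (i%:R * h) omega))) +
    expR 4 * (h * ((2 * n%:R + 1) * 6))))).
  apply: ler_sum => i _; rewrite -mulrDr -mulrDr mulrCA.
  by apply: ler_wpM2l.
rewrite big_split/= -mulr_sumr sumr_const card_ord -[_ *+ k]mulr_natr -mulrA -mulrDr.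
rewrite ler_pM2l ?expR_gt0//.
apply: (@le_trans _ _ (k%:R * (C * h ^+ 2) + h * ((2 * n%:R + 1) * 6) * k%:R)).
  rewrite lerD2r; apply: (le_trans tele); rewrite gerDr subr_le0.
  by apply: (le_trans (g_le _ (u0 k))); rewrite mul0r g_0.
by rewrite le_eqVlt; apply/orP; left; apply/eqP; ring.
Qed.

(** [J] stands for the exponentially weighted Jacobi moments, which enter through their initial
    value and their recursion up to [O(h^2)]. *)
Context (J : nat -> R -> R) (J0 : forall m, J m 0 = 1)
  (JS : forall m, exists2 C : R, 0 <= C & forall s h : R, 0 <= s -> 0 <= h -> h <= 1 ->
    `|J m (s + h) - J m s - h * (coef_d mu m * J m.-1 s - coef_c n mu m * J m s)|
    <= C * h ^+ 2).

Lemma phase_mean_limit (tau t : R) (m : nat) : 0 < t ->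
  exists2 B : R, 0 <= B & forall M, 1 <= M ->
    \forall N \near \oo, forall i, (i <= N.+1)%N ->
    `|phase_mean tau M (t / N.+1%:R) m i - cos tau * J m (i%:R * (t / N.+1%:R))| <= B / M.
Proof.
move=> t0.
(* One row of the triangular system is solved from the row before it. The factor [coef_d] in the
   hypothesis makes it trivial for [m' = 0], which starts the induction. *)
have main (m' : nat) : (exists2 B : R, 0 <= B & forall M, 1 <= M ->
    \forall N \near \oo, forall i, (i <= N.+1)%N ->
    coef_d mu m' * `|phase_mean tau M (t / N.+1%:R) m'.-1 i -
      cos tau * J m'.-1 (i%:R * (t / N.+1%:R))| <= B / M) ->
    exists2 B : R, 0 <= B & forall M, 1 <= M ->
    \forall N \near \oo, forall i, (i <= N.+1)%N ->
    `|phase_mean tau M (t / N.+1%:R) m' i - cos tau * J m' (i%:R * (t / N.+1%:R))| <= B / M.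
  move=> [B' B'0 IH]; have [C' C'0 EC'] := @cutoff_error_bound R n mu mu0 m'.
  have [CJ CJ0 JSm] := JS m'.
  (* For fixed [M] and large [N], the discretization errors [k1] and [k2] are at most [1/M] each,
     whence the [2], and the error [k3] in the occupation bound is at most [1], whence the final
     [+ 1]. *)
  exists (B' * t + 2 + C' * expR 4 * ((2 * n%:R + 1) * 6 * t + 1)).
    by rewrite !addr_ge0// !mulr_ge0 ?expR_ge0 ?(ltW t0)// !addr_ge0 ?mulr_ge0 ?(ltW t0).
  move=> M M1; have M0 : 0 < M by rewrite (lt_le_trans _ M1).
  have iM0 : 0 < M^-1 by rewrite invr_gt0.
  have [C1 C10 step] := phase_mean_step M1 EC'.
  have [C2 C20 occ] := occupation_bound M1.
  have IHM := IH M M1.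
  near=> N.
  have r1' : 1 * Num.sqrt (t / N.+1%:R) <= 1 by near: N; exact: near_sqrt_small.
  have k1 : t * C1 * Num.sqrt (t / N.+1%:R) <= M^-1 by near: N; exact: near_sqrt_small.
  have k2' : t * CJ * Num.sqrt (t / N.+1%:R) <= M^-1 by near: N; exact: near_sqrt_small.
  have k3' : t * C2 * Num.sqrt (t / N.+1%:R) <= 1 by near: N; exact: near_sqrt_small.
  have k4' : coef_c n mu m' * Num.sqrt (t / N.+1%:R) <= 1.
    by near: N; exact: near_sqrt_small.
  have IHN : forall i, (i <= N.+1)%N -> coef_d mu m' *
      `|phase_mean tau M (t / N.+1%:R) m'.-1 i -
        cos tau * J m'.-1 (i%:R * (t / N.+1%:R))| <= B' / M.
    by near: N; exact: IHM.
  set h := t / N.+1%:R in r1' k1 k2' k3' k4' IHN *.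
  have h0 : 0 < h by rewrite divr_gt0.
  have Nh : N.+1%:R * h = t by rewrite mulrC divfK.
  have r0 : 0 <= Num.sqrt h by rewrite sqrtr_ge0.
  have r1 : Num.sqrt h <= 1 by rewrite -[leLHS]mul1r.
  have hr : h <= Num.sqrt h.
    by rewrite -[leLHS](sqr_sqrtr (ltW h0)) expr2 ler_piMl.
  have h1 : h <= 1 := le_trans hr r1.
  have k2 : t * CJ * h <= M^-1.
    by apply: le_trans k2'; rewrite ler_wpM2l// mulr_ge0// ltW.
  have k3 : t * C2 * h <= 1.
    by apply: le_trans k3'; rewrite ler_wpM2l// mulr_ge0// ltW.
  have k4 : coef_c n mu m' * h <= 1.
    by apply: le_trans k4'; rewrite ler_wpM2l// coef_c_ge0.
  pose D i := phase_mean tau M h m' i - cos tau * J m' (i%:R * h).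
  pose eps i := h * (B' / M) + C1 * (h * Num.sqrt h) + CJ * h ^+ 2 +
    C' / M * (h * occupation M (i%:R * h)).
  have D0 : D 0%N = 0.
    rewrite /D mul0r J0 mulr1; apply/eqP; rewrite subr_eq0; apply/eqP.
    rewrite -[RHS](expect_cst P); apply: expect_ae.
    - apply: measurable_funM.
        have mT := rv_measurable_fun (mulr_ge0 (ler0n R 0) (ltW h0))
          (@phase_measurable tau h 0 (ltW h0)).
        by case: (bounded_rv_cos mT).
      by rewrite mul0r; case: (testfn_bounded_rv BM (@testfn_hpow_cutoff R n mu m' M M0) (lexx 0)).
    - exact: measurable_cst.
    case: BM => _ _ w0 _ _; apply: filterS w0 => omega w0.
    rewrite /phase big_ord0 addr0 mul0r w0.
    rewrite (_ : hnorm2 0 = 0); last first.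
      by rewrite hnorm2E big1// => i _; rewrite /hcoord linear0 mxE expr0n.
    by rewrite /hpow_cutoff cutoff0 /hpow addr0 powR1 !mulr1.
  have DS i : (i < N.+1)%N -> `|D i.+1 - (1 - coef_c n mu m' * h) * D i| <= eps i.
    move=> iN; have t_i : 0 <= i%:R * h by rewrite mulr_ge0// ltW.
    have S1 := step tau h i h0 h1.
    have S2 := JSm _ _ t_i (ltW h0) h1.
    have S3 := IHN i (ltnW iN).
    rewrite (_ : i%:R * h + h = i.+1%:R * h) in S2; last by rewrite -natr1; ring.
    rewrite /D /eps.
    set g1 := phase_mean _ _ _ _ i.+1 in S1 *; set g0 := phase_mean _ _ _ m' i in S1 *.
    set gp := phase_mean _ _ _ m'.-1 i in S1 S3 *.
    set j1 := J m' (i.+1%:R * h) in S2 *; set j0 := J m' (i%:R * h) in S2 *.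
    set jp := J m'.-1 _ in S2 S3 *.
    rewrite (_ : _ - _ * _ = (g1 - g0 - h * (coef_d mu m' * gp - coef_c n mu m' * g0)) -
      cos tau * (j1 - j0 - h * (coef_d mu m' * jp - coef_c n mu m' * j0)) +
      h * (coef_d mu m' * (gp - cos tau * jp))); last by ring.
    have d0 : 0 <= coef_d mu m' by rewrite !mulr_ge0// !addr_ge0.
    have T3 : `|h * (coef_d mu m' * (gp - cos tau * jp))| <= h * (B' / M).
      by rewrite normrM (gtr0_norm h0) ler_pM2l// normrM (ger0_norm d0).
    have T2 : `|cos tau * (j1 - j0 - h * (coef_d mu m' * jp - coef_c n mu m' * j0))|
        <= CJ * h ^+ 2.
      rewrite normrM; apply: le_trans S2; rewrite ler_piMl//.
      by rewrite ler_norml cos_geN1 cos_le1.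
    apply: (le_trans (ler_normD _ _)).
    apply: (@le_trans _ _ ((C1 * (h * Num.sqrt h) + h * (C' / M * occupation M (i%:R * h))
        + CJ * h ^+ 2) + h * (B' / M))).
      by apply: lerD => //; apply: (le_trans (ler_normB _ _)); apply: lerD.
    rewrite [X in _ + X + _ + _]mulrCA.
    by move: (h * occupation _ _) => O; lra.
  have a01 : 0 <= 1 - coef_c n mu m' * h <= 1.
    rewrite subr_ge0 k4/= gerBl mulr_ge0 ?(ltW h0)// coef_c_ge0//.
  move=> i iN; apply: (le_trans (discrete_gronwall D0 a01 DS iN)).
  have ih : i%:R * h <= t by rewrite -Nh ler_wpM2r ?(ltW h0)// ler_nat.
  rewrite /eps big_split/= -mulr_sumr sumr_const card_ord -[_ *+ i]mulr_natr.
  have O := occ h i (ltW h0).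
  have CM0 : 0 <= C' / M by rewrite mulr_ge0// ltW.
  apply: (@le_trans _ _ ((B' / M + C1 * Num.sqrt h + CJ * h) * t +
    C' / M * (expR 4 * ((2 * n%:R + 1) * 6 * t + 1)))).
    apply: lerD.
      rewrite (_ : _ * i%:R = (B' / M + C1 * Num.sqrt h + CJ * h) * (i%:R * h)); last by ring.
      apply: ler_wpM2l => //.
      by apply: addr_ge0; [apply: addr_ge0|]; apply: mulr_ge0 => //; exact: ltW.
    apply: ler_wpM2l => //; apply: (le_trans O).
    rewrite ler_pM2l ?expR_gt0//; apply: lerD.
      by rewrite ler_wpM2l// mulr_ge0// addr_ge0// mulr_ge0.
    apply: le_trans k3; rewrite [t * C2]mulrC ler_wpM2r ?(ltW h0)//.
    by rewrite ler_wpM2l.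
  rewrite [leRHS](_ : _ = B' / M * t + M^-1 + M^-1 +
    C' / M * (expR 4 * ((2 * n%:R + 1) * 6 * t + 1))); last by ring.
  rewrite lerD2r (_ : _ * t = B' / M * t + t * C1 * Num.sqrt h + t * CJ * h); last by ring.
  by apply: lerD => //; apply: lerD.
elim: m => [|m [B B0 IH]]; apply: main.
  exists 0 => // M M1; near=> N => i _.
  by rewrite /coef_d mulr0 !mul0r.
have d0 : 0 <= coef_d mu m.+1 by rewrite !mulr_ge0// !addr_ge0.
exists (coef_d mu m.+1 * B); first by rewrite mulr_ge0.
move=> M M1; have := IH M M1; apply: filterS => N H i iN.
by rewrite -mulrA ler_wpM2l//; exact: H.
Unshelve. all: by end_near. Qed.

End discrete_recursion.

(** * Characteristic function of the area *)

Section convergence_in_probability.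
Context (R : realType) (d : measure_display) (Omega : measurableType d)
  (P : probability Omega R).

Lemma cos_lipschitz (x y : R) : `|cos x - cos y| <= `|x - y|.
Proof.
have dc (z : R) : is_derive z 1 (fun z => cos (y + z)) (- sin (y + z)).
  have dt : is_derive z 1 (fun z => y + z) 1.
    have := is_deriveD (is_derive_cst (y : R) z (1 : R)) (is_derive_id z (1 : R)).
    by rewrite add0r.
  by have := is_derive1_comp (is_derive_cos (y + z)) dt; rewrite mulr1.
have := @mean_value_bound R _ _ (x - y) 1 dc.
rewrite addr0 mul1r addrCA subrr addr0; apply => c _.
by rewrite normrN ler_norml sin_geN1 sin_le1.
Qed.

(** Off the events [A N k] the Lipschitz bound moves the cosine by at most [e / 2]; on them it moves
    by at most [2], and their probabilities tend to zero. *)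
Lemma cvg_in_probability_cos (I : finType) (X : nat -> I -> Omega -> R)
    (Y : I -> Omega -> R) (c : I -> R) (tau : R) (Z : Omega -> R) :
  (forall N k, measurable_fun setT (X N k)) -> (forall k, measurable_fun setT (Y k)) ->
  (forall k, cvg_in_probability P (fun N => X N k) (Y k)) ->
  bounded_rv Z -> (forall omega, `|Z omega| <= 1) ->
  expect P (fun omega => cos (tau + \sum_k c k * X N k omega) * Z omega)
    @[N --> \oo] -->
  expect P (fun omega => cos (tau + \sum_k c k * Y k omega) * Z omega).
Proof.
move=> mX mY XY bZ Z1.
have mcX N : measurable_fun setT (fun omega => tau + \sum_k c k * X N k omega).
  apply: measurable_funD => //; apply: measurable_sum => k.
  exact: measurable_funM.
have mcY : measurable_fun setT (fun omega => tau + \sum_k c k * Y k omega).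
  apply: measurable_funD => //; apply: measurable_sum => k.
  exact: measurable_funM.
apply/cvgrPdist_le => e e0.
pose L := 1 + \sum_k `|c k|.
have L0 : 0 < L by rewrite ltr_pwDl// sumr_ge0.
pose e' := e / 2 / L.
have e'0 : 0 < e' by rewrite !divr_gt0.
pose A N k := [set omega | e' < `|X N k omega - Y k omega|].
have mA N k : measurable (A N k).
  rewrite (_ : A N k = (fun omega => `|X N k omega - Y k omega|) @^-1` `]e', +oo[%classic).
    have mf : measurable_fun setT (fun omega => `|X N k omega - Y k omega|).
      by apply: measurableT_comp => //; exact: measurable_funB.
    by rewrite -[X in measurable X]setTI; apply: mf.
  by apply/seteqP; split => omega /=; rewrite in_itv/= andbT.
have bA N k : bounded_rv (\1_(A N k) : Omega -> R).
  split; first exact: measurable_indic.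
  by exists 1 => omega; rewrite indicE; case: (_ \in _); rewrite ?normr1 ?normr0.
have EA N k : expect P (\1_(A N k)) = fine (P (A N k)).
  by rewrite /expect /Rintegral integral_indic// setIT.
have small : \forall N \near \oo, \sum_k fine (P (A N k)) <= e / 4.
  have c0 : \sum_k fine (P (A N k)) @[N --> \oo] --> (0 : R).
    elim: (index_enum I) => [|k s IH].
      by under eq_fun do rewrite big_nil; exact: cvg_cst.
    have ck : fine (P (A N k)) @[N --> \oo] --> (0 : R).
      by apply/fine_cvg; exact: XY.
    rewrite (_ : (fun N => \sum_(j <- k :: s) fine (P (A N j))) =
      (fun N => fine (P (A N k)) + \sum_(j <- s) fine (P (A N j)))).
      by rewrite -[X in _ --> X](addr0 (0 : R)); exact: (cvgD ck IH).
    by apply/funext => N; rewrite big_cons.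
  by apply: (cvgr_le _ c0); rewrite divr_gt0.
apply: filterS small => N small.
have bcX : bounded_rv (fun omega => cos (tau + \sum_k c k * X N k omega) * Z omega).
  by apply: bounded_rvM => //; exact: bounded_rv_cos.
have bcY : bounded_rv (fun omega => cos (tau + \sum_k c k * Y k omega) * Z omega).
  by apply: bounded_rvM => //; exact: bounded_rv_cos.
rewrite -(expectB P bcY bcX).
have bS : bounded_rv (fun omega => \sum_k \1_(A N k) omega : R).
  by apply: bounded_rv_sum => k; exact: bA.
have bS2 := bounded_rvM (bounded_rv_cst Omega (2 : R)) bS.
apply: (@le_trans _ _ (expect P (fun omega => e / 2 + 2 * \sum_k \1_(A N k) omega))).
  apply: le_expect_norm; first exact: bounded_rvB.
    by apply: bounded_rvD => //; exact: bounded_rv_cst.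
  move=> omega; rewrite -mulrBl normrM.
  apply: (@le_trans _ _ `|cos (tau + \sum_k c k * Y k omega) -
      cos (tau + \sum_k c k * X N k omega)|); first by rewrite ler_piMr.
  have [[k Ak]|nA] := pselect (exists k, A N k omega).
    apply: (@le_trans _ _ 2).
      rewrite (le_trans (ler_normB _ _))// -[leRHS]/(1 + 1) lerD// ler_norml;
        by rewrite cos_geN1 cos_le1.
    rewrite -lerBlDl; apply: (@le_trans _ _ (2 * \1_(A N k) omega)).
      by rewrite indicE mem_set// mulr1 gerBl divr_ge0// ltW.
    by rewrite ler_pM2l// (bigD1 k)//= lerDl sumr_ge0.
  apply: (@le_trans _ _ (e / 2)); last first.
    by rewrite lerDl mulr_ge0// sumr_ge0// => i _; rewrite indicE ler0n.
  apply: (le_trans (cos_lipschitz _ _)).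
  rewrite opprD addrACA subrr add0r -sumrB.
  apply: (le_trans (ler_norm_sum _ _ _)).
  apply: (@le_trans _ _ (\sum_k `|c k| * e')).
    apply: ler_sum => k _; rewrite -mulrBr normrM ler_wpM2l//.
    by rewrite leNgt; apply/negP => lt; apply: nA; exists k; rewrite /A/= distrC.
  rewrite -mulr_suml (_ : e / 2 = L * e'); last by rewrite /e' [RHS]mulrC divfK ?gt_eqF.
  by rewrite ler_wpM2r ?(ltW e'0)// lerDr.
rewrite (expectD P (bounded_rv_cst Omega _) bS2) expect_cst (expectZ P 2 bS).
rewrite expect_sum; last by move=> k; exact: bA.
under eq_bigr do rewrite EA.
by move: (\sum_k _) small => x; lra.
Qed.

End convergence_in_probability.

(** * Midpoint sums along uniform partitions *)

Section area_limit.
Context (R : realType) (n : nat).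
Implicit Types (w : R -> 'M[R]_(n, 4)).

Definition unif_partition (t : R) (N : nat) : seq R :=
  mkseq (fun i => i.+1%:R * (t / N.+1%:R)) N.+1.

Lemma unif_partition_nth t N i : (i < N.+1)%N ->
  nth 0 (unif_partition t N) i = i.+1%:R * (t / N.+1%:R).
Proof. by move=> iN; rewrite nth_mkseq. Qed.

Lemma unif_partition_nth0 t N i : (i <= N.+1)%N ->
  nth 0 (0 :: unif_partition t N) i = i%:R * (t / N.+1%:R).
Proof. by case: i => [|i] iN /=; [rewrite mul0r|rewrite unif_partition_nth]. Qed.

Lemma unif_partitionP t N : 0 < t -> itv_partition 0 t (unif_partition t N).
Proof.
move=> t0; split.
  apply/(pathP 0) => i; rewrite size_mkseq => iN.
  rewrite unif_partition_nth0 ?(ltnW iN)// unif_partition_nth//.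
  by rewrite ltr_pM2r ?divr_gt0// ltr_nat.
by rewrite (last_nth 0) size_mkseq unif_partition_nth0// mulrC divfK.
Qed.

Lemma unif_partition_mesh t : 0 < t -> mesh 0 (unif_partition t N) @[N --> \oo] --> (0 : R).
Proof.
move=> t0.
have c1 : t / N.+1%:R @[N --> \oo] --> (0 : R).
  by rewrite -[X in _ --> X](mulr0 t); apply: cvgM; [exact: cvg_cst|exact: cvg_harmonic].
apply: (squeeze_cvgr _ (cvg_cst (0 : R)) c1); apply: nearW => N.
rewrite /mesh; apply/andP; split; first exact: bigmax_ge_id.
apply: bigmax_le => [|[i iN] _ /=]; first by rewrite divr_ge0// ltW.
rewrite size_mkseq in iN.
rewrite unif_partition_nth// unif_partition_nth0 ?(ltnW iN)//.
by rewrite -mulrBl -natr1 addrAC subrr add0r mul1r.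
Qed.

Lemma edot_qim_linear (lambda : 'rV[R]_3) (I : Type) (s : seq I) (f : I -> 'rV[R]_4) :
  edot lambda (qim (\sum_(i <- s) f i)) = \sum_(i <- s) edot lambda (qim (f i)).
Proof.
elim/big_rec2: _ => [|i y x _ <-].
  by rewrite /edot big1// => k _; rewrite !mxE mulr0.
by rewrite /edot -big_split; apply: eq_bigr => k _; rewrite !mxE mulrDr.
Qed.

Lemma edot_qimZ (lambda : 'rV[R]_3) c p :
  edot lambda (qim (c *: p)) = c * edot lambda (qim p).
Proof. by rewrite /edot mulr_sumr; apply: eq_bigr => k _; rewrite !mxE mulrCA. Qed.

(** When the products are expanded, [y conj(y)] and [z conj(z)] cancel. There remains
    [z conj(y) - y conj(z)], which is twice the imaginary part of [z conj(y)]. *)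
Lemma stratonovich_term (lambda : 'rV[R]_3) (y z : 'rV[R]_4) (ry rz : R) :
  edot lambda (qim (qmul (z - y) (2^-1 *: (ry *: qconj y + rz *: qconj z)) -
                    qmul (2^-1 *: (ry *: y + rz *: z)) (qconj z - qconj y))) =
  (ry + rz) * edot lambda (qim (qmul z (qconj y))).
Proof.
rewrite /edot !sum_ord3 !qimE.
have B (p q : 'rV[R]_4) k : (p - q) 0 k = p 0 k - q 0 k by rewrite !mxE.
have D (p q : 'rV[R]_4) k : (p + q) 0 k = p 0 k + q 0 k by rewrite !mxE.
have Z c (p : 'rV[R]_4) k : (c *: p) 0 k = c * p 0 k by rewrite !mxE.
rewrite !B /qmul !mkquatE !B !Z !D !Z !qconjE.
by field.
Qed.

Lemma edot_area_sum (lambda : 'rV[R]_3) w (t : R) (N : nat) :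
  edot lambda (qim (area_sum w (unif_partition t N))) =
  \sum_(i < N.+1) area_incr lambda (w (i%:R * (t / N.+1%:R))) (w (i.+1%:R * (t / N.+1%:R))).
Proof.
rewrite /area_sum edot_qimZ edot_qim_linear mulr_sumr.
under eq_bigr => j _ do rewrite edot_qim_linear mulr_sumr.
rewrite exchange_big size_mkseq; apply: eq_bigr => i _ /=.
have iN : (i < N.+1)%N by [].
rewrite unif_partition_nth// unif_partition_nth0 ?(ltnW iN)//.
rewrite /area_incr hdot_imrot mulr_sumr; apply: eq_bigr => j _.
by rewrite stratonovich_term mulrA !rhoE.
Qed.

End area_limit.

(** * Passage to the limit in the partition and in the cutoff *)

Section area_limit_law.
Context (R : realType) (n : nat) (d : measure_display) (Omega : measurableType d)
  (P : probability Omega R) (F : R -> set (set Omega))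
  (w : R -> Omega -> 'M[R]_(n, 4)) (BM : brownian_motion_HP P F w).

Lemma area_sum_measurable (t : R) (N : nat) (k : 'I_3) : 0 < t ->
  measurable_fun setT
    (fun omega => qim (area_sum (fun u => w u omega) (unif_partition t N)) 0 k).
Proof.
move=> t0; have h0 : 0 <= t / N.+1%:R by rewrite divr_ge0// ltW.
(* The [k]-th coordinate of the area sum is the phase for [lambda] equal to the [k]-th basis
   vector. *)
have := rv_measurable_fun BM (mulr_ge0 (ler0n R N.+1) h0)
  (@phase_measurable _ _ _ _ _ _ _ BM (delta_mx 0 k) 0 _ N.+1 h0).
congr measurable_fun; apply/funext => omega.
rewrite /phase add0r -(edot_area_sum _ (fun u => w u omega)).
rewrite /edot (bigD1 k)//= big1 => [|l lk].
  by rewrite mxE !eqxx mul1r addr0.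
by rewrite mxE eqxx (negbTE lk) mul0r.
Qed.

Context (a : R -> Omega -> 'rV[R]_3) (QA : quaternionic_area P w a)
  (lambda : 'rV[R]_3) (mu : R) (mu0 : 0 <= mu)
  (mu_lambda : edot lambda lambda = mu ^+ 2 + 2 * mu)
  (J : nat -> R -> R) (J0 : forall m, J m 0 = 1)
  (JS : forall m, exists2 C : R, 0 <= C & forall s h : R, 0 <= s -> 0 <= h -> h <= 1 ->
    `|J m (s + h) - J m s - h * (coef_d mu m * J m.-1 s - coef_c n mu m * J m s)|
    <= C * h ^+ 2).

Lemma edot_area_measurable (t : R) : 0 <= t ->
  measurable_fun setT (fun omega => edot lambda (a t omega)).
Proof.
move=> t0; apply: measurable_sum => k; apply: measurable_funM => //.
by case: (QA k t0).
Qed.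

Lemma hnorm2_measurable (t : R) : 0 <= t ->
  measurable_fun setT (fun omega => hnorm2 (w t omega)).
Proof.
move=> t0; apply: (rv_measurable_fun BM t0).
exact: (continuous_comp_measurable BM (smooth_continuous (@smooth_hnorm2 R n)) t0 (lexx t)).
Qed.

Lemma hpow_measurable (t : R) m : 0 <= t ->
  measurable_fun setT (fun omega => hpow mu m (hnorm2 (w t omega))).
Proof.
move=> t0; apply: (measurableT_comp (f := fun x : R => x `^ (- weight mu m))).
  exact: measurable_powR.
by apply: measurable_funD => //; exact: hnorm2_measurable.
Qed.

Lemma area_cutoff_moment (tau t : R) (m : nat) : 0 < t ->
  exists2 B : R, 0 <= B & forall M, 1 <= M ->
  `|expect P (fun omega => cos (tau + edot lambda (a t omega)) *
      hpow_cutoff mu m M (hnorm2 (w t omega))) - cos tau * J m t| <= B / M.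
Proof.
move=> t0; have [B B0 PB] := phase_mean_limit BM mu0 mu_lambda J0 JS tau m t0.
exists B => // M M1; have M0 : 0 < M by rewrite (lt_le_trans _ M1).
have bZ : bounded_rv (fun omega => hpow_cutoff mu m M (hnorm2 (w t omega))).
  exact: (testfn_bounded_rv BM (@testfn_hpow_cutoff R n mu m M M0) (ltW t0)).
have Z1 omega : `|hpow_cutoff mu m M (hnorm2 (w t omega))| <= 1.
  by rewrite ger0_norm ?hpow_cutoff_ge0 ?hpow_cutoff_le1// hnorm2_ge0.
have cE := @cvg_in_probability_cos R d Omega P 'I_3
  (fun N k omega => qim (area_sum (fun u => w u omega) (unif_partition t N)) 0 k)
  (fun k omega => a t omega 0 k) (fun k => lambda 0 k) tau _
  (fun N k => @area_sum_measurable t N k t0)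
  (fun k => (QA k (ltW t0)).1)
  (fun k => (QA k (ltW t0)).2 _ (fun N => unif_partitionP N t0) (unif_partition_mesh t0))
  bZ Z1.
have NE N : expect P (fun omega => cos (tau + \sum_k lambda 0 k *
      qim (area_sum (fun u => w u omega) (unif_partition t N)) 0 k) *
      hpow_cutoff mu m M (hnorm2 (w t omega))) =
    phase_mean P w lambda mu tau M (t / N.+1%:R) m N.+1.
  rewrite /phase_mean (_ : N.+1%:R * (t / N.+1%:R) = t); last by rewrite mulrC divfK.
  congr (expect P); apply/funext => omega; congr (cos (tau + _) * _).
  exact: (edot_area_sum lambda (fun u => w u omega)).
apply: (cvgr_to_le (cvg_norm (cvgB cE (cvg_cst (cos tau * J m t))))).
have := PB M M1; apply: filterS => N /(_ N.+1 (leqnn _)).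
by rewrite -NE (_ : N.+1%:R * (t / N.+1%:R) = t); last by rewrite mulrC divfK.
Qed.

(** The cutoff level tends to infinity along the integers: dominated convergence handles the
    expectation, and the distance [B / M] to the right-hand side vanishes. *)
Lemma area_moment (tau t : R) (m : nat) : 0 < t ->
  expect P (fun omega => cos (tau + edot lambda (a t omega)) *
      hpow mu m (hnorm2 (w t omega))) = cos tau * J m t.
Proof.
move=> t0; have [B B0 HB] := area_cutoff_moment tau m t0.
have mE : measurable_fun setT (fun omega => tau + edot lambda (a t omega)).
  by apply: measurable_funD => //; apply: edot_area_measurable; exact: ltW.
have [mc _] := bounded_rv_cos mE.
pose X N omega := cos (tau + edot lambda (a t omega)) *
  hpow_cutoff mu m N.+1%:R (hnorm2 (w t omega)).
have cX : expect P (X N) @[N --> \oo] --> expect P (fun omega =>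
    cos (tau + edot lambda (a t omega)) * hpow mu m (hnorm2 (w t omega))).
  apply: (@expect_cvg R d Omega P X _ 1).
  - move=> N; apply: measurable_funM => //.
    by case: (testfn_bounded_rv BM (@testfn_hpow_cutoff R n mu m N.+1%:R (ltr0Sn _ _)) (ltW t0)).
  - by apply: measurable_funM => //; apply: hpow_measurable; exact: ltW.
  - apply: aeW => omega.
    have v1 : -1 < hnorm2 (w t omega) by rewrite (lt_le_trans _ (hnorm2_ge0 _)).
    apply: cvgM; first exact: cvg_cst.
    have := cvgM (cvg_cst (hpow mu m (hnorm2 (w t omega)))) (cutoff_cvg v1).
    by rewrite mulr1; apply.
  - apply: aeW => omega N; rewrite normrM mulr_ile1//.
      by rewrite ler_norml cos_geN1 cos_le1.
    by rewrite ger0_norm ?hpow_cutoff_ge0 ?hpow_cutoff_le1 ?hnorm2_ge0.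
have c0 : B / N.+1%:R @[N --> \oo] --> (0 : R).
  by rewrite -[X in _ --> X](mulr0 B); apply: cvgM; [exact: cvg_cst|exact: cvg_harmonic].
have cJ : expect P (X N) @[N --> \oo] --> cos tau * J m t.
  apply/cvgrPdist_le => e e0.
  have cB : \forall N \near \oo, B / N.+1%:R <= e by apply: (cvgr_le _ c0).
  apply: filterS cB => N; apply: le_trans.
  by rewrite distrC; apply: (HB N.+1%:R); rewrite ler1n.
exact: (cvg_unique _ cX cJ).
Qed.

End area_limit_law.

(** * Moments of the Jacobi process *)

Section jacobi_moments.
Context (R : realType) (n : nat) (mu : R).

Lemma jacobi_gen_intro (alpha beta : R) (f f1 f2 g : R -> R) :
  (forall x : R, is_derive x 1 f (f1 x)) -> (forall x : R, is_derive x 1 f1 (f2 x)) ->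
  continuous f2 -> continuous g -> f1 0 = 0 -> f1 (pi / 2) = 0 ->
  (forall r, 0 < r < pi / 2 ->
     g r = 2^-1 * f2 r + ((alpha + 2^-1) * (cos r / sin r) -
                          (beta + 2^-1) * (sin r / cos r)) * f1 r) ->
  jacobi_gen alpha beta f g.
Proof.
move=> df df1 cf2 cg f10 f1pi gE.
have E1 : derive1 f = f1.
  by apply/funext => x; rewrite derive1E; apply: derive_val.
have E2 : derive1n 2 f = f2.
  by rewrite derive1nS/= E1; apply/funext => x; rewrite derive1E; apply: derive_val.
split; rewrite ?E2 ?E1//.
- exact: continuous_subspaceT.
- by move=> r r0; rewrite /jacobi_op E1 E2 gE.
Qed.

Definition cos_pow (m : nat) (r : R) : R := cos r ^+ m.*2.

(** At [m = 0] the truncated predecessors in the exponents do no harm, here and in [cos_pow2]: the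
    factor [m.*2%:R] is zero. *)
Let cos_pow1 (m : nat) (r : R) : R := - (m.*2%:R * (cos r ^+ m.*2.-1 * sin r)).

Let cos_pow2 (m : nat) (r : R) : R :=
  m.*2%:R * (m.*2.-1%:R * (cos r ^+ m.*2.-2 * sin r ^+ 2) - cos r ^+ m.*2).

(** The Jacobi generator applied to [cos^(2 m)]. The poles of its coefficients cancel, leaving a
    polynomial in [cos^2], again an admissible test function. *)
Definition cos_pow_gen (m : nat) (r : R) : R :=
  coef_d mu m * cos_pow m.-1 r - (coef_d mu m + 4 * n%:R * m%:R) * cos_pow m r.

Lemma is_derive_cosX k (x : R) :
  is_derive x 1 (fun r : R => cos r ^+ k.+1) (- (k.+1%:R * (cos x ^+ k * sin x))).
Proof.
rewrite (_ : (fun r => _) = (@cos R) ^+ k.+1); last by apply/funext => r; rewrite exprfctE.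
have H := is_deriveX k.+1 (is_derive_cos x); apply: (is_derive_eq H).
by rewrite /GRing.scale/=; ring.
Qed.

Lemma is_derive_cos_pow m (x : R) : is_derive x 1 (cos_pow m) (cos_pow1 m x).
Proof.
case: m => [|m]; rewrite /cos_pow /cos_pow1; last exact: is_derive_cosX.
by rewrite mul0r oppr0; exact: is_derive_cst.
Qed.

Lemma is_derive_cos_pow1 m (x : R) : is_derive x 1 (cos_pow1 m) (cos_pow2 m x).
Proof.
case: m => [|m]; rewrite /cos_pow1 /cos_pow2.
  rewrite mul0r (_ : (fun r => _) = cst 0); first exact: is_derive_cst.
  by apply/funext => r; rewrite mul0r oppr0.
have H := is_deriveN (is_deriveZ m.+1.*2%:R (is_deriveM (is_derive_cosX m.*2 x) (is_derive_sin x))).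
apply: (is_derive_eq H).
by rewrite /GRing.scale/= doubleS !exprS; ring.
Qed.

Lemma continuous_cosX k : continuous (fun r : R => cos r ^+ k).
Proof.
move=> r; exact: (@continuous_comp _ _ _ (@cos R) (fun x => x ^+ k) r
  (@continuous_cos R r) (@exprn_continuous _ k _)).
Qed.

Lemma continuous_cos_pow2 m : continuous (cos_pow2 m).
Proof.
move=> r; apply: cvgM; first exact: cvg_cst.
apply: cvgB; last exact: continuous_cosX.
apply: cvgM; first exact: cvg_cst.
apply: cvgM; first exact: continuous_cosX.
exact: (@continuous_comp _ _ _ (@sin R) (fun x => x ^+ 2) r
  (@continuous_sin R r) (@exprn_continuous _ 2 _)).
Qed.

Lemma continuous_cos_pow_gen m : continuous (cos_pow_gen m).
Proof.
by move=> r; apply: cvgB; apply: cvgM;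
  [exact: cvg_cst|exact: continuous_cosX|exact: cvg_cst|exact: continuous_cosX].
Qed.

Lemma cos_pow1_0 m : cos_pow1 m 0 = 0.
Proof. by rewrite /cos_pow1 sin0 !mulr0 oppr0. Qed.

Lemma cos_pow1_pi2 m : cos_pow1 m (pi / 2) = 0.
Proof.
rewrite /cos_pow1; case: m => [|m]; first by rewrite mul0r oppr0.
by rewrite cos_pihalf doubleS expr0n/= mul0r mulr0 oppr0.
Qed.

Lemma cos_pow_genE m (r : R) : 0 < r < pi / 2 ->
  cos_pow_gen m r = 2^-1 * cos_pow2 m r +
    ((2 * n%:R - 1 + 2^-1) * (cos r / sin r) -
     (mu + 1 + 2^-1) * (sin r / cos r)) * cos_pow1 m r.
Proof.
move=> /andP[r0 rpi].
have c0 : cos r != 0.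
  by rewrite gt_eqF// cos_gt0_pihalf// rpi (lt_trans _ r0)// oppr_lt0 divr_gt0// pi_gt0.
have s0 : sin r != 0.
  rewrite gt_eqF// sin_gt0_pi// r0/= (lt_trans rpi)//.
  by rewrite ltr_pdivrMr// ltr_pMr ?pi_gt0// ltr1n.
rewrite /cos_pow_gen /cos_pow /cos_pow1 /cos_pow2 /coef_d.
case: m => [|m] /=; first by rewrite !(mulr0, mul0r); ring.
rewrite (sin2cos2 r) doubleS /= !exprS.
set c := cos r in c0 *; set s := sin r in s0 *; set k := c ^+ m.*2.
have e1 : s * s = 1 - c * c by rewrite -!expr2 /s sin2cos2.
(* The single factors [cos] and [sin] in the first derivative clear both denominators. *)
have e2 (A B q : R) : (A * (c / s) - B * (s / c)) * - (q * (c * k * s)) =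
    - (q * k * (A * (c * c) - B * (s * s))) by field; rewrite c0 s0.
have m2 : (m.*2.+2%:R : R) = 2 * m%:R + 2 by rewrite -!natr1 -mul2n natrM; ring.
have m1 : (m.*2.+1%:R : R) = 2 * m%:R + 1 by rewrite -natr1 -mul2n natrM.
rewrite e2 e1 m2 m1 -[m.+1%:R]natr1 expr0; clear.
by field.
Qed.

Lemma jacobi_gen_cos_pow m :
  jacobi_gen (2 * n%:R - 1) (mu + 1) (cos_pow m) (cos_pow_gen m).
Proof.
apply: (@jacobi_gen_intro _ _ _ (cos_pow1 m) (cos_pow2 m)).
- exact: is_derive_cos_pow.
- exact: is_derive_cos_pow1.
- exact: continuous_cos_pow2.
- exact: continuous_cos_pow_gen.
- exact: cos_pow1_0.
- exact: cos_pow1_pi2.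
- exact: cos_pow_genE.
Qed.

Definition cos_pow_gen2 (m : nat) (r : R) : R :=
  coef_d mu m * cos_pow_gen m.-1 r - (coef_d mu m + 4 * n%:R * m%:R) * cos_pow_gen m r.

(** The [h^2] error in [diffusion_step] requires the generator to be applied twice; the second
    application follows by linearity. *)
Lemma jacobi_gen_cos_pow_gen m :
  jacobi_gen (2 * n%:R - 1) (mu + 1) (cos_pow_gen m) (cos_pow_gen2 m).
Proof.
apply: (@jacobi_gen_intro _ _ _
  (fun x => coef_d mu m * cos_pow1 m.-1 x - (coef_d mu m + 4 * n%:R * m%:R) * cos_pow1 m x)
  (fun x => coef_d mu m * cos_pow2 m.-1 x - (coef_d mu m + 4 * n%:R * m%:R) * cos_pow2 m x)).
- move=> x; exact: (is_deriveB (is_deriveZ _ (is_derive_cos_pow m.-1 x))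
    (is_deriveZ _ (is_derive_cos_pow m x))).
- move=> x; exact: (is_deriveB (is_deriveZ _ (is_derive_cos_pow1 m.-1 x))
    (is_deriveZ _ (is_derive_cos_pow1 m x))).
- by move=> x; apply: cvgB; apply: cvgM;
    [exact: cvg_cst|exact: continuous_cos_pow2|exact: cvg_cst|exact: continuous_cos_pow2].
- by move=> x; apply: cvgB; apply: cvgM;
    [exact: cvg_cst|exact: continuous_cos_pow_gen|exact: cvg_cst|exact: continuous_cos_pow_gen].
- by rewrite !cos_pow1_0 !mulr0 subr0.
- by rewrite !cos_pow1_pi2 !mulr0 subr0.
- move=> r r0; rewrite /cos_pow_gen2 !cos_pow_genE//.
  by move: (cos_pow1 m r) (cos_pow1 m.-1 r) (cos_pow2 m r) (cos_pow2 m.-1 r)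
    (sin r / cos r) (cos r / sin r) => x1 x2 x3 x4 x5 x6; ring.
Qed.

Lemma cos_pow_bound m r : `|cos_pow m r| <= 1.
Proof. by rewrite normrX exprn_ile1// ler_norml cos_geN1 cos_le1. Qed.

Context (mu0 : 0 <= mu).

Definition cos_pow_coef (m : nat) : R := coef_d mu m + (coef_d mu m + 4 * n%:R * m%:R).

Lemma coef_d_ge0 m : 0 <= coef_d mu m.
Proof. by rewrite !mulr_ge0// !addr_ge0. Qed.

Lemma cos_pow_lin_bound (m : nat) (a b C D : R) : `|a| <= C -> `|b| <= D ->
  `|coef_d mu m * a - (coef_d mu m + 4 * n%:R * m%:R) * b| <=
  coef_d mu m * C + (coef_d mu m + 4 * n%:R * m%:R) * D.
Proof.
move=> aC bD; have c0 := coef_d_ge0 m.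
have k0 : 0 <= coef_d mu m + 4 * n%:R * m%:R by rewrite addr_ge0// !mulr_ge0.
move: (coef_d mu m) (coef_d mu m + 4 * n%:R * m%:R) c0 k0 => c k c0 k0.
apply: (le_trans (ler_normB _ _)); rewrite !normrM (ger0_norm k0) (ger0_norm c0).
by rewrite lerD// ler_wpM2l.
Qed.

(** From [1 + x <= exp x] follows [exp (- x) <= 1 / (1 + x)], and [1 / (1 + x) - 1 + x] equals
    [x^2 / (1 + x)]. *)
Lemma expRN_bounds (x : R) : 0 <= x -> `|expR (- x) - 1 + x| <= x ^+ 2.
Proof.
move=> x0; rewrite ger0_norm; last first.
  by have := expR_ge1Dx (- x); lra.
have e1 : 1 + x <= expR x := expR_ge1Dx x.
have e0 : 0 < expR x := expR_gt0 x.
have eN : expR (- x) * expR x = 1 by rewrite -expRD addNr expR0.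
have eN0 : 0 <= expR (- x) := expR_ge0 _.
have : expR (- x) * (1 + x) <= 1 by rewrite -[leRHS]eN ler_wpM2l.
by nra.
Qed.

Context (d : measure_display) (Omega : measurableType d)
  (P : probability Omega R) (F : R -> set (set Omega)) (X : R -> Omega -> R)
  (JP : jacobi_process P (2 * n%:R - 1) (mu + 1) F 0 X).

Definition cos_moment (m : nat) (s : R) : R :=
  expect P (fun omega => cos_pow m (X s omega)).

Lemma continuous_jacobi_bounded_rv (f : R -> R) (C s : R) : continuous f ->
  (forall x, `|f x| <= C) -> 0 <= s -> bounded_rv (fun omega => f (X s omega)).
Proof.
move=> cf fC s0; have [[FF aX _ _ _] _] := JP.
apply: (@rv_measurable_bounded _ _ _ F s _ C FF s0); last by move=> omega.
exact: (adapted_rv_measurable FF aX cf s0).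
Qed.

(** The exponential shifts the diagonal coefficient [coef_d m + 4 n m] by [2 n mu], which turns it
    into [coef_c m]. *)
Definition jacobi_moment (m : nat) (s : R) : R :=
  expR (- (2 * n%:R * mu * s)) * cos_moment m s.

Lemma jacobi_moment0 m : jacobi_moment m 0 = 1.
Proof.
rewrite /jacobi_moment mulr0 oppr0 expR0 mul1r -[RHS](expect_cst P).
apply: expect_ae.
- by case: (continuous_jacobi_bounded_rv (@continuous_cosX m.*2) (cos_pow_bound m) (lexx 0)).
- exact: measurable_cst.
have [[_ _ X0 _ _] _] := JP; apply: filterS X0 => omega ->.
by rewrite /cos_pow cos0 expr1n.
Qed.

Lemma cos_moment_step m : exists2 C : R, 0 <= C & forall s h : R, 0 <= s -> 0 <= h ->
  `|cos_moment m (s + h) - cos_moment m s - h * (coef_d mu m * cos_moment m.-1 s -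
      (coef_d mu m + 4 * n%:R * m%:R) * cos_moment m s)| <= C * h ^+ 2.
Proof.
pose k := coef_d mu m + 4 * n%:R * m%:R.
have gB i r : `|cos_pow_gen i r| <= cos_pow_coef i.
  by have := cos_pow_lin_bound i (cos_pow_bound i.-1 r) (cos_pow_bound i r); rewrite !mulr1.
have g2B r := cos_pow_lin_bound m (gB m.-1 r) (gB m r).
have cg2 : continuous (cos_pow_gen2 m).
  by move=> x; apply: cvgB; apply: cvgM;
    [exact: cvg_cst|exact: continuous_cos_pow_gen|exact: cvg_cst|exact: continuous_cos_pow_gen].
exists (coef_d mu m * cos_pow_coef m.-1 + k * cos_pow_coef m).
  exact: le_trans (g2B 0).
move=> s h s0 h0.
have m1 : rv_measurable (F s) (fun=> 1 : R) by rewrite /rv_measurable; exact: measurable_cst.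
have n1 (omega : Omega) : `|1 : R| <= 1 by rewrite normr1.
have [dX _] := JP.
have := diffusion_step dX (jacobi_gen_cos_pow m) (jacobi_gen_cos_pow_gen m)
  (@continuous_cosX m.*2) (@continuous_cos_pow_gen m) cg2 (cos_pow_bound m) (gB m)
  g2B s0 h0 m1 n1.
clear n1 m1.
under eq_fun do rewrite mul1r.
have bf i u (u0 : 0 <= u) :=
  continuous_jacobi_bounded_rv (@continuous_cosX i.*2) (cos_pow_bound i) u0.
have bg := continuous_jacobi_bounded_rv (@continuous_cos_pow_gen m) (gB m) s0.
have sh0 : 0 <= s + h by rewrite addr_ge0.
rewrite (expectB P (bounded_rvB (bf m _ sh0) (bf m _ s0))
  (bounded_rvM (bounded_rv_cst Omega h) bg)).
rewrite (expectB P (bf m _ sh0) (bf m _ s0)) (expectZ P h bg).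
have scl (c0 : R) (Y : Omega -> R) : bounded_rv Y -> bounded_rv (fun omega => c0 * Y omega).
  by move=> bY; apply: bounded_rvM => //; exact: bounded_rv_cst.
rewrite [X in h * X](expectB P (scl (coef_d mu m) _ (bf m.-1 _ s0)) (scl k _ (bf m _ s0))).
by rewrite (expectZ P _ (bf m.-1 _ s0)) (expectZ P _ (bf m _ s0)).
Qed.

Lemma jacobi_moment_step m : exists2 C : R, 0 <= C & forall s h : R,
  0 <= s -> 0 <= h -> h <= 1 ->
  `|jacobi_moment m (s + h) - jacobi_moment m s -
    h * (coef_d mu m * jacobi_moment m.-1 s - coef_c n mu m * jacobi_moment m s)|
  <= C * h ^+ 2.
Proof.
have [C C0 CK] := cos_moment_step m.
pose th := 2 * n%:R * mu; have th0 : 0 <= th by rewrite !mulr_ge0.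
pose k := coef_d mu m + 4 * n%:R * m%:R.
pose G := coef_d mu m + k.
have G0 : 0 <= G by rewrite !addr_ge0 ?coef_d_ge0// !mulr_ge0.
have CG0 : 0 <= C + G := addr_ge0 C0 G0.
exists (C + th ^+ 2 + th * (C + G)).
  by apply: addr_ge0; [apply: addr_ge0 => //; exact: sqr_ge0|exact: mulr_ge0].
move=> s h s0 h0 h1; have := CK s h s0 h0.
have Kb i u : 0 <= u -> `|cos_moment i u| <= 1.
  move=> u0; apply: expect_norm_le => [|omega]; last exact: cos_pow_bound.
  exact: (continuous_jacobi_bounded_rv (@continuous_cosX i.*2) (cos_pow_bound i) u0).
have Kg := cos_pow_lin_bound m (Kb m.-1 s s0) (Kb m s s0).
rewrite !mulr1 in Kg.
have Kh := Kb m (s + h) (addr_ge0 s0 h0).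
have Eh := expRN_bounds (mulr_ge0 th0 h0).
rewrite /jacobi_moment -/th (_ : - (th * (s + h)) = - (th * s) + - (th * h)); last by ring.
rewrite expRD.
have es : `|expR (- (th * s))| <= 1.
  by rewrite ger0_norm ?expR_ge0// -expR0 ler_expR oppr_le0 mulr_ge0.
have -> : coef_c n mu m = k + th by rewrite /coef_c /weight /k /th; field.
rewrite -/k in Kg *; move: es Eh Kh Kg.
move: (expR (- (th * s))) (expR (- (th * h))) (cos_moment m (s + h)) (cos_moment m s)
  (cos_moment m.-1 s) => e eh K1 K0 Kp es Eh Kh Kg KC.
set g := coef_d mu m * Kp - k * K0 in KC Kg *.
(* The three terms are the error in the recursion for the cosine moment, the second-order remainder
   of the exponential, and the product of the two first-order increments. *)
rewrite (_ : _ - _ - _ = e * ((K1 - K0 - h * g) + (eh - 1 + th * h) * K1 -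
  th * h * ((K1 - K0 - h * g) + h * g))); last by rewrite /g; ring.
rewrite normrM; apply: (@le_trans _ _ (1 * (C * h ^+ 2 + (th * h) ^+ 2 * 1 +
  th * h * (C * h ^+ 2 + h * G)))).
  apply: ler_pM => //; apply: (le_trans (ler_normB _ _)); apply: lerD.
    by apply: (le_trans (ler_normD _ _)); rewrite lerD// normrM ler_pM.
  rewrite normrM (ger0_norm (mulr_ge0 th0 h0)) ler_wpM2l ?mulr_ge0//.
  apply: (le_trans (ler_normD _ _)); rewrite lerD// normrM (ger0_norm h0).
  by rewrite ler_wpM2l.
have hh : h * h ^+ 2 <= h ^+ 2 by rewrite ler_piMl// exprn_ge0.
have : th * C * (h * h ^+ 2) <= th * C * h ^+ 2 by rewrite ler_wpM2l// mulr_ge0.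
by rewrite !mulr1 mul1r; nra.
Qed.

End jacobi_moments.

(** * Expectations through a density *)

Section expectation_density.
Context (R : realType).

Context (d : measure_display) (Omega : measurableType d) (P : probability Omega R)
  (X : Omega -> measurableTypeR R) (mX : measurable_fun setT X)
  (D : set (measurableTypeR R)) (mD : measurable D)
  (q : measurableTypeR R -> R) (mq : measurable_fun D q) (q0 : forall r, D r -> 0 <= q r)
  (law : forall B : set (measurableTypeR R), measurable B ->
    P (X @^-1` B) = (\int[lebesgue_measure]_(r in D `&` B) (q r)%:E)%E).

Lemma density_integrable : lebesgue_measure.-integrable D (EFin \o q).
Proof.
apply/integrableP; split; first exact/measurable_EFinP.
under eq_integral => r rD do
  rewrite /= ger0_norm ?(q0 (set_mem rD))//.
by rewrite -(setIT D) -law// preimage_setT probability_setT ltry.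
Qed.

Lemma density_total : \int[lebesgue_measure]_(r in D) q r = 1.
Proof.
rewrite /Rintegral -(setIT D) -law// preimage_setT.
exact: (congr1 fine (probability_setT P)).
Qed.

Lemma density_mul_integrable (f : measurableTypeR R -> R) (C : R) : measurable_fun setT f ->
  (forall r, `|f r| <= C) ->
  lebesgue_measure.-integrable D (EFin \o (fun r => q r * f r)).
Proof.
move=> mf fC; have C0 : 0 <= C := le_trans (normr_ge0 _) (fC 0).
have iC := integrableZl mD C density_integrable.
apply: (le_integrable mD _ _ iC).
  by apply/measurable_EFinP; apply: measurable_funM => //; exact: measurable_funTS.
move=> r Dr /=; rewrite lee_fin normrM normrM (ger0_norm C0) mulrC.
by rewrite ler_wpM2r.
Qed.

Lemma density_integral_norm_le (f : measurableTypeR R -> R) (C : R) : measurable_fun setT f ->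
  (forall r, `|f r| <= C) -> `|\int[lebesgue_measure]_(r in D) (q r * f r)| <= C.
Proof.
move=> mf fC; have iqf := density_mul_integrable mf fC.
apply: (le_trans (le_normr_Rintegral mD iqf)).
rewrite -[leRHS]mulr1 -density_total -(RintegralZl _ mD density_integrable).
apply: le_Rintegral => //.
- exact: integrable_norm iqf.
- exact: integrableZl density_integrable.
- by move=> r Dr; rewrite normrM (ger0_norm (q0 Dr)) mulrC ler_wpM2r// q0.
Qed.

Lemma density_integral_indic (B : set (measurableTypeR R)) : measurable B ->
  \int[lebesgue_measure]_(r in D) (q r * \1_B r) = expect P (\1_B \o X).
Proof.
move=> mB.
have -> : expect P (\1_B \o X) = fine (P (X @^-1` B)).
  rewrite /expect /Rintegral (_ : (fun x => _) = EFin \o (\1_(X @^-1` B) : Omega -> R)).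
    rewrite integral_indic ?setIT//.
    by rewrite -[X in measurable X]setTI; exact: mX.
  by apply/funext => omega /=; rewrite !indicE; congr (_ %:R%:E).
rewrite law// /Rintegral integral_mkcondr; congr fine; apply: eq_integral => r _.
rewrite patchE indicE; case: (r \in B); first by rewrite mulr1.
by rewrite mulr0.
Qed.

(** The law is given on sets only. [f] is within [1 / (N + 1)] of a combination of [N + 1]
    indicators, and neither side moves by more than the uniform distance, because [q] has total mass
    one. *)
Lemma expect_density (f : measurableTypeR R -> R) : measurable_fun setT f ->
  (forall r, 0 <= f r <= 1) ->
  expect P (fun omega => f (X omega)) =
  \int[lebesgue_measure]_(r in D) (q r * f r).
Proof.
move=> mf f01.
have bX (g : measurableTypeR R -> R) C : measurable_fun setT g -> (forall r, `|g r| <= C) ->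
    bounded_rv (fun omega => g (X omega)).
  by move=> mg gC; split; [exact: measurableT_comp mg mX|exists C].
have f1 r : `|f r| <= 1 by have /andP[f0 f1] := f01 r; rewrite ger0_norm.
pose B N i := [set r : measurableTypeR R | i.+1%:R <= N%:R * f r].
have mB N i : measurable (B N i).
  have mN : measurable_fun setT (fun r => N%:R * f r) by exact: measurable_funM.
  rewrite -[X in measurable X]setTI.
  rewrite (_ : B N i = (fun r => N%:R * f r) @^-1` `[i.+1%:R, +oo[%classic).
    exact: mN.
  by apply/seteqP; split => r /=; rewrite in_itv/= andbT.
pose S N r : R := \sum_(i < N.+1) \1_(B N.+1 i) r.
have mS N : measurable_fun setT (S N).
  by apply: measurable_sum => i; exact: measurable_indic.
have SE N : expect P (fun omega => S N (X omega)) =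
    \int[lebesgue_measure]_(r in D) (q r * S N r).
  rewrite /S expect_sum; last first.
    move=> i; apply: (bX _ 1); first exact: measurable_indic.
    by move=> r; rewrite indicE; case: (_ \in _); rewrite ?normr1 ?normr0.
  have I (i : nat) : lebesgue_measure.-integrable D (EFin \o (fun r => q r * \1_(B N.+1 i) r)).
    apply: (@density_mul_integrable _ 1); first exact: measurable_indic.
    by move=> r; rewrite indicE; case: (_ \in _); rewrite ?normr1 ?normr0.
  elim: (index_enum _) => [|i s IH].
    rewrite big_nil /Rintegral; under eq_integral do rewrite big_nil mulr0.
    by rewrite integral0.
  rewrite big_cons IH -(density_integral_indic (mB _ _)) -RintegralD//; last first.
    elim: s {IH} => [|j s IH].
      rewrite (_ : _ \o _ = cst 0%E) ?integrable0//.
      by apply/funext => r /=; rewrite big_nil mulr0.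
    rewrite (_ : _ \o _ = (EFin \o (fun r => q r * \1_(B N.+1 j) r)) \+
      (EFin \o (fun r => q r * \sum_(j <- s) \1_(B N.+1 j) r))).
      exact: integrableD (I j) IH.
    by apply/funext => r /=; rewrite big_cons mulrDr EFinD.
  by apply: eq_Rintegral => r _; rewrite big_cons mulrDr.
have fS N r : `|f r - N.+1%:R^-1 * S N r| <= N.+1%:R^-1.
  have /andP[f0 fr1] := f01 r.
  have /sum_indicator_approx : 0 <= N.+1%:R * f r <= N.+1%:R.
    by rewrite mulr_ge0//= ler_piMr.
  rewrite (_ : \sum_(i < N.+1) _ = S N r); last first.
    apply: eq_bigr => i _; rewrite indicE; congr (nat_of_bool _)%:R.
    by apply/idP/idP => [H|/set_mem//]; exact: mem_set.
  move=> fS.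
  rewrite -(ler_pM2l (ltr0Sn R N)) mulfV// -{1}(gtr0_norm (ltr0Sn R N)) -normrM.
  by rewrite mulrBr mulVKf.
apply/eqP; rewrite -subr_eq0 -normr_le0; apply/ler_addgt0Pr => e e0.
rewrite add0r; near \oo => N.
have Ne : N.+1%:R^-1 <= e / 2.
  near: N; apply: (cvgr_le (0 : R)); first exact: cvg_harmonic.
  by rewrite divr_gt0.
have bf := bX f 1 mf f1.
have S1 r : `|N.+1%:R^-1 * S N r| <= 1 + N.+1%:R^-1.
  rewrite -[X in `|X|](subKr (f r)); apply: (le_trans (ler_normB _ _)).
  exact: lerD.
have mS' : measurable_fun setT (fun r => N.+1%:R^-1 * S N r) by exact: measurable_funM.
have bS := bX _ _ mS' S1.
have SB r : `|S N r| <= N.+1%:R.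
  rewrite /S; apply: (le_trans (ler_norm_sum _ _ _)).
  rewrite -[leRHS]mulr1 mulr_natl -[N.+1 in leRHS]card_ord -sumr_const.
  by apply: ler_sum => i _; rewrite indicE; case: (_ \in _); rewrite ?normr1 ?normr0.
have E1 : `|expect P (fun omega => f (X omega)) -
    expect P (fun omega => N.+1%:R^-1 * S N (X omega))| <= N.+1%:R^-1.
  rewrite -(expectB P bf bS); apply: expect_norm_le; first exact: bounded_rvB.
  by move=> omega; exact: fS.
have mfS : measurable_fun setT (fun r => f r - N.+1%:R^-1 * S N r) by exact: measurable_funB.
have E2 : `|\int[lebesgue_measure]_(r in D) (q r * f r) -
    \int[lebesgue_measure]_(r in D) (q r * (N.+1%:R^-1 * S N r))| <= N.+1%:R^-1.
  rewrite -RintegralB//; last 2 first.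
  - exact: density_mul_integrable mf f1.
  - exact: density_mul_integrable mS' S1.
  under eq_Rintegral do rewrite -mulrBr.
  exact: density_integral_norm_le mfS (fS N).
have E3 : \int[lebesgue_measure]_(r in D) (q r * (N.+1%:R^-1 * S N r)) =
    N.+1%:R^-1 * \int[lebesgue_measure]_(r in D) (q r * S N r).
  rewrite -(RintegralZl _ mD (density_mul_integrable (mS N) SB)).
  by apply: eq_Rintegral => r _; rewrite mulrCA.
move: E1 E2; rewrite (expectZ P _ (bX _ _ (mS N) SB)) SE E3.
move: (expect _ _) (Rintegral _ _ _) (Rintegral _ _ _) => x y z.
move: Ne; clear; move: (N.+1%:R^-1) => c; move: (c * z) => cz.
by rewrite !ler_norml => ? /andP[? ?] /andP[? ?]; apply/andP; split; lra.
Unshelve. all: by end_near. Qed.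

End expectation_density.

(** * Binomial series *)

Section binomial_series.
Context (R : realType) (gam : R) (gam0 : 0 <= gam).

(** The rising factorial of [gam] over [j!], that is, the coefficient of [(1 - x)^j] in
    [x^(- gam)]. *)
Definition binom_coef (j : nat) : R := \prod_(i < j) ((gam + i%:R) / i.+1%:R).

Definition binom_poly (k : nat) : {poly R} :=
  \sum_(j < k) binom_coef j *: (1 - 'X) ^+ j.

Lemma binom_coefS j : j.+1%:R * binom_coef j.+1 = (gam + j%:R) * binom_coef j.
Proof. by rewrite /binom_coef big_ord_recr/= mulrC -mulrA divfK// mulrC. Qed.

Lemma binom_coef_ge0 j : 0 <= binom_coef j.
Proof. by apply: prodr_ge0 => i _; rewrite divr_ge0// addr_ge0. Qed.

Lemma binom_polyS k (x : R) :
  (binom_poly k.+1).[x] = (binom_poly k).[x] + binom_coef k * (1 - x) ^+ k.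
Proof. by rewrite /binom_poly big_ord_recr/= hornerD hornerZ horner_exp !hornerE. Qed.

Lemma binom_poly0 (x : R) : (binom_poly 0).[x] = 0.
Proof. by rewrite /binom_poly big_ord0 horner0. Qed.

Lemma binom_poly_ge0 k (x : R) : x <= 1 -> 0 <= (binom_poly k).[x].
Proof.
move=> x1; elim: k => [|k IH]; first by rewrite binom_poly0.
by rewrite binom_polyS addr_ge0// mulr_ge0 ?binom_coef_ge0// exprn_ge0// subr_ge0.
Qed.

Lemma binom_poly_nd (x : R) : x <= 1 -> nondecreasing_seq (fun k => (binom_poly k).[x]).
Proof.
move=> x1; apply/nondecreasing_seqP => k; rewrite binom_polyS lerDl.
by rewrite mulr_ge0 ?binom_coef_ge0// exprn_ge0// subr_ge0.
Qed.

Lemma binom_poly1 k : (binom_poly k.+1).[1] = 1.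
Proof.
elim: k => [|k IH]; rewrite binom_polyS.
  by rewrite binom_poly0 /binom_coef big_ord0 expr0 mulr1 add0r.
by rewrite IH subrr expr0n/= mulr0 addr0.
Qed.

(** The function [x^(- gam)] solves [gam p + x p' = 0]. The truncated series solves it up to one
    boundary term, as the recurrence [binom_coefS] telescopes. *)
Lemma binom_poly_deriv k (x : R) :
  gam * (binom_poly k).[x] + x * (binom_poly k)^`().[x] =
  k%:R * binom_coef k * (1 - x) ^+ k.-1.
Proof.
elim: k => [|k IH].
  by rewrite /binom_poly big_ord0 linear0 horner0 !mulr0 !mul0r addr0.
have dS : (binom_poly k.+1)^`().[x] = (binom_poly k)^`().[x] -
    binom_coef k * (k%:R * (1 - x) ^+ k.-1).
  rewrite /binom_poly big_ord_recr/= derivD hornerD derivZ hornerZ.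
  have e1 : (1 - 'X : {poly R}).[x] = 1 - x by rewrite !hornerE.
  rewrite deriv_exp derivB derivC derivX sub0r mulN1r hornerMn hornerN horner_exp e1.
  by rewrite -[X in _ * X]mulr_natl !mulrN.
rewrite binom_polyS dS binom_coefS.
have -> : gam * ((binom_poly k).[x] + binom_coef k * (1 - x) ^+ k) +
    x * ((binom_poly k)^`().[x] - binom_coef k * (k%:R * (1 - x) ^+ k.-1)) =
    (gam * (binom_poly k).[x] + x * (binom_poly k)^`().[x]) +
    (gam * binom_coef k * (1 - x) ^+ k - x * k%:R * binom_coef k * (1 - x) ^+ k.-1).
  by move: (_.[x]) (_.[x]) => a b; ring.
rewrite IH; case: k {IH dS} => [|k] /=; first by rewrite !expr0; ring.
by rewrite exprS; ring.
Qed.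

Lemma powR_pred (x : R) : 0 < x -> x `^ gam = x `^ (gam - 1) * x.
Proof.
move=> x0; rewrite -[X in _ = _ * X](powRr1 (ltW x0)) -powRD ?subrK//.
by rewrite (gt_eqF x0) implybT.
Qed.

(* All terms but one cancel in the derivative of [x^gam p_k(x)]. *)
Lemma is_derive_binom k (x : R) : 0 < x ->
  is_derive x 1 (fun x => x `^ gam * (binom_poly k).[x])
    (x `^ (gam - 1) * (k%:R * binom_coef k * (1 - x) ^+ k.-1)).
Proof.
move=> x0; have H := is_deriveM (is_derive1_powR gam x0) (is_derive_poly (binom_poly k) x).
apply: (is_derive_eq H); rewrite -binom_poly_deriv /GRing.scale/= (powR_pred x0).
by ring.
Qed.

Lemma binom_mvt k (x : R) : 0 < x -> x <= 1 ->
  exists2 c : R, x <= c <= 1 & 1 - x `^ gam * (binom_poly k.+1).[x] =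
    c `^ (gam - 1) * ((gam + k%:R) * binom_coef k * (1 - c) ^+ k) * (1 - x).
Proof.
move=> x0 x1.
pose f (x : R) := x `^ gam * (binom_poly k.+1).[x].
have df y : x <= y -> is_derive y 1 f (y `^ (gam - 1) * (k.+1%:R * binom_coef k.+1 * (1 - y) ^+ k)).
  by move=> xy; apply: is_derive_binom; exact: lt_le_trans xy.
have cf : {within `[x, 1], continuous f}.
  apply/continuous_in_subspaceT => y /set_mem/=; rewrite in_itv/= => /andP[xy _].
  by apply: is_derive1_continuous; exact: df.
have dI y : y \in `]x, 1[%R ->
    is_derive y 1 f (y `^ (gam - 1) * (k.+1%:R * binom_coef k.+1 * (1 - y) ^+ k)).
  by rewrite in_itv/= => /andP[/ltW xy _]; exact: df.
have [c cx E] := MVT_segment x1 dI cf.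
exists c; first by move: cx; rewrite in_itv.
by rewrite -binom_coefS -E /f powR1 binom_poly1 mulr1.
Qed.

(** The derivative in [is_derive_binom] is nonnegative on the interval, so the product increases to
    its value [1] at [x = 1]. *)
Lemma binom_poly_le1 k (x : R) : 0 < x -> x <= 1 -> x `^ gam * (binom_poly k).[x] <= 1.
Proof.
move=> x0 x1; apply: (@le_trans _ _ (x `^ gam * (binom_poly k.+1).[x])).
  by rewrite ler_wpM2l ?powR_ge0//; exact: binom_poly_nd.
have [c /andP[xc c1] E] := binom_mvt k x0 x1.
rewrite -subr_ge0 E !mulr_ge0 ?powR_ge0 ?binom_coef_ge0 ?exprn_ge0 ?subr_ge0//.
by rewrite addr_ge0.
Qed.

(** Each of the [k] terms of the geometric sum of the [u^i], [i < k], is at least [u^k]. *)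
Lemma natr_expr_bounded (u : R) k : 0 <= u -> u < 1 -> k%:R * u ^+ k <= (1 - u)^-1.
Proof.
move=> u0 u1; have u10 : 0 < 1 - u by rewrite subr_gt0.
rewrite -[leRHS]mul1r ler_pdivlMr// mulrC.
apply: (@le_trans _ _ (1 - u ^+ k)); last by rewrite gerBl exprn_ge0.
have -> : 1 - u ^+ k = (1 - u) * \sum_(i < k) u ^+ i.
  by rewrite -[LHS]opprB subrX1 -mulNr opprB.
rewrite ler_pM2l//.
rewrite mulr_natl -[k in _ *+ k]card_ord -sumr_const; apply: ler_sum => i _.
by rewrite ler_wiXn2l ?(ltW u1)// ltnW.
Qed.

(** With [s = t^2] and [t = u^2], [s^k] is [t^k u^k u^k]. The factor [t^k] keeps the coefficient
    bounded, by [binom_poly_le1] at [1 - t]; the first [u^k] keeps [gam + k] bounded; the second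
    tends to zero. *)
Lemma binom_term_cvg (s : R) : 0 <= s -> s < 1 ->
  (gam + k%:R) * binom_coef k * s ^+ k @[k --> \oo] --> (0 : R).
Proof.
move=> s0 s1; pose t := Num.sqrt s; pose u := Num.sqrt t.
have st : s = t ^+ 2 by rewrite sqr_sqrtr.
have t0 : 0 <= t := sqrtr_ge0 s.
have tu : t = u ^+ 2 by rewrite sqr_sqrtr.
have u0 : 0 <= u := sqrtr_ge0 t.
have t1 : t < 1 by rewrite -(@ltr_pXn2r _ 2) ?nnegrE// -st expr1n.
have u1 : u < 1 by rewrite -(@ltr_pXn2r _ 2) ?nnegrE// -tu expr1n.
pose C := ((1 - t) `^ gam)^-1.
have t10 : 0 < 1 - t by rewrite subr_gt0.
have bC k : binom_coef k * t ^+ k <= C.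
  rewrite /C -[leRHS]mul1r ler_pdivlMr ?powR_gt0// mulrC.
  apply: le_trans (binom_poly_le1 k.+1 t10 _); last by rewrite gerBl.
  rewrite ler_wpM2l ?powR_ge0// binom_polyS subKr lerDr binom_poly_ge0//.
  by rewrite gerBl.
have C0 : 0 <= C by rewrite invr_ge0 powR_ge0.
have c0 : C * (gam + (1 - u)^-1) * u ^+ k @[k --> \oo] --> (0 : R).
  rewrite -[X in _ --> X](mulr0 (C * (gam + (1 - u)^-1))).
  by apply: cvgM; [exact: cvg_cst|apply: cvg_expr; rewrite ger0_norm].
apply: (squeeze_cvgr _ (cvg_cst (0 : R)) c0); apply: nearW => k.
rewrite !mulr_ge0 ?binom_coef_ge0 ?exprn_ge0 ?addr_ge0//=.
have -> : (gam + k%:R) * binom_coef k * s ^+ k =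
    (binom_coef k * t ^+ k) * ((gam + k%:R) * u ^+ k) * u ^+ k.
  have -> : s ^+ k = t ^+ k * (u ^+ k * u ^+ k).
    by rewrite -!exprMn -expr2 -tu -expr2 -st.
  by ring.
rewrite ler_wpM2r ?exprn_ge0// ler_pM ?mulr_ge0 ?binom_coef_ge0 ?exprn_ge0 ?addr_ge0//.
rewrite mulrDl lerD ?natr_expr_bounded//.
by rewrite ler_piMr// exprn_ile1// ltW.
Qed.

Lemma binom_series_cvg (x : R) : 0 < x -> x <= 1 ->
  x `^ gam * (binom_poly k).[x] @[k --> \oo] --> (1 : R).
Proof.
move=> x0 x1.
have s0 : 0 <= 1 - x by rewrite subr_ge0.
have s1 : 1 - x < 1 by rewrite gtrBl.
have cT : 1 - x^-1 * ((gam + k%:R) * binom_coef k * (1 - x) ^+ k)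
    @[k --> \oo] --> (1 : R).
  rewrite -[X in _ --> X]subr0 -[X in _ --> _ - X](mulr0 x^-1).
  apply: cvgB; first exact: cvg_cst.
  by apply: cvgM; [exact: cvg_cst|exact: binom_term_cvg].
rewrite -cvg_shiftS.
apply: (squeeze_cvgr _ cT (cvg_cst (1 : R))); apply: nearW => k.
rewrite binom_poly_le1// andbT lerBlDl -lerBlDr.
have [c /andP[xc c1] ->] := binom_mvt k x0 x1.
have c0 : 0 < c := lt_le_trans x0 xc.
have T0 : 0 <= (gam + k%:R) * binom_coef k.
  by rewrite mulr_ge0 ?binom_coef_ge0// addr_ge0.
have P0 : 0 <= (1 - c) ^+ k by rewrite exprn_ge0// subr_ge0.
(* In the mean value formula, [c^(gam - 1) <= 1 / c <= 1 / x] and [1 - c <= 1 - x], so the unknown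
   point [c] may be replaced by [x]. *)
apply: (@le_trans _ _ (x^-1 * ((gam + k%:R) * binom_coef k * (1 - x) ^+ k) * 1)).
  apply: ler_pM => //.
  - exact: mulr_ge0 (powR_ge0 _ _) (mulr_ge0 T0 P0).
  - apply: ler_pM => //; [exact: powR_ge0|exact: mulr_ge0| |].
      apply: (@le_trans _ _ c^-1); last by rewrite lef_pV2.
      rewrite -[leRHS]mul1r ler_pdivlMr// -(powR_pred c0).
      apply: (@le_trans _ _ (1 `^ gam)); last by rewrite powR1.
      by apply: ge0_ler_powR; rewrite ?nnegrE ?(ltW c0).
    by rewrite ler_wpM2l// lerXn2r ?nnegrE ?subr_ge0// lerB.
  - exact: ltW.
by rewrite mulr1.
Qed.

End binomial_series.

(** * The Jacobi expectation of the inverse weight *)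

Section jacobi_density.
Context (R : realType) (n : nat) (mu : R) (mu0 : 0 <= mu)
  (d : measure_display) (Omega : measurableType d)
  (P : probability Omega R) (F : R -> set (set Omega)) (X : R -> Omega -> R)
  (JP : jacobi_process P (2 * n%:R - 1) (mu + 1) F 0 X) (t : R) (t0 : 0 < t)
  (q : R -> R) (mq : measurable_fun `[0, pi / 2] q)
  (q0 : forall r, 0 <= r <= pi / 2 -> 0 <= q r)
  (law : forall B : set R, measurable B ->
    P (X t @^-1` B) =
    (\int[lebesgue_measure]_(r in `[0%R, (pi / 2)%R] `&` B) (q r)%:E)%E).

Let D : set (measurableTypeR R) := `[0%R, (pi / 2)%R]%classic.

Let q' : measurableTypeR R -> R := q.

Lemma jacobi_measurable : measurable_fun setT (X t : Omega -> measurableTypeR R).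
Proof.
have [[FF aX _ _ _] _] := JP; have [sF mF _] := FF.
apply: (rv_measurableP (sF _ (ltW t0)) (mF _ (ltW t0))).
by apply: (@adapted_rv_measurable _ _ _ _ F X id) => //; [move=> x; exact: cvg_id|exact: ltW].
Qed.

Let mD : measurable D. Proof. exact: measurable_itv. Qed.

Let q0' : forall r, D r -> 0 <= q' r.
Proof. by move=> r; rewrite /D/= in_itv/=; exact: q0. Qed.

Definition cos2_poly (p : {poly R}) (r : R) : R := p.[cos r ^+ 2].

Lemma continuous_cos2_poly p : continuous (cos2_poly p).
Proof.
move=> r; exact: (@continuous_comp _ _ _ (fun r : R => cos r ^+ 2) (horner p) r
  (@continuous_cosX R 2 r) (@continuous_horner R p _)).
Qed.

Lemma expect_cos2_poly (p : {poly R}) (C : R) : (forall y, 0 <= y <= 1 -> 0 <= p.[y] <= C) ->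
  expect P (fun omega => cos2_poly p (X t omega)) =
  \int[lebesgue_measure]_(r in D) (q' r * cos2_poly p r).
Proof.
move=> pC.
have C1 : 0 < 1 + C.
  have /pC/andP[p0 pc] : 0 <= (0 : R) <= 1 by rewrite lexx ler01.
  by rewrite ltr_pwDl// (le_trans p0).
have pB r : 0 <= cos2_poly p r <= C.
  by apply: pC; rewrite sqr_ge0/= -(cos2Dsin2 r) lerDl sqr_ge0.
have mp : measurable_fun setT (cos2_poly p : measurableTypeR R -> R).
  exact (continuous_measurable_fun (continuous_cos2_poly (p := p))).
(* Rescaling puts the values in [[0, 1]], as [expect_density] requires; [1 + C] keeps the divisor
   positive. *)
pose f : measurableTypeR R -> R := fun r => (1 + C)^-1 * cos2_poly p r.
have mf : measurable_fun setT f by apply: measurable_funM.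
have f01 r : 0 <= f r <= 1.
  have /andP[p0 pc] := pB r.
  rewrite /f mulr_ge0 ?invr_ge0 ?(ltW C1)//= mulrC ler_pdivrMr// mul1r.
  by rewrite (le_trans pc)// lerDr.
have pf r : cos2_poly p r = (1 + C) * f r by rewrite /f mulVKf// gt_eqF.
have f1 r : `|f r| <= 1 by have /andP[? ?] := f01 r; rewrite ger0_norm.
have bf : bounded_rv (fun omega => f (X t omega)).
  by split; [exact: measurableT_comp mf jacobi_measurable|exists 1].
under eq_fun do rewrite pf.
rewrite (expectZ P _ bf) (expect_density jacobi_measurable mD mq q0' law mf f01).
rewrite -(RintegralZl _ mD (density_mul_integrable mD mq q0' law mf f1)).
by apply: eq_Rintegral => r _; rewrite pf mulrCA.
Qed.

Lemma jacobi_moment_poly (p : {poly R}) :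
  \sum_(i < size p) p`_i * jacobi_moment n mu P X i t =
  expR (- (2 * n%:R * mu * t)) * expect P (fun omega => cos2_poly p (X t omega)).
Proof.
have bc i : bounded_rv (fun omega => cos_pow i (X t omega)).
  exact: (continuous_jacobi_bounded_rv JP (@continuous_cosX R i.*2) (cos_pow_bound i) (ltW t0)).
have bp i : bounded_rv (fun omega => p`_i * cos_pow i (X t omega)).
  by apply: bounded_rvM => //; exact: bounded_rv_cst.
have -> : (fun omega => cos2_poly p (X t omega)) =
    (fun omega => \sum_(i < size p) p`_i * cos_pow i (X t omega)).
  apply/funext => omega; rewrite /cos2_poly horner_coef; apply: eq_bigr => i _.
  by rewrite -exprM mul2n.
rewrite expect_sum; last by move=> i; exact: bp.
rewrite mulr_sumr; apply: eq_bigr => i _.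
by rewrite (expectZ P _ (bc i)) mulrCA.
Qed.

Lemma binom_poly_bound k (y : R) : 0 <= y <= 1 ->
  0 <= (binom_poly (mu / 2) k).[y] <= \sum_(j < k) binom_coef (mu / 2) j.
Proof.
have g0 : 0 <= mu / 2 by rewrite divr_ge0.
move=> /andP[y0 y1]; rewrite binom_poly_ge0//=.
elim: k => [|k IH]; first by rewrite binom_poly0 big_ord0.
rewrite binom_polyS big_ord_recr/= lerD// ler_piMr ?binom_coef_ge0//.
by rewrite exprn_ile1 ?subr_ge0// gerBl.
Qed.

(** The partial sums increase to the inverse weight, so monotone convergence applies, and the finite
    limit [S] makes the integral finite. It is applied on the half-open interval: at [pi / 2] the
    cosine vanishes and the series does not represent the integrand, but this point is a null
    set. *)
Lemma binom_density_cvg (S : R) :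
  expect P (fun omega => cos2_poly (binom_poly (mu / 2) k) (X t omega)) @[k --> \oo] --> S ->
  S = \int[lebesgue_measure]_(r in `[0, pi / 2]) (q r * (cos r `^ mu)^-1).
Proof.
have g0 : 0 <= mu / 2 by rewrite divr_ge0.
move=> cS.
pose D' : set (measurableTypeR R) := `[0%R, (pi / 2)%R[%classic.
have mD' : measurable D' by exact: measurable_itv.
have DD : D' `<=` D by apply: subset_itvl; rewrite bnd_simp.
pose g k (r : measurableTypeR R) : \bar R := (q' r * cos2_poly (binom_poly (mu / 2) k) r)%:E.
have cosP r : D' r -> 0 < cos r.
  rewrite /D'/= in_itv/= => /andP[r0 rpi].
  by rewrite cos_gt0_pihalf// rpi (lt_le_trans _ r0)// oppr_lt0 divr_gt0// pi_gt0.
have cos2_01 (r : R) : 0 <= cos r ^+ 2 <= 1.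
  by rewrite sqr_ge0/= -(cos2Dsin2 r) lerDl sqr_ge0.
have mp k : measurable_fun setT (cos2_poly (binom_poly (mu / 2) k) : measurableTypeR R -> R).
  exact (continuous_measurable_fun (continuous_cos2_poly (p := _))).
have mg k E : measurable E -> E `<=` D -> measurable_fun E (g k).
  move=> mE ED; apply/measurable_EFinP; apply: measurable_funM.
    exact: measurable_funS mD ED mq.
  exact: measurable_funTS.
have int_g k : (\int[lebesgue_measure]_(r in D') g k r)%E =
    (expect P (fun omega => cos2_poly (binom_poly (mu / 2) k) (X t omega)))%:E.
  rewrite (expect_cos2_poly (@binom_poly_bound k)) /Rintegral fineK.
    exact: (integral_itv_bndo_bndc (mg k D' mD' DD)).
  apply: integrable_fin_num => //.
  apply: (@density_mul_integrable _ _ _ P (X t) D mD q' mq q0' law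
    (cos2_poly (binom_poly (mu / 2) k)) (\sum_(j < k) binom_coef (mu / 2) j)) => //.
  move=> r; have /andP[p0 p1] := binom_poly_bound k (cos2_01 r).
  by rewrite ger0_norm.
have g_ge0 k r : D' r -> (0 <= g k r)%E.
  move=> /DD Dr; rewrite lee_fin mulr_ge0 ?q0'//.
  by have /andP[] := binom_poly_bound k (cos2_01 r).
have g_nd r : D' r -> {homo g^~ r : k l / (k <= l)%N >-> (k <= l)%E}.
  move=> /DD Dr k l kl; rewrite lee_fin ler_wpM2l ?q0'//.
  by apply: binom_poly_nd => //; have /andP[] := cos2_01 r.
have g_lim r : D' r -> g^~ r @ \oo --> (q' r * (cos r `^ mu)^-1)%:E.
  move=> D'r; have c0 := cosP r D'r.
  have y0 : 0 < cos r ^+ 2 by rewrite exprn_gt0.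
  have /andP[_ y1] := cos2_01 r.
  apply/cvg_EFin; first exact: nearW.
  have cE : (cos r ^+ 2) `^ (mu / 2) = cos r `^ mu.
    by rewrite -powR_mulrn ?(ltW c0)// -powRrM mulrC divfK.
  have h0 : cos r `^ mu != 0 by rewrite gt_eqF// powR_gt0.
  rewrite (_ : fine \o g^~ r = fun k => q' r * (cos r `^ mu)^-1 *
      ((cos r ^+ 2) `^ (mu / 2) * (binom_poly (mu / 2) k).[cos r ^+ 2])).
    rewrite -[X in _ --> X]mulr1; apply: cvgM; first exact: cvg_cst.
    exact: binom_series_cvg.
  by apply/funext => k /=; rewrite cE mulrA -[X in _ = X * _]mulrA mulVf// mulr1.
have cI : (expect P (fun omega =>
    cos2_poly (binom_poly (mu / 2) k) (X t omega)))%:E @[k --> \oo] -->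
    (\int[lebesgue_measure]_(r in D') limn (g^~ r))%E.
  under eq_fun do rewrite -int_g.
  exact: (cvg_monotone_convergence mD' (fun k => mg k D' mD' DD) g_ge0 g_nd).
have cS' : (expect P (fun omega =>
    cos2_poly (binom_poly (mu / 2) k) (X t omega)))%:E @[k --> \oo] --> S%:E.
  by apply/cvg_EFin => //; exact: nearW.
have := cvg_unique _ cS' cI.
have -> : (\int[lebesgue_measure]_(r in D') limn (g^~ r) =
    \int[lebesgue_measure]_(r in D') (q' r * (cos r `^ mu)^-1)%:E)%E.
  apply: eq_integral => r /set_mem D'r.
  by apply/cvg_lim => //; exact: g_lim.
rewrite integral_itv_bndo_bndc => [SE|]; first by rewrite /Rintegral -SE.
apply/measurable_EFinP; apply: measurable_funM; first exact: measurable_funS mD DD mq.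
apply: measurable_funTS; under eq_fun do rewrite -powRN.
apply: (measurableT_comp (f := fun x : R => x `^ (- mu))); first exact: measurable_powR.
exact (continuous_measurable_fun (@continuous_cos R)).
Qed.

End jacobi_density.

(** * Removal of the weight and conclusion *)

Section area_characteristic_function.
Context (R : realType) (n : nat) (d : measure_display) (Omega : measurableType d)
  (P : probability Omega R) (F : R -> set (set Omega))
  (w : R -> Omega -> 'M[R]_(n, 4)) (BM : brownian_motion_HP P F w)
  (a : R -> Omega -> 'rV[R]_3) (QA : quaternionic_area P w a)
  (lambda : 'rV[R]_3).

(** The empty sequence is a partition of [[0, 0]] and its area sum is zero; hence the constant [0]
    converges in probability to [a 0]. *)
Lemma area_time0 (tau : R) :
  expect P (fun omega => cos (tau + edot lambda (a 0 omega))) = cos tau.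
Proof.
have mE := @edot_area_measurable _ _ _ _ _ _ _ QA lambda 0 (lexx 0).
have part (N : nat) : itv_partition 0 (0 : R) ((fun=> [::]) N) by [].
have mesh0 : mesh 0 ((fun=> [::] : seq R) N) @[N --> \oo] --> (0 : R).
  by under eq_fun do rewrite /mesh big_ord0; exact: cvg_cst.
have E0 omega k : qim (area_sum (fun u => w u omega) [::]) 0 k = 0.
  rewrite /area_sum big1 ?scaler0 ?mxE// => j _.
  by rewrite big_ord0.
have XY k : cvg_in_probability P (fun (_ : nat) (_ : Omega) => 0) (fun omega => a 0 omega 0 k).
  move=> e e0; have := (QA k (lexx 0)).2 _ part mesh0 e e0.
  by under eq_fun do under eq_set do rewrite E0.
have cE := @cvg_in_probability_cos R d Omega P 'I_3 (fun _ _ _ => 0)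
  (fun k omega => a 0 omega 0 k) (fun k => lambda 0 k) tau (fun=> 1)
  (fun _ _ => measurable_cst _) (fun k => (QA k (lexx 0)).1) XY
  (bounded_rv_cst Omega 1) (fun=> ltac:(by rewrite normr1)).
have cT : expect P (fun omega : Omega => cos (tau + \sum_k lambda 0 k * 0) * 1)
    @[N --> \oo] --> cos tau.
  rewrite (_ : (fun=> expect P _) = fun=> cos tau); first exact: cvg_cst.
  apply/funext => _; rewrite expect_cst mulr1; congr cos.
  by rewrite big1 ?addr0// => k _; rewrite mulr0.
have <- : expect P (fun omega => cos (tau + edot lambda (a 0 omega)) * 1) = cos tau.
  exact: (cvg_unique _ cE cT).
by congr (expect P); apply/funext => omega; rewrite mulr1.
Qed.

Context (mu : R) (mu0 : 0 <= mu)
  (mu_lambda : edot lambda lambda = mu ^+ 2 + 2 * mu)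
  (J : nat -> R -> R) (J0 : forall m, J m 0 = 1)
  (JS : forall m, exists2 C : R, 0 <= C & forall s h : R, 0 <= s -> 0 <= h -> h <= 1 ->
    `|J m (s + h) - J m s - h * (coef_d mu m * J m.-1 s - coef_c n mu m * J m s)|
    <= C * h ^+ 2).

Lemma hpowE m (v : R) : 0 <= v ->
  hpow mu m v = (1 + v)^-1 `^ (mu / 2) * (1 + v)^-1 ^+ m.
Proof.
move=> v0; have v1 : 0 < 1 + v by rewrite ltr_pwDl.
have x0 : 0 < (1 + v)^-1 by rewrite invr_gt0.
rewrite /hpow /weight -powR_mulrn ?(ltW x0)// -powRD; last by rewrite (gt_eqF x0) implybT.
by rewrite -[in RHS]powR_inv1 ?(ltW v1)// -powRrM mulN1r.
Qed.

Lemma area_poly_moment (tau t : R) (p : {poly R}) : 0 < t ->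
  expect P (fun omega => cos (tau + edot lambda (a t omega)) *
    ((1 + hnorm2 (w t omega))^-1 `^ (mu / 2) * p.[(1 + hnorm2 (w t omega))^-1])) =
  cos tau * \sum_(i < size p) p`_i * J i t.
Proof.
move=> t0.
have mE : measurable_fun setT (fun omega => tau + edot lambda (a t omega)).
  by apply: measurable_funD => //; apply: (edot_area_measurable QA); exact: ltW.
pose Y i omega := cos (tau + edot lambda (a t omega)) * hpow mu i (hnorm2 (w t omega)).
have bY i : bounded_rv (Y i).
  apply: bounded_rvM; first exact: bounded_rv_cos.
  split; first by apply: (hpow_measurable BM); exact: ltW.
  by exists 1 => omega; rewrite ger0_norm ?hpow_ge0 ?hpow_le1 ?hnorm2_ge0.
have bpY i : bounded_rv (fun omega => p`_i * Y i omega).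
  by apply: bounded_rvM => //; exact: bounded_rv_cst.
under eq_fun => omega.
  rewrite horner_coef mulr_sumr mulr_sumr.
  under eq_bigr => i _.
    rewrite [X in _ * X]mulrCA -(hpowE i (hnorm2_ge0 (w t omega))) mulrCA.
    rewrite -/(Y i omega); over.
  over.
rewrite expect_sum; last by move=> i; exact: bpY.
rewrite mulr_sumr; apply: eq_bigr => i _; rewrite (expectZ P _ (bY i)).
by rewrite (area_moment BM QA mu0 mu_lambda J0 JS tau i t0) mulrCA.
Qed.

(** The product of the weight [x^(mu/2)] and the partial sums of [x^(- mu/2)] stays in [[0, 1]] and
    tends to [1]; dominated convergence removes the weight. *)
Lemma area_binom_cvg (tau t : R) : 0 < t ->
  cos tau * \sum_(i < size (binom_poly (mu / 2) k)) (binom_poly (mu / 2) k)`_i * J i t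
    @[k --> \oo] --> expect P (fun omega => cos (tau + edot lambda (a t omega))).
Proof.
move=> t0; have g0 : 0 <= mu / 2 by rewrite divr_ge0.
under eq_fun do rewrite -area_poly_moment//.
have mE : measurable_fun setT (fun omega => tau + edot lambda (a t omega)).
  by apply: measurable_funD => //; apply: (edot_area_measurable QA); exact: ltW.
have [mc _] := bounded_rv_cos mE.
have mv := hnorm2_measurable BM (ltW t0).
have mx : measurable_fun setT (fun omega => (1 + hnorm2 (w t omega))^-1).
  rewrite (_ : (fun omega => _) = fun omega => (1 + hnorm2 (w t omega)) `^ (-1)).
    apply: (measurableT_comp (f := fun x : R => x `^ (-1))); first exact: measurable_powR.
    exact: measurable_funD.
  by apply/funext => omega; rewrite powR_inv1// addr_ge0// hnorm2_ge0.
have x0 omega : 0 < (1 + hnorm2 (w t omega))^-1.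
  by rewrite invr_gt0 ltr_pwDl// hnorm2_ge0.
have x1 omega : (1 + hnorm2 (w t omega))^-1 <= 1.
  by rewrite invf_le1 ?ltr_pwDl ?hnorm2_ge0// lerDl hnorm2_ge0.
apply: (@expect_cvg R d Omega P _ _ 1) => //.
- move=> k; apply: measurable_funM => //; apply: measurable_funM.
    by apply: (measurableT_comp (f := fun x : R => x `^ (mu / 2))) mx; exact: measurable_powR.
  apply: (measurableT_comp (f := horner (binom_poly (mu / 2) k))) mx.
  exact: continuous_measurable_fun (@continuous_horner R _).
- apply: aeW => omega; rewrite -[X in _ --> X]mulr1.
  by apply: cvgM; [exact: cvg_cst|exact: binom_series_cvg].
- apply: aeW => omega k; rewrite normrM mulr_ile1//.
    by rewrite ler_norml cos_geN1 cos_le1.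
  by rewrite ger0_norm ?binom_poly_le1// mulr_ge0 ?powR_ge0 ?binom_poly_ge0.
Qed.

End area_characteristic_function.

Lemma transition_integral_time0 (R : realType) (q : R -> R -> R -> R) (mu : R) :
  transition_integral q 0 0 (fun r => (cos r `^ mu)^-1) = 1.
Proof.
rewrite /transition_integral eqxx /Rintegral integral_dirac//.
  rewrite diracE mem_set/=; first by rewrite cos0 powR1 invr1 mulr1.
  by rewrite in_itv/= lexx divr_ge0// pi_ge0.
apply/measurable_EFinP; apply: measurable_funTS; under eq_fun do rewrite -powRN.
apply: (measurableT_comp (f := fun x : R => x `^ (- mu))); first exact: measurable_powR.
exact: continuous_measurable_fun (@continuous_cos R).
Qed.

Lemma area_cos_expectation (R : realType) (n : nat)
    (d : measure_display) (Omega : measurableType d)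
    (P : probability Omega R) (F : R -> set (set Omega))
    (w : R -> Omega -> 'M[R]_(n, 4)) (a : R -> Omega -> 'rV[R]_3)
    (lambda : 'rV[R]_3) (t mu tau : R) (q : R -> R -> R -> R) :
  brownian_motion_HP P F w -> quaternionic_area P w a -> 0 <= t ->
  0 <= mu -> edot lambda lambda = mu ^+ 2 + 2 * mu ->
  jacobi_transition_density (2 * n%:R - 1) (mu + 1) q ->
  expect P (fun omega => cos (tau + edot lambda (a t omega))) =
  cos tau * (expR (- (2 * n%:R * mu * t)) *
    transition_integral q t 0 (fun r => (cos r `^ mu)^-1)).
Proof.
move=> BM QA; rewrite le_eqVlt => /predU1P[<-|t0] mu0 mu_lambda [qpos qlaw].
  rewrite (area_time0 QA) transition_integral_time0.
  by rewrite mulr0 oppr0 expR0 !mulr1.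
have I0 : 0 <= (0 : R) <= pi / 2 by rewrite lexx divr_ge0// pi_ge0.
have [d1 [Om1 [P1 [F1 [X [JP law]]]]]] := qlaw 0 I0.
have [mq q0] := qpos t 0 t0 I0.
have A (tau' : R) := area_binom_cvg (tau := tau') BM QA mu0 mu_lambda (jacobi_moment0 (n := n) JP)
  (jacobi_moment_step mu0 JP) t0.
pose s k := expect P1 (fun omega => cos2_poly (binom_poly (mu / 2) k) (X t omega)).
pose e := expR (- (2 * n%:R * mu * t)).
have e0 : e != 0 by rewrite gt_eqF// expR_gt0.
have As (tau' : R) : cos tau' * (e * s k) @[k --> \oo] -->
    expect P (fun omega => cos (tau' + edot lambda (a t omega))).
  by have := A tau'; under eq_fun do rewrite (jacobi_moment_poly JP t0).
(* That the Jacobi expectations [s k] converge to a finite limit is read off the area side at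
   [tau = 0], where the cosine is not zero; [binom_density_cvg] then identifies this limit with the
   integral. *)
pose S := e^-1 * expect P (fun omega => cos (0 + edot lambda (a t omega))).
have sS : s k @[k --> \oo] --> S.
  rewrite (_ : s = fun k => e^-1 * (cos 0 * (e * s k))).
    by apply: cvgM; [exact: cvg_cst|exact: As].
  by apply/funext => k; rewrite cos0 mul1r mulKf.
have SE := binom_density_cvg mu0 JP t0 mq q0 (fun B => law t B t0) sS.
rewrite /transition_integral (gt_eqF t0) -SE.
have AS : cos tau * (e * s k) @[k --> \oo] --> cos tau * (e * S).
  by apply: cvgM; [exact: cvg_cst|apply: cvgM => //; exact: cvg_cst].
exact: (cvg_unique _ (As tau) AS).
Qed.

Local Open Scope complex_scope.

Theorem corollary4p7 (R : realType) (n : nat) (hn : (1 <= n)%N)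
    (d : measure_display) (Omega : measurableType d)
    (P : probability Omega R) (F : R -> set (set Omega))
    (w : R -> Omega -> 'M[R]_(n, 4)) (a : R -> Omega -> 'rV[R]_3)
    (lambda : 'rV[R]_3) (t mu : R) (q : R -> R -> R -> R) :
  brownian_motion_HP P F w ->
  quaternionic_area P w a ->
  (forall k, 0 <= lambda 0 k) ->
  0 <= t ->
  mu = Num.sqrt (enorm lambda ^+ 2 + 1) - 1 ->
  jacobi_transition_density (2 * n%:R - 1) (mu + 1) q ->
  cexpectation P (fun omega => expi (edot lambda (a t omega))) =
  (expR (- (2 * n%:R * mu * t)) *
   transition_integral q t 0 (fun r => (cos r `^ mu)^-1))%:C.
Proof.
move=> BM QA _ t0 muE JD.
have l0 : 0 <= edot lambda lambda by apply: sumr_ge0 => k _; exact: sqr_ge0.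
rewrite /enorm sqr_sqrtr// in muE.
have s0 : 0 <= edot lambda lambda + 1 by rewrite addr_ge0.
have mu0 : 0 <= mu.
  by rewrite muE subr_ge0 -[leLHS]sqrtr1 ler_wsqrtr// lerDr.
have mu_lambda : edot lambda lambda = mu ^+ 2 + 2 * mu.
  have H : (mu + 1) ^+ 2 = edot lambda lambda + 1 by rewrite muE subrK sqr_sqrtr.
  by rewrite -[LHS](addrK 1) -H; ring.
have E tau := @area_cos_expectation _ _ _ _ _ _ _ _ _ _ _ tau _ BM QA t0 mu0 mu_lambda JD.
have Ere : \int[P]_omega cos (edot lambda (a t omega)) =
    expR (- (2 * n%:R * mu * t)) *
    transition_integral q t 0 (fun r => (cos r `^ mu)^-1).
  have := E 0; rewrite cos0 mul1r => <-.
  by apply: eq_Rintegral => omega _; rewrite add0r.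
have Eim : \int[P]_omega sin (edot lambda (a t omega)) = 0.
  have := E (- (pi / 2)); rewrite cosN cos_pihalf mul0r => <-.
  apply: eq_Rintegral => omega _.
  by rewrite addrC cosBpihalf.
by rewrite /cexpectation /expi /= Ere Eim.
Qed.
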